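(* Let $d,n\in\mathbb N$, $\mathcal X=[-1,1]^d\cap\mathbb F^d$, $\delta>0$, $\mathcal D\subseteq\mathcal X$, let $f:\mathcal X\to\mathbb F^n$ be a classifier that is $\delta$-robust on $\mathcal D$, and let $\sigma:\overline{\mathbb F}\to\overline{\mathbb F}$ satisfy Condition 1. Then there exists a $\sigma$-network $\nu:\overline{\mathbb F}^d\to\overline{\mathbb F}^n$ that is $\delta$-provably robust on $\mathcal D$ and satisfies $\mathrm{class}(\nu(\mathbf x))=\mathrm{class}(f(\mathbf x))$ for all $\mathbf x\in\mathcal D$.
   Context: Floating point. Fix integers $E\ge 5$ and $M$ with $2^{E-1}\ge M\ge 3$; let $\mathfrak e_{\min}=-2^{E-1}+2$, $\mathfrak e_{\max}=2^{E-1}-1$. $\mathbb F=\{(-1)^b(s_0.s_1\dots s_M)_2\cdot 2^e: b,s_i\in\{0,1\},e\in\{\mathfrak e_{\min},\dots,\mathfrak e_{\max}\}\}$, $\overline{\mathbb F}=\mathbb F\cup\{-\infty,+\infty,\mathrm{NaN}\}$, $\Omega=2^{\mathfrak e_{\max}}(2-2^{-M})$, $\varepsilon=2^{-M-1}$; $x^+$ (resp. $x^-$) is the next larger (smaller) element of $\overline{\mathbb F}\setminus\{\mathrm{NaN}\}$. $\mathrm{rnd}:\mathbb R\to\overline{\mathbb F}$ is round-to-nearest-ties-to-even with overflow to $\pm\infty$ when $|x|\ge\Omega+2^{\mathfrak e_{\max}}\varepsilon$; $x\oplus y=\mathrm{rnd}(x+y)$, $x\otimes y=\mathrm{rnd}(xy)$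 for finite $x,y$ (IEEE-754 otherwise); sums $\bigoplus$ are evaluated left to right. Networks: $\mathrm{aff}_{W,\mathbf b}(\mathbf x)_i=(\bigoplus_{j}x_j\otimes w_{ij})\oplus b_i$ for $W\in\mathbb F^{m\times k}$, $\mathbf b\in\mathbb F^m$; a $\sigma$-network $\overline{\mathbb F}^{d_0}\to\overline{\mathbb F}^{d_L}$ is $\mathrm{aff}_{W_L,\mathbf b_L}\circ\tilde\sigma\circ\cdots\circ\tilde\sigma\circ\mathrm{aff}_{W_1,\mathbf b_1}$ with $\tilde\sigma$ coordinatewise $\sigma$. Intervals: $\mathbb I=\{\langle a,b\rangle:a,b\in\overline{\mathbb F}\setminus\{\mathrm{NaN}\},a\le b\}\cup\{\top\}$, $\gamma(\langle a,b\rangle)=[a,b]\cap\overline{\mathbb F}$, $\gamma(\top)=\overline{\mathbb F}$, $\gamma$ of a box is the product. For $\phi:\overline{\mathbb F}^k\to\overline{\mathbb F}$, $\phi^\sharp(\mathcal B)=\langle\min S,\max S\rangle$ ($S=\phi(\gamma(\mathcal B))$) if $\mathrm{NaN}\notin S$, else $\top$. $\langle a,b\rangle\odot^\sharp\langle c,d\rangle$ for $\odot\in\{\oplus,\otimes\}$ is $\langle\min S,\max S\rangle$ with $S=\{a\odot c,a\odot d,b\odot c,b\odot d\}$, or $\top$ if $\mathrm{NaN}\in S$ or an operand is $\top$. $\mathrm{aff}^\sharp_{W,\mathbf b}$ evaluates the formula of $\mathrm{aff}_{W,\mathbf b}$ with $\oplus^\sharp,\otimes^\sharp$ and singleton intervals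 for constants, and $\nu^\sharp$ is the composition of the $\mathrm{aff}^\sharp$ maps and coordinatewise $\sigma^\sharp$. Condition 1 on $\sigma$: (C1) there exist $c_1,c_2\in\mathbb F$ with $\sigma(c_1)=0$, $|\sigma(c_2)|\in[\frac\varepsilon2+2\varepsilon^2,\frac54-2\varepsilon]$, $\max\{|c_1|,|c_2|\}\ge2^{\mathfrak e_{\min}+1}$, and $\sigma(x)$ between $\sigma(c_1)$ and $\sigma(c_2)$ for all $x$ between $c_1,c_2$; (C2) there is $\eta\in\mathbb F$ with $|\eta|\in[2^{\mathfrak e_{\min}+5},4-8\varepsilon]$, $|\sigma(\eta)|,|\sigma(\eta^+)|\in[2^{\mathfrak e_{\min}+5},2^{\mathfrak e_{\max}-6}|\eta|]$, such that for all $x,y\in\mathbb F$ with $x\le\eta<\eta^+\le y$, either $\sigma(x)\le\sigma(\eta)<\sigma(\eta^+)\le\sigma(y)$ or $\sigma(x)\ge\sigma(\eta)>\sigma(\eta^+)\ge\sigma(y)$; (C3) there is $\lambda\in[0,2^{\mathfrak e_{\max}-7}\min\{|\sigma(\eta)|,2^{M+3}\}]$ with $|\sigma(x)-\sigma(\eta)|\le\lambda|x-\eta|$ and $|\sigma(y)-\sigma(\eta^+)|\le\lambda|y-\eta^+|$ for all $x,y\in\mathbb F$ with $x\le\eta<\eta^+\le y$. Classification: $\mathrm{class}(y_1,\dots,y_n)=\arg\max_{i\in[n]}y_i$ with an arbitrary fixed tie-breaking rule. $\mathcal N_\delta(\mathbf x_0)=\{\mathbf x\in\mathcal X:\|\mathbf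 x_0-\mathbf x\|_\infty\le\delta\}$. A classifier $f:\mathcal X\to\mathbb F^n$ is $\delta$-robust on $\mathcal D$ if for all $\mathbf x_0\in\mathcal D$ and $\mathbf y,\mathbf y'\in f(\mathcal N_\delta(\mathbf x_0))$, $\mathrm{class}(\mathbf y)=\mathrm{class}(\mathbf y')$. A network $\nu:\overline{\mathbb F}^d\to\overline{\mathbb F}^n$ is $\delta$-provably robust on $\mathcal D$ if for all $\mathbf x_0\in\mathcal D$ and $\mathbf y,\mathbf y'\in\gamma(\nu^\sharp(\mathcal B))$, $\mathrm{class}(\mathbf y)=\mathrm{class}(\mathbf y')$, where $\mathcal B\in\mathbb I^d$ is the abstract box with $\gamma(\mathcal B)=\mathcal N_\delta(\mathbf x_0)$. *)

(* Defs.v *)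
From Stdlib Require Import Reals ZArith List ClassicalEpsilon.
Import ListNotations.
Open Scope R_scope.

Inductive ext : Type := EF (r : R) | PInf | NInf | ENaN.

Section FP.
Variables E M : nat.

Definition emin : Z := (- 2 ^ (Z.of_nat E - 1) + 2)%Z.
Definition emax : Z := (2 ^ (Z.of_nat E - 1) - 1)%Z.

(** F = { (-1)^b (s_0.s_1...s_M)_2 * 2^e } = { m * 2^(e-M) : |m| <= 2^(M+1)-1 } *)
Definition isF (r : R) : Prop :=
  exists (m e : Z), (Z.abs m <= 2 ^ (Z.of_nat M + 1) - 1)%Z /\
    (emin <= e <= emax)%Z /\ r = IZR m * powerRZ 2 (e - Z.of_nat M).

Definition inFbar (x : ext) : Prop :=
  match x with EF r => isF r | _ => True end.

Definition Omega : R := powerRZ 2 emax * (2 - powerRZ 2 (- Z.of_nat M)).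
Definition eps : R := powerRZ 2 (- Z.of_nat M - 1).

(** round-to-nearest, ties to even (the even neighbour y of a tie {y,z}
    is the one that is an integer multiple of 2|y-z|) *)
Definition rnd_spec (x y : R) : Prop :=
  isF y /\ (forall z, isF z -> Rabs (x - y) <= Rabs (x - z)) /\
  (forall z, isF z -> z <> y -> Rabs (x - z) = Rabs (x - y) ->
     exists k : Z, y = IZR k * (2 * Rabs (y - z))).

Definition rnd (x : R) : ext :=
  if Rle_dec (Omega + powerRZ 2 emax * eps) (Rabs x) then
    (if Rle_dec 0 x then PInf else NInf)
  else EF (epsilon (inhabits 0) (rnd_spec x)).

Definition oplus (x y : ext) : ext :=
  match x, y with
  | EF a, EF b => rnd (a + b)
  | ENaN, _ | _, ENaN => ENaN
  | PInf, NInf | NInf, PInf => ENaN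
  | PInf, _ | _, PInf => PInf
  | NInf, _ | _, NInf => NInf
  end.

Definition inf_times (pos : bool) (a : R) : ext :=
  if Req_EM_T a 0 then ENaN
  else if Rlt_dec 0 a then (if pos then PInf else NInf)
  else (if pos then NInf else PInf).

Definition otimes (x y : ext) : ext :=
  match x, y with
  | ENaN, _ | _, ENaN => ENaN
  | EF a, EF b => rnd (a * b)
  | EF a, PInf | PInf, EF a => inf_times true a
  | EF a, NInf | NInf, EF a => inf_times false a
  | PInf, PInf | NInf, NInf => PInf
  | PInf, NInf | NInf, PInf => NInf
  end.

Definition fsum (l : list ext) : ext :=
  match l with [] => EF 0 | t :: ts => fold_left oplus ts t end.

Record layer := Layer { lW : list (list R); lb : list R }.

Definition layer_ok (k m : nat) (l : layer) : Prop :=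
  length (lW l) = m /\ Forall (fun row => length row = k /\ Forall isF row) (lW l) /\
  length (lb l) = m /\ Forall isF (lb l).

Fixpoint wf_net (k : nat) (ls : list layer) (n : nat) : Prop :=
  match ls with
  | [] => False
  | l :: ls' => exists m, layer_ok k m l /\
      ((ls' = [] /\ m = n) \/ (ls' <> [] /\ wf_net m ls' n))
  end.

Definition aff (l : layer) (x : list ext) : list ext :=
  map (fun p => oplus (fsum (map (fun q => otimes (fst q) (EF (snd q))) (combine x (fst p))))
                      (EF (snd p)))
      (combine (lW l) (lb l)).

Fixpoint eval_net (sigma : ext -> ext) (ls : list layer) (x : list ext) : list ext :=
  match ls with
  | [] => x
  | l :: ls' => match ls' with
                | [] => aff l x
                | _ => eval_net sigma ls' (map sigma (aff l x))
                end
  end.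

Definition le_ext (x y : ext) : Prop :=
  match x, y with
  | ENaN, _ | _, ENaN => False
  | NInf, _ => True
  | _, PInf => True
  | EF a, EF b => a <= b
  | _, _ => False
  end.

Definition lt_ext (x y : ext) : Prop := le_ext x y /\ x <> y.

Definition leb_ext (x y : ext) : bool :=
  match x, y with
  | ENaN, _ | _, ENaN => false
  | NInf, _ => true
  | _, PInf => true
  | EF a, EF b => if Rle_dec a b then true else false
  | _, _ => false
  end.

Definition min_ext (x y : ext) : ext := if leb_ext x y then x else y.
Definition max_ext (x y : ext) : ext := if leb_ext x y then y else x.

Definition is_nan (x : ext) : bool := match x with ENaN => true | _ => false end.

Definition next_spec (x y : ext) : Prop :=
  inFbar y /\ y <> ENaN /\ lt_ext x y /\
  forall z, inFbar z -> z <> ENaN -> lt_ext x z -> le_ext y z.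
Definition next_up (x : ext) : ext := epsilon (inhabits ENaN) (next_spec x).

Inductive itv : Type := Itv (a b : ext) | Top.

Definition valid_itv (I : itv) : Prop :=
  match I with
  | Itv a b => inFbar a /\ inFbar b /\ a <> ENaN /\ b <> ENaN /\ le_ext a b
  | Top => True
  end.

Definition in_gamma (I : itv) (x : ext) : Prop :=
  match I with
  | Itv a b => inFbar x /\ le_ext a x /\ le_ext x b
  | Top => inFbar x
  end.

Definition gamma_box (B : list itv) (y : list ext) : Prop := Forall2 in_gamma B y.

Definition sharp_spec (phi : ext -> ext) (I : itv) (J : itv) : Prop :=
  let S := fun y => exists x, in_gamma I x /\ phi x = y in
  (S ENaN /\ J = Top) \/
  (~ S ENaN /\ exists a b, J = Itv a b /\ S a /\ S b /\
      forall y, S y -> le_ext a y /\ le_ext y b).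
Definition sharp (phi : ext -> ext) (I : itv) : itv :=
  epsilon (inhabits Top) (sharp_spec phi I).

Definition isharp (op : ext -> ext -> ext) (I J : itv) : itv :=
  match I, J with
  | Itv a b, Itv c d =>
      let s1 := op a c in let s2 := op a d in let s3 := op b c in let s4 := op b d in
      if orb (orb (is_nan s1) (is_nan s2)) (orb (is_nan s3) (is_nan s4)) then Top
      else Itv (min_ext (min_ext s1 s2) (min_ext s3 s4))
               (max_ext (max_ext s1 s2) (max_ext s3 s4))
  | _, _ => Top
  end.

Definition isum (l : list itv) : itv :=
  match l with [] => Itv (EF 0) (EF 0) | t :: ts => fold_left (isharp oplus) ts t end.

Definition aff_sharp (l : layer) (X : list itv) : list itv :=
  map (fun p => isharp oplus
                  (isum (map (fun q => isharp otimes (fst q) (Itv (EF (snd q)) (EF (snd q))))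
                             (combine X (fst p))))
                  (Itv (EF (snd p)) (EF (snd p))))
      (combine (lW l) (lb l)).

Fixpoint eval_sharp (sigma : ext -> ext) (ls : list layer) (X : list itv) : list itv :=
  match ls with
  | [] => X
  | l :: ls' => match ls' with
                | [] => aff_sharp l X
                | _ => eval_sharp sigma ls' (map (sharp sigma) (aff_sharp l X))
                end
  end.

Definition C1 (sigma : ext -> ext) : Prop :=
  exists c1 c2 r2 : R, isF c1 /\ isF c2 /\ sigma (EF c1) = EF 0 /\ sigma (EF c2) = EF r2 /\
    eps / 2 + 2 * eps ^ 2 <= Rabs r2 <= 5 / 4 - 2 * eps /\
    Rmax (Rabs c1) (Rabs c2) >= powerRZ 2 (emin + 1) /\
    forall x, isF x -> Rmin c1 c2 <= x <= Rmax c1 c2 ->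
      exists s, sigma (EF x) = EF s /\ Rmin 0 r2 <= s <= Rmax 0 r2.

Definition C2 (sigma : ext -> ext) (eta : R) : Prop :=
  isF eta /\ powerRZ 2 (emin + 5) <= Rabs eta <= 4 - 8 * eps /\
  (exists s, sigma (EF eta) = EF s /\
     powerRZ 2 (emin + 5) <= Rabs s <= powerRZ 2 (emax - 6) * Rabs eta) /\
  (exists s, sigma (next_up (EF eta)) = EF s /\
     powerRZ 2 (emin + 5) <= Rabs s <= powerRZ 2 (emax - 6) * Rabs eta) /\
  forall x y, isF x -> isF y -> x <= eta -> le_ext (next_up (EF eta)) (EF y) ->
    (le_ext (sigma (EF x)) (sigma (EF eta)) /\
     lt_ext (sigma (EF eta)) (sigma (next_up (EF eta))) /\
     le_ext (sigma (next_up (EF eta))) (sigma (EF y))) \/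
    (le_ext (sigma (EF eta)) (sigma (EF x)) /\
     lt_ext (sigma (next_up (EF eta))) (sigma (EF eta)) /\
     le_ext (sigma (EF y)) (sigma (next_up (EF eta)))).

Definition C3 (sigma : ext -> ext) (eta : R) : Prop :=
  exists lam s0 s1 etap : R,
    sigma (EF eta) = EF s0 /\ next_up (EF eta) = EF etap /\ sigma (EF etap) = EF s1 /\
    0 <= lam <= powerRZ 2 (emax - 7) * Rmin (Rabs s0) (powerRZ 2 (Z.of_nat M + 3)) /\
    forall x y, isF x -> isF y -> x <= eta -> etap <= y ->
      (exists sx, sigma (EF x) = EF sx /\ Rabs (sx - s0) <= lam * Rabs (x - eta)) /\
      (exists sy, sigma (EF y) = EF sy /\ Rabs (sy - s1) <= lam * Rabs (y - etap)).

Definition condition1 (sigma : ext -> ext) : Prop :=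
  C1 sigma /\ exists eta : R, C2 sigma eta /\ C3 sigma eta.

Definition inX (d : nat) (x : list ext) : Prop :=
  length x = d /\ Forall (fun v => exists r, v = EF r /\ isF r /\ -1 <= r <= 1) x.

Definition inFvec (n : nat) (y : list ext) : Prop :=
  length y = n /\ Forall (fun v => exists r, v = EF r /\ isF r) y.

Definition inN (d : nat) (delta : R) (x0 x : list ext) : Prop :=
  inX d x /\ Forall2 (fun a b => exists r s, a = EF r /\ b = EF s /\ Rabs (r - s) <= delta) x0 x.

Definition robust (d : nat) (cls : list ext -> nat) (f : list ext -> list ext)
    (delta : R) (D : list ext -> Prop) : Prop :=
  forall x0, D x0 -> forall x x', inN d delta x0 x -> inN d delta x0 x' ->
    cls (f x) = cls (f x').

Definition provably_robust (d : nat) (cls : list ext -> nat) (sigma : ext -> ext)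
    (ls : list layer) (delta : R) (D : list ext -> Prop) : Prop :=
  forall x0, D x0 -> forall B : list itv, Forall valid_itv B ->
    (forall x, gamma_box B x <-> inN d delta x0 x) ->
    forall y y', gamma_box (eval_sharp sigma ls B) y -> gamma_box (eval_sharp sigma ls B) y' ->
      cls y = cls y'.

End FP.

(** class = argmax with an arbitrary (fixed) tie-breaking rule: any function
    returning an index of a maximal coordinate (on NaN-free vectors of length n) *)
Definition is_class (n : nat) (cls : list ext -> nat) : Prop :=
  forall y, length y = n -> Forall (fun v => v <> ENaN) y ->
    (cls y < n)%nat /\ forall j, (j < n)%nat -> le_ext (nth j y ENaN) (nth (cls y) y ENaN).

(* Main.v *)
(** Every wire carries a truth value: the activation is at most [sigma eta] or at least [sigma eta+] (or the other way
    round if [sigma] decreases at [eta]). For a box of inputs it is surely true, surely false, or undetermined, and a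
    classifier is built from the comparisons [x_j > c] and disjunctions of negated or plain wires: since the boxes of two
    points of [D] with different classes are disjoint in some coordinate, a disjunction of conjunctions of such comparisons
    is surely true on the boxes of one class and surely false on those of the others.

    The difficulty is that [sigma] may vary enormously away from [eta], so that one activation can drown the gap of
    another. Here rounding helps. Inside one neuron, adding and subtracting a constant [b] whose spacing is twice the gap
    doubles the gap while the overall range stays bounded; the constants are supplied by neurons with zero weights. As the
    Lipschitz constant of (C3) allows a weight [w] with [lam * w <= / 8] that still separates [sigma eta] from
    [sigma eta+], a layer of such neurons halves the undershoot below [eta]. Once it is of the size of a few units in the
    last place, further doublings collapse every false value to exactly [0], and two wires can be combined by addition. *)
Require Import Defs.
From Stdlib Require Import Reals ZArith List Lra Lia Classical ClassicalEpsilon.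
Import ListNotations.
Open Scope R_scope.

(** * Powers of two *)

(** The bias is added once and last, so every constant inside a sum must be a weight times a wire
    with a fixed value; that is why each neuron travels with copies of the constant wires. Interval
    arithmetic forgets correlations, hence every estimate is required for all independent
    combinations of wire values, including undetermined wires, of which only the range is known. One
    layer halves the undershoot because the factor 1/8 of the weight is doubled at most twice, by
    rounding the product and by rounding the final sum with [eta]. Negation exchanges undershoot and
    overshoot, and overshoot is never contracted; so each gate negates first, then contracts, then
    combines. The doublings start at [2 ^ (emin - M + 1)], since the rounding offset has to be a
    positive float smaller than the gap. They end at [2 ^ (1 - M)], the spacing of floats in [2, 4),
    which bounds the step from [eta] to its successor. Four further doublings make the first operand
    of a disjunction outweigh the undershoot [2 ^ (- M)] of the second one together with all
    rounding errors. *)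

Definition bp (e : Z) : R := powerRZ 2 e.

Lemma bp_pos e : 0 < bp e.
Proof. apply powerRZ_lt; lra. Qed.

Lemma bp_plus a b : bp (a + b) = bp a * bp b.
Proof. apply powerRZ_add; lra. Qed.

Lemma bp_0 : bp 0 = 1.
Proof. reflexivity. Qed.

Lemma bp_1 : bp 1 = 2.
Proof. unfold bp; simpl; lra. Qed.

Lemma bp_S e : bp (e + 1) = 2 * bp e.
Proof. rewrite bp_plus, bp_1; ring. Qed.

Lemma bp_shift (n : nat) e : bp (e + Z.of_nat n) = 2 ^ n * bp e.
Proof.
  rewrite bp_plus. unfold bp at 2. rewrite <- pow_powerRZ. ring.
Qed.

Lemma bp_IZR e : (0 <= e)%Z -> bp e = IZR (2 ^ e).
Proof.
  intros H. unfold bp. replace e with (Z.of_nat (Z.to_nat e)) by lia.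
  rewrite <- pow_powerRZ, <- pow_IZR. reflexivity.
Qed.

Lemma bp_le a b : (a <= b)%Z -> bp a <= bp b.
Proof.
  intros H. replace b with (a + Z.of_nat (Z.to_nat (b - a)))%Z by lia.
  rewrite bp_shift. pose proof (bp_pos a).
  assert (1 <= 2 ^ Z.to_nat (b - a)) by (apply pow_R1_Rle; lra). nra.
Qed.

Lemma bp_lt a b : (a < b)%Z -> bp a < bp b.
Proof.
  intros H. apply Rlt_le_trans with (bp (a + 1)).
  - rewrite bp_S. pose proof (bp_pos a). lra.
  - apply bp_le; lia.
Qed.

Lemma bp_lt_inv a b : bp a < bp b -> (a < b)%Z.
Proof.
  intros H. destruct (Z_lt_le_dec a b) as [|C]; auto.
  apply bp_le in C. lra.
Qed.

Lemma bp_opp e : bp (- e) * bp e = 1.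
Proof. rewrite <- bp_plus. replace (- e + e)%Z with 0%Z by lia. apply bp_0. Qed.

(** Expressing several powers as multiples of one of them leaves goals that [lra] can treat as
    linear. *)
Ltac rel x y n :=
  replace (bp x) with (2 ^ n * bp y)
    by (rewrite <- bp_shift; f_equal; lia).

Lemma binade x : 0 < x -> exists e, bp e <= x < bp (e + 1).
Proof.
  intros Hx.
  assert (up1 : forall (n : nat) e, bp e <= x -> x < bp (e + Z.of_nat n) ->
            exists e, bp e <= x < bp (e + 1)).
  { induction n as [|n IH]; intros e H1 H2.
    - rewrite Z.add_0_r in H2. lra.
    - destruct (Rlt_le_dec x (bp (e + 1))) as [H|H]; [now exists e|].
      apply (IH (e + 1)%Z); auto.
      now replace (e + 1 + Z.of_nat n)%Z with (e + Z.of_nat (S n))%Z by lia. }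
  assert (big : forall y, exists n : nat, y < bp (Z.of_nat n)).
  { intros y. destruct (Pow_x_infinity 2 ltac:(rewrite Rabs_right; lra) (y + 1)) as [N HN].
    exists N. specialize (HN N (Nat.le_refl _)). unfold bp.
    rewrite <- pow_powerRZ, Rabs_right in * by (apply Rle_ge, pow_le; lra). lra. }
  destruct (big (/ x)) as [k Hk]. destruct (big x) as [l Hl].
  apply (up1 (k + l)%nat (- Z.of_nat k)%Z).
  - pose proof (bp_opp (Z.of_nat k)). pose proof (bp_pos (Z.of_nat k)).
    pose proof (bp_pos (- Z.of_nat k)).
    assert (/ x * x = 1) by (field; lra). nra.
  - now replace (- Z.of_nat k + Z.of_nat (k + l))%Z with (Z.of_nat l) by lia.
Qed.

(** * Nearest integers, finite minima and relations between lists *)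

Lemma nearest_even t : exists N : Z,
  Rabs (t - IZR N) <= / 2 /\ (Rabs (t - IZR N) = / 2 -> Z.even N = true).
Proof.
  destruct (archimed t) as [H1 H2]. set (u := up t) in *.
  assert (IZR (u - 1) = IZR u - 1) by (rewrite minus_IZR; ring).
  destruct (Rtotal_order (IZR u - t) (/ 2)) as [H3|[H3|H3]].
  - exists u. rewrite Rabs_left by lra. split; intros; lra.
  - destruct (Z.even u) eqn:Eu.
    + exists u. split; auto. rewrite Rabs_left by lra. lra.
    + exists (u - 1)%Z. split.
      * rewrite H. rewrite Rabs_right by lra. lra.
      * intros _. rewrite Z.even_sub, Eu. reflexivity.
  - exists (u - 1)%Z. rewrite H, Rabs_right by lra. split; intros; lra.
Qed.

Lemma IZR_lt_le1 a b : IZR a < IZR b -> IZR a + 1 <= IZR b.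
Proof. intros H. apply lt_IZR in H. rewrite <- plus_IZR. apply IZR_le. lia. Qed.

Lemma Rabs_intro x a : - a <= x <= a -> Rabs x <= a.
Proof. intros H. unfold Rabs; destruct Rcase_abs; lra. Qed.

Lemma Rabs_elim x a : Rabs x <= a -> - a <= x <= a.
Proof. unfold Rabs; destruct Rcase_abs; lra. Qed.

(** Used on the finite list of all floats: it yields successors, extreme values of [sigma] on an
    interval, and the ends of neighbourhoods. *)
Lemma argmin (l : list R) (P : R -> Prop) (g : R -> R) : (exists x, In x l /\ P x) ->
  exists x, In x l /\ P x /\ forall y, In y l -> P y -> g x <= g y.
Proof.
  induction l as [|a l IH]; intros (x & Hx & Px); [destruct Hx|].
  destruct (classic (exists y, In y l /\ P y)) as [C|C].
  - destruct (IH C) as (z & Hz & Pz & Mz). destruct (classic (P a /\ g a <= g z)) as [[Pa Ga]|D].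
    + exists a. split; [now left|]. split; auto. intros y [<-|Hy] Py; [lra|].
      specialize (Mz y Hy Py). lra.
    + exists z. split; [now right|]. split; auto. intros y [<-|Hy] Py; auto.
      destruct (Rle_lt_dec (g z) (g a)); auto. exfalso. apply D. split; auto. lra.
  - destruct Hx as [->|Hx]; [|exfalso; eauto].
    exists x. split; [now left|]. split; auto. intros y [<-|Hy] Py; [lra|]. exfalso. eauto.
Qed.

Lemma Forall_choice {A B} (P : A -> B -> Prop) l : Forall (fun a => exists b, P a b) l ->
  exists l', Forall2 P l l'.
Proof.
  induction 1 as [|a l [b Hb] _ [l' IH]]; [exists []; constructor|].
  exists (b :: l'). now constructor.
Qed.

Lemma Forall2_comp {A B C} (P : A -> B -> Prop) (Q : B -> C -> Prop) (S : A -> C -> Prop) l1 l2 l3 :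
  Forall2 P l1 l2 -> Forall2 Q l2 l3 -> (forall a b c, P a b -> Q b c -> S a c) -> Forall2 S l1 l3.
Proof.
  intros H. revert l3. induction H; intros l3 H' HS; inversion H'; subst; constructor; eauto.
Qed.

Lemma Forall2_map_l {A B C} (g : A -> B) (P : B -> C -> Prop) l l' :
  Forall2 P (map g l) l' <-> Forall2 (fun a c => P (g a) c) l l'.
Proof.
  split.
  - revert l'. induction l; intros l' H; inversion H; subst; constructor; auto.
  - induction 1; simpl; constructor; auto.
Qed.

Lemma Forall2_seq {A} (P : nat -> A -> Prop) n : forall s l, length l = n ->
  (forall j, (j < n)%nat -> exists a, nth_error l j = Some a /\ P (s + j)%nat a) ->
  Forall2 P (seq s n) l.
Proof.
  induction n as [|n IH]; intros s l Hl H; destruct l as [|a l]; try discriminate; simpl; constructor.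
  - destruct (H 0%nat) as (a' & H1 & H2); [lia|]. injection H1 as <-. now rewrite Nat.add_0_r in H2.
  - apply IH; [now injection Hl|]. intros j Hj. destruct (H (S j)) as (a' & H1 & H2); [lia|].
    exists a'. split; auto. now rewrite Nat.add_succ_r in H2.
Qed.

Lemma Forall2_seq_inv {A} (P : nat -> A -> Prop) n : forall s l, Forall2 P (seq s n) l ->
  length l = n /\ forall j, (j < n)%nat -> exists a, nth_error l j = Some a /\ P (s + j)%nat a.
Proof.
  induction n as [|n IH]; intros s l H; simpl in H; inversion H as [|s' a n' l' Ha Hl]; subst.
  - split; auto. intros; lia.
  - destruct (IH _ _ Hl) as [H1 H2]. split; [simpl; lia|]. intros [|j] Hj.
    + exists a. now rewrite Nat.add_0_r.
    + destruct (H2 j) as (a' & H3 & H4); [lia|]. exists a'. split; auto.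
      now rewrite Nat.add_succ_r.
Qed.

(** The strict gap excludes ties at the maximum, so the tie-breaking rule cannot matter. *)
Lemma class_decided n cls i y lo hi : is_class n cls -> lo < hi -> (i < n)%nat ->
  Forall2 (fun j v => exists r, v = EF r /\ (j = i -> hi <= r) /\ (j <> i -> r <= lo)) (seq 0 n) y ->
  cls y = i.
Proof.
  intros Hcls Hlt Hi H. destruct (Forall2_seq_inv _ _ _ _ H) as [Hl Hn].
  destruct (Hcls y Hl) as [C1 C2].
  { apply Forall_forall. intros v Hv. apply In_nth_error in Hv. destruct Hv as [j Hj].
    assert (Hjn : (j < n)%nat) by (rewrite <- Hl; apply nth_error_Some; congruence).
    destruct (Hn j) as (a & H1 & r & -> & _); auto. congruence. }
  destruct (Nat.eq_dec (cls y) i) as [|Hne]; auto. exfalso.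
  specialize (C2 i Hi).
  destruct (Hn _ C1) as (a & H1 & r & -> & _ & Hr). destruct (Hn i Hi) as (a' & H2 & r' & -> & Hr' & _).
  rewrite (nth_error_nth _ _ _ H1), (nth_error_nth _ _ _ H2) in C2.
  simpl in *. specialize (Hr Hne). specialize (Hr' eq_refl). lra.
Qed.

(** * Floating-point numbers and rounding *)

Section Floats.
Variables E M : nat.
Hypothesis HE : (5 <= E)%nat.
Hypothesis HM : (3 <= M)%nat.
Hypothesis HEM : (M <= 2 ^ (E - 1))%nat.

Notation emin := (emin E).
Notation emax := (emax E).
Notation m := (Z.of_nat M).
Notation isF := (isF E M).

Lemma pow2_E : (16 <= 2 ^ (Z.of_nat E - 1))%Z.
Proof.
  change 16%Z with (2 ^ 4)%Z. apply Z.pow_le_mono_r; lia.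
Qed.

Lemma emin_emax : (emin + emax = 1)%Z.
Proof. unfold Defs.emin, Defs.emax; lia. Qed.

Lemma emax_ge : (15 <= emax)%Z.
Proof. pose proof pow2_E. unfold Defs.emax; lia. Qed.

Lemma M_le : (m <= emax + 1)%Z.
Proof.
  unfold Defs.emax. apply Nat2Z.inj_le in HEM. rewrite Nat2Z.inj_pow in HEM.
  rewrite Nat2Z.inj_sub in HEM by lia. simpl Z.of_nat in HEM. lia.
Qed.

Lemma M_ge : (3 <= m)%Z.
Proof. lia. Qed.

Ltac exps := let a := fresh "XE" in let b := fresh "XE" in let c := fresh "XE" in let d := fresh "XE" in
  pose proof emin_emax as a; pose proof emax_ge as b; pose proof M_le as c; pose proof M_ge as d.

(** The closed bound admits the mantissa [2 ^ (m + 1)], which is carried into the next exponent;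
    hence [e + m + 1] must not exceed [emax], while [isF_strict] reaches the top binade. *)
Lemma isF_intro N e r : r = IZR N * bp e -> (emin - m <= e)%Z -> (e + m + 1 <= emax)%Z ->
  Rabs r <= bp (e + m + 1) -> isF r.
Proof.
  intros -> H1 H2 H3.
  assert (HN : (Z.abs N <= 2 ^ (m + 1))%Z).
  { rewrite Rabs_mult, (Rabs_right (bp e)) in H3 by (pose proof (bp_pos e); lra).
    rewrite <- abs_IZR in H3.
    replace (e + m + 1)%Z with ((m + 1) + e)%Z in H3 by lia.
    rewrite bp_plus in H3. apply Rmult_le_reg_r in H3; [|apply bp_pos].
    rewrite bp_IZR in H3 by lia. now apply le_IZR in H3. }
  assert (Hp : (2 ^ (m + 1) = 2 * 2 ^ m)%Z) by (rewrite Z.pow_add_r by lia; lia).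
  assert (0 < 2 ^ m)%Z by (apply Z.pow_pos_nonneg; lia).
  destruct (Z.eq_dec (Z.abs N) (2 ^ (m + 1))) as [Heq|Hne].
  - exists (Z.sgn N * 2 ^ m)%Z, (e + m + 1)%Z. split; [|split].
    + rewrite Z.abs_mul. destruct N; simpl Z.sgn; rewrite ?(Z.abs_eq (2^m)); lia.
    + exps; lia.
    + replace N with (Z.sgn N * (2 * 2 ^ m))%Z at 1
        by (rewrite <- Hp, <- Heq; rewrite Z.mul_comm; apply Z.abs_sgn).
      change (powerRZ 2 (e + m + 1 - m)) with (bp (e + m + 1 - m)).
      replace (e + m + 1 - m)%Z with (e + 1)%Z by lia. rewrite bp_S, !mult_IZR. ring.
  - exists N, (e + m)%Z. split; [lia|split; [exps; lia|]].
    change (powerRZ 2 (e + m - m)) with (bp (e + m - m)).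
    now replace (e + m - m)%Z with e by lia.
Qed.

Lemma isF_strict N e r : r = IZR N * bp e -> (emin - m <= e)%Z -> (e + m <= emax)%Z ->
  Rabs r < bp (e + m + 1) -> isF r.
Proof.
  intros -> H1 H2 H3. exists N, (e + m)%Z. split; [|split].
  - rewrite Rabs_mult, (Rabs_right (bp e)) in H3 by (pose proof (bp_pos e); lra).
    rewrite <- abs_IZR in H3.
    replace (e + m + 1)%Z with ((m + 1) + e)%Z in H3 by lia.
    rewrite bp_plus in H3. apply Rmult_lt_reg_r in H3; [|apply bp_pos].
    rewrite bp_IZR in H3 by lia. apply lt_IZR in H3. lia.
  - lia.
  - change (powerRZ 2 (e + m - m)) with (bp (e + m - m)).
    now replace (e + m - m)%Z with e by lia.
Qed.

(** Representations in [isF] need not be normalised, but a mantissa below [2 ^ (m + 1)] still forces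
    the exponent to be at least [i]. *)
Lemma isF_canon r i : isF r -> bp i <= Rabs r -> exists N, r = IZR N * bp (i - m).
Proof.
  intros (n & e & Hn & He & ->) Hi.
  change (powerRZ 2 (e - m)) with (bp (e - m)) in *.
  assert (i < e + 1)%Z.
  { apply bp_lt_inv. eapply Rle_lt_trans; [exact Hi|].
    rewrite Rabs_mult, (Rabs_right (bp _)) by (pose proof (bp_pos (e - m)); lra).
    rewrite <- abs_IZR. replace (e + 1)%Z with ((m + 1) + (e - m))%Z by lia.
    rewrite bp_plus. apply Rmult_lt_compat_r; [apply bp_pos|].
    rewrite bp_IZR by lia. apply IZR_lt. lia. }
  exists (n * 2 ^ (e - i))%Z. rewrite mult_IZR, <- bp_IZR by lia.
  rewrite Rmult_assoc, <- bp_plus. do 2 f_equal. lia.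
Qed.

Lemma isF_sub r : isF r -> exists N, r = IZR N * bp (emin - m).
Proof.
  intros (n & e & Hn & He & ->).
  change (powerRZ 2 (e - m)) with (bp (e - m)) in *.
  exists (n * 2 ^ (e - emin))%Z. rewrite mult_IZR, <- bp_IZR by lia.
  rewrite Rmult_assoc, <- bp_plus. do 2 f_equal. lia.
Qed.

Lemma isF_opp r : isF r -> isF (- r).
Proof.
  intros (n & e & Hn & He & ->). exists (- n)%Z, e.
  rewrite opp_IZR, Z.abs_opp. repeat split; try lia. ring.
Qed.

Lemma isF_0 : isF 0.
Proof.
  exists 0%Z, emin. split; [|split].
  - simpl. assert (0 < 2 ^ (m + 1))%Z by (apply Z.pow_pos_nonneg; lia). lia.
  - exps; lia.
  - ring.
Qed.

Lemma isF_bp e : (emin - m <= e <= emax)%Z -> isF (bp e).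
Proof.
  intros H. exps. destruct (Z_lt_le_dec e emin).
  - apply (isF_intro 1 e); try lia; [ring|].
    rewrite Rabs_right by (pose proof (bp_pos e); lra). apply bp_le; lia.
  - apply (isF_strict (2 ^ m) (e - m)); try lia.
    + rewrite <- bp_IZR, <- bp_plus by lia. f_equal; lia.
    + rewrite Rabs_right by (pose proof (bp_pos e); lra). apply bp_lt; lia.
Qed.

Lemma isF_gap z f e : isF z -> isF f -> bp e <= f -> f < z -> f + bp (e - m) <= z.
Proof.
  intros Hz Hf H1 H2. pose proof (bp_pos e).
  destruct (isF_canon z e Hz) as [a ->]; [rewrite Rabs_right; lra|].
  destruct (isF_canon f e Hf) as [b ->]; [rewrite Rabs_right; lra|].
  pose proof (bp_pos (e - m)).
  apply Rmult_lt_reg_r in H2; auto. apply IZR_lt_le1 in H2. nra.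
Qed.

Lemma isF_gap_sub z f : isF z -> isF f -> f < z -> f + bp (emin - m) <= z.
Proof.
  intros Hz Hf H2. destruct (isF_sub z Hz) as [a ->]. destruct (isF_sub f Hf) as [b ->].
  pose proof (bp_pos (emin - m)).
  apply Rmult_lt_reg_r in H2; auto. apply IZR_lt_le1 in H2. nra.
Qed.

Lemma isF_scale f i t : isF f -> bp i <= Rabs f < bp (i + 1) ->
  (emin <= i + t <= emax)%Z -> isF (f * bp t).
Proof.
  intros Hf [H1 H2] Ht. destruct (isF_canon f i Hf H1) as [N HN].
  apply (isF_strict N (i + t - m)); try lia.
  - rewrite HN, Rmult_assoc, <- bp_plus. do 2 f_equal; lia.
  - rewrite Rabs_mult, (Rabs_right (bp t)) by (pose proof (bp_pos t); lra).
    replace (i + t - m + m + 1)%Z with ((i + 1) + t)%Z by lia. rewrite bp_plus.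
    apply Rmult_lt_compat_r; auto. apply bp_pos.
Qed.

(** Overflow begins at [bp emax * (2 - bp (- m - 1))]; the factor 3/2 stays clear of it and keeps
    the rounded value inside the top binade. *)
Definition safe (x : R) : Prop := Rabs x <= 3 / 2 * bp emax.
Definition rn (x : R) : R := epsilon (inhabits 0) (rnd_spec E M x).

Lemma rnd_grid x e N : (emin <= e <= emax)%Z -> (e = emin \/ bp e <= Rabs x) ->
  Rabs (x / bp (e - m) - IZR N) <= / 2 ->
  (Rabs (x / bp (e - m) - IZR N) = / 2 -> Z.even N = true) ->
  isF (IZR N * bp (e - m)) -> rnd_spec E M x (IZR N * bp (e - m)).
Proof.
  intros He Hx HN Hev HF. set (s := bp (e - m)) in *.
  assert (Hs : 0 < s) by apply bp_pos.
  assert (dist : forall K, Rabs (x - IZR K * s) = Rabs (x / s - IZR K) * s).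
  { intros K. rewrite <- (Rabs_right s) at 3 by lra. rewrite <- Rabs_mult. f_equal. field. lra. }
  assert (int : forall K, IZR K <> IZR N -> Rabs (x / s - IZR N) <= Rabs (x / s - IZR K) /\
     (Rabs (x / s - IZR K) = Rabs (x / s - IZR N) -> Rabs (x / s - IZR N) = / 2 /\
        Rabs (IZR N - IZR K) = 1)).
  { intros K HK.
    assert (1 <= Rabs (IZR N - IZR K)).
    { rewrite <- minus_IZR, <- abs_IZR. apply IZR_le.
      assert (N <> K) by (intros ->; auto). lia. }
    revert HN H. unfold Rabs; repeat destruct Rcase_abs; intros; split; intros;
      try split; lra. }
  assert (grid : forall z, isF z -> (exists K, z = IZR K * s) \/
            (e <> emin /\ Rabs z < bp e)).
  { intros z Hz. destruct (Rlt_le_dec (Rabs z) (bp e)) as [H|H].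
    - destruct (Z.eq_dec e emin) as [->|]; [left; now apply isF_sub|now right].
    - left. now apply isF_canon. }
  assert (out : forall z, e <> emin -> Rabs z < bp e ->
            Rabs (x - IZR N * s) < Rabs (x - z)).
  { intros z He' Hz. destruct Hx as [|Hx]; [contradiction|].
    assert (Hb : exists K, bp e = IZR K * s).
    { exists (2 ^ m)%Z. unfold s. rewrite <- bp_IZR, <- bp_plus by lia. f_equal; lia. }
    destruct Hb as [K HK].
    assert (near : forall K, Rabs (x - IZR N * s) <= Rabs (x - IZR K * s)).
    { intros K'. rewrite !dist. apply Rmult_le_compat_r; [lra|].
      destruct (Req_dec (IZR K') (IZR N)) as [->|]; [lra|]. now apply int. }
    pose proof (near K) as P1. pose proof (near (- K)%Z) as P2.
    rewrite opp_IZR in P2. replace (- IZR K * s) with (- bp e) in P2 by (rewrite HK; ring).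
    rewrite <- HK in P1. pose proof (bp_pos e).
    revert P1 P2 Hx Hz. generalize (Rabs (x - IZR N * s)). intros d.
    unfold Rabs; repeat destruct Rcase_abs; intros; lra. }
  split; [exact HF|split].
  - intros z Hz. destruct (grid z Hz) as [[K ->]|[H1 H2]].
    + rewrite !dist. apply Rmult_le_compat_r; [lra|].
      destruct (Req_dec (IZR K) (IZR N)) as [->|]; [lra|]. now apply int.
    + left. now apply out.
  - intros z Hz Hne Heq. destruct (grid z Hz) as [[K ->]|[H1 H2]].
    + rewrite !dist in Heq. apply Rmult_eq_reg_r in Heq; [|lra].
      assert (HK : IZR K <> IZR N) by (intros H; apply Hne; now rewrite H).
      destruct (int K HK) as [_ H]. destruct (H Heq) as [H1 H2].
      apply Hev in H1. apply Z.even_spec in H1. destruct H1 as [k ->].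
      exists k. rewrite <- Rmult_minus_distr_r, Rabs_mult, H2, (Rabs_right s) by lra.
      rewrite mult_IZR. ring.
    + pose proof (out z H1 H2). lra.
Qed.

Lemma rnd_exists x : safe x -> exists y, rnd_spec E M x y.
Proof.
  intros Hx. unfold safe in Hx. exps.
  assert (He : exists e, (emin <= e <= emax)%Z /\ (e = emin \/ bp e <= Rabs x) /\
                 Rabs x < bp (e + 1)).
  { destruct (Rlt_le_dec (Rabs x) (bp (emin + 1))) as [H3|H3].
    - exists emin. repeat split; auto; lia.
    - destruct (binade (Rabs x)) as [e [H4 H5]]; [pose proof (bp_pos (emin + 1)); lra|].
      exists e. repeat split; auto.
      + assert (emin + 1 < e + 1)%Z by (apply bp_lt_inv; lra). lia.
      + assert (e < emax + 1)%Z; [|lia]. apply bp_lt_inv.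
        rewrite bp_S. pose proof (bp_pos emax). lra. }
  destruct He as [e [He [He1 He2]]]. destruct (nearest_even (x / bp (e - m))) as [N [HN HN2]].
  exists (IZR N * bp (e - m)). apply rnd_grid; auto.
  pose proof (bp_pos (e - m)) as Hs.
  assert (Hd : Rabs (x - IZR N * bp (e - m)) <= / 2 * bp (e - m)).
  { replace (x - IZR N * bp (e - m)) with ((x / bp (e - m) - IZR N) * bp (e - m)) by (field; lra).
    rewrite Rabs_mult, (Rabs_right (bp (e - m))) by lra. apply Rmult_le_compat_r; lra. }
  assert (Hb : bp (e + 1) = IZR (2 ^ (m + 1)) * bp (e - m)).
  { rewrite <- bp_IZR, <- bp_plus by lia. f_equal; lia. }
  destruct (Z.eq_dec e emax) as [->|Hne].
  - apply (isF_strict N (emax - m)); auto; try lia.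
    replace (emax - m + m + 1)%Z with (emax + 1)%Z by lia.
    assert (Hsm : 8 * bp (emax - m) <= bp emax).
    { replace 8 with (bp 3) by (unfold bp; simpl; lra). rewrite <- bp_plus. apply bp_le; lia. }
    rewrite bp_S. revert Hd Hx. pose proof (bp_pos emax).
    unfold Rabs; repeat destruct Rcase_abs; intros; lra.
  - apply (isF_intro N (e - m)); auto; try lia.
    replace (e - m + m + 1)%Z with (e + 1)%Z by lia.
    rewrite Rabs_mult, (Rabs_right (bp (e - m))) by lra.
    rewrite Hb. apply Rmult_le_compat_r; [lra|]. rewrite <- abs_IZR. apply IZR_le.
    assert (HZ : IZR (Z.abs N) < IZR (2 ^ (m + 1)) + 1).
    { rewrite abs_IZR. apply Rmult_lt_reg_r with (bp (e - m)); auto.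
      rewrite Rmult_plus_distr_r, <- Hb.
      replace (Rabs (IZR N) * bp (e - m)) with (Rabs (IZR N * bp (e - m)))
        by (rewrite Rabs_mult, (Rabs_right (bp (e - m))); lra).
      revert Hd He2. unfold Rabs; repeat destruct Rcase_abs; intros; lra. }
    rewrite <- plus_IZR in HZ. apply lt_IZR in HZ. lia.
Qed.

Lemma rn_spec x : safe x -> rnd_spec E M x (rn x).
Proof. intros H. unfold rn. apply epsilon_spec. now apply rnd_exists. Qed.

Lemma rnd_rn x : safe x -> rnd E M x = EF (rn x).
Proof.
  intros H. unfold rnd. destruct Rle_dec as [H1|]; [exfalso|reflexivity].
  unfold safe in H. unfold Omega, eps in H1.
  change (powerRZ 2 emax) with (bp emax) in H1. change (powerRZ 2 (- m)) with (bp (- m)) in H1.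
  change (powerRZ 2 (- m - 1)) with (bp (- m - 1)) in H1.
  assert (bp (- m) = 2 * bp (- m - 1)) by (rewrite <- bp_S; f_equal; lia).
  assert (bp (- m - 1) <= bp (-2)) by (apply bp_le; lia).
  assert (bp (-2) = / 4) by (unfold bp; simpl; lra).
  assert (bp (- m - 1) < / 4).
  { rewrite <- H3. apply bp_lt; lia. }
  pose proof (bp_pos emax). nra.
Qed.

Lemma safe_bp x : Rabs x <= bp emax -> safe x.
Proof. unfold safe. pose proof (bp_pos emax). lra. Qed.

Lemma rn_F x : safe x -> isF (rn x).
Proof. intros H. apply (rn_spec x H). Qed.

Lemma rn_near x z : safe x -> isF z -> Rabs (x - rn x) <= Rabs (x - z).
Proof. intros H Hz. now apply (rn_spec x H). Qed.

Lemma rn_id x : safe x -> isF x -> rn x = x.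
Proof.
  intros H Hx. pose proof (rn_near x x H Hx) as P.
  rewrite Rminus_diag, Rabs_R0 in P. revert P.
  unfold Rabs; destruct Rcase_abs; intros; lra.
Qed.

Lemma rn_le x f : safe x -> isF f -> x <= f -> rn x <= f.
Proof.
  intros H Hf Hx. destruct (Req_dec x f) as [->|]; [rewrite rn_id; auto; lra|].
  destruct (Rle_lt_dec (rn x) f) as [|C]; auto.
  pose proof (rn_near x f H Hf) as P. revert P.
  unfold Rabs; repeat destruct Rcase_abs; intros; lra.
Qed.

Lemma rn_ge x f : safe x -> isF f -> f <= x -> f <= rn x.
Proof.
  intros H Hf Hx. destruct (Req_dec x f) as [->|]; [rewrite rn_id; auto; lra|].
  destruct (Rle_lt_dec f (rn x)) as [|C]; auto.
  pose proof (rn_near x f H Hf) as P. revert P.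
  unfold Rabs; repeat destruct Rcase_abs; intros; lra.
Qed.

Lemma rn_mono x y : safe x -> safe y -> x <= y -> rn x <= rn y.
Proof.
  intros Hx Hy H. destruct (Req_dec x y) as [->|]; [lra|].
  destruct (Rle_lt_dec (rn x) (rn y)) as [|C]; auto.
  pose proof (rn_near x (rn y) Hx (rn_F y Hy)) as P1.
  pose proof (rn_near y (rn x) Hy (rn_F x Hx)) as P2. revert P1 P2.
  unfold Rabs; repeat destruct Rcase_abs; intros; lra.
Qed.

(** Two distinct nearest floats would both be multiples of [2 * Rabs (y - y')], and so would be
    their difference, which has only half that size. *)
Lemma rnd_spec_unique x y y' : rnd_spec E M x y -> rnd_spec E M x y' -> y = y'.
Proof.
  intros (F1 & N1 & T1) (F2 & N2 & T2).
  destruct (Req_dec y y') as [|Hne]; auto. exfalso.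
  assert (Heq : Rabs (x - y) = Rabs (x - y')) by (apply Rle_antisym; auto).
  destruct (T1 y' F2 (not_eq_sym Hne) (eq_sym Heq)) as [k Hk].
  destruct (T2 y F1 Hne Heq) as [k' Hk'].
  rewrite (Rabs_minus_sym y' y) in Hk'.
  assert (Hd : 0 < Rabs (y - y')) by (apply Rabs_pos_lt; lra).
  assert (Hs : y - y' = IZR (k - k') * 2 * Rabs (y - y')).
  { rewrite Hk at 1. rewrite Hk' at 2. rewrite minus_IZR. ring. }
  assert (H1 : Rabs (y - y') = IZR (2 * Z.abs (k - k')) * Rabs (y - y')).
  { rewrite Hs at 1. rewrite !Rabs_mult, Rabs_Rabsolu, (Rabs_right 2), <- abs_IZR, mult_IZR by lra.
    ring. }
  assert (H2 : 1 = IZR (2 * Z.abs (k - k'))) by nra.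
  apply eq_IZR in H2. lia.
Qed.

Lemma rn_opp x : safe x -> rn (- x) = - rn x.
Proof.
  intros H. assert (H' : safe (- x)) by (unfold safe; now rewrite Rabs_Ropp).
  apply (rnd_spec_unique (- x)); [now apply rn_spec|].
  destruct (rn_spec x H) as (F1 & N1 & T1). split; [now apply isF_opp|split].
  - intros z Hz. replace (- x - - rn x) with (- (x - rn x)) by ring.
    replace (- x - z) with (- (x - - z)) by ring. rewrite !Rabs_Ropp. apply N1. now apply isF_opp.
  - intros z Hz Hne Heq. destruct (T1 (- z)) as [k Hk].
    + now apply isF_opp.
    + intros C. apply Hne. lra.
    + replace (- x - - rn x) with (- (x - rn x)) in Heq by ring.
      replace (- x - z) with (- (x - - z)) in Heq by ring. now rewrite !Rabs_Ropp in Heq.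
    + exists (- k)%Z. rewrite Hk at 1. rewrite opp_IZR.
      replace (- rn x - z) with (- (rn x - - z)) by ring. rewrite Rabs_Ropp. ring.
Qed.

(** The rounded value is no farther from [x] than the float [f], so rounding at most doubles a
    deviation from a float. *)
Lemma rn_dev_lo x f d : safe x -> isF f -> 0 <= d -> f - d <= x -> f - 2 * d <= rn x.
Proof.
  intros H Hf Hd Hx. destruct (Rle_lt_dec f x) as [C|C].
  - pose proof (rn_ge x f H Hf C). lra.
  - pose proof (rn_near x f H Hf) as P. revert P.
    unfold Rabs; repeat destruct Rcase_abs; intros; lra.
Qed.

Lemma rn_dev_hi x f d : safe x -> isF f -> 0 <= d -> x <= f + d -> rn x <= f + 2 * d.
Proof.
  intros H Hf Hd Hx. destruct (Rle_lt_dec x f) as [C|C].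
  - pose proof (rn_le x f H Hf C). lra.
  - pose proof (rn_near x f H Hf) as P. revert P.
    unfold Rabs; repeat destruct Rcase_abs; intros; lra.
Qed.

(** Half the spacing of the binade below [bp e]; including the endpoint costs nothing because [bp e]
    lies on the same grid. *)
Lemma rn_err x e : (emin < e <= emax)%Z -> Rabs x <= bp e -> Rabs (rn x - x) <= bp (e - m - 2).
Proof.
  intros He Hx. exps. pose proof (bp_pos (e - 1 - m)) as Hs.
  destruct (nearest_even (x / bp (e - 1 - m))) as [N [HN _]].
  assert (Hd : Rabs (x - IZR N * bp (e - 1 - m)) <= bp (e - m - 2)).
  { replace (x - IZR N * bp (e - 1 - m)) with ((x / bp (e - 1 - m) - IZR N) * bp (e - 1 - m))
      by (field; lra).
    rewrite Rabs_mult, (Rabs_right (bp (e - 1 - m))) by lra.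
    replace (bp (e - 1 - m)) with (2 * bp (e - m - 2)) in * by (rewrite <- bp_S; f_equal; lia). nra. }
  assert (HF : isF (IZR N * bp (e - 1 - m))).
  { apply (isF_intro N (e - 1 - m)); auto; try lia.
    replace (e - 1 - m + m + 1)%Z with e by lia.
    rewrite Rabs_mult, (Rabs_right (bp (e - 1 - m))) by lra.
    assert (Hb : bp e = IZR (2 ^ (m + 1)) * bp (e - 1 - m)).
    { rewrite <- bp_IZR, <- bp_plus by lia. f_equal; lia. }
    rewrite Hb. apply Rmult_le_compat_r; [lra|]. rewrite <- abs_IZR. apply IZR_le.
    assert (HZ : IZR (Z.abs N) < IZR (2 ^ (m + 1)) + 1).
    { rewrite abs_IZR. apply Rmult_lt_reg_r with (bp (e - 1 - m)); auto.
      rewrite Rmult_plus_distr_r, <- Hb.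
      replace (Rabs (IZR N) * bp (e - 1 - m)) with (Rabs (IZR N * bp (e - 1 - m)))
        by (rewrite Rabs_mult, (Rabs_right (bp (e - 1 - m))); lra).
      replace (bp (e - 1 - m)) with (2 * bp (e - m - 2)) in * by (rewrite <- bp_S; f_equal; lia).
      revert Hd Hx. unfold Rabs; repeat destruct Rcase_abs; intros; lra. }
    rewrite <- plus_IZR in HZ. apply lt_IZR in HZ. lia. }
  assert (Hsafe : safe x).
  { apply safe_bp. eapply Rle_trans; [exact Hx|]. apply bp_le; lia. }
  rewrite Rabs_minus_sym. eapply Rle_trans; [|exact Hd]. now apply rn_near.
Qed.

Lemma rn_half_lo b x e : safe x -> isF b -> bp e <= b -> x < b + bp (e - m - 1) -> rn x <= b.
Proof.
  intros H Hb H1 H2. destruct (Rle_lt_dec (rn x) b) as [|C]; auto. exfalso.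
  pose proof (isF_gap _ _ e (rn_F x H) Hb H1 C) as G.
  pose proof (rn_near x b H Hb) as P.
  replace (bp (e - m)) with (2 * bp (e - m - 1)) in * by (rewrite <- bp_S; f_equal; lia).
  revert P. pose proof (bp_pos (e - m - 1)).
  unfold Rabs; repeat destruct Rcase_abs; intros; lra.
Qed.

Lemma rn_half_hi b x e : safe x -> isF b -> bp e <= b -> (emin <= e)%Z -> (e + 2 <= emax)%Z ->
  b < bp (e + 1) ->
  b + bp (e - m - 1) < x -> b + bp (e - m) <= rn x.
Proof.
  intros H Hb H1 He He2 H3 H2. pose proof (bp_pos e).
  assert (Hs : bp (e - m) = 2 * bp (e - m - 1)) by (rewrite <- bp_S; f_equal; lia).
  pose proof (bp_pos (e - m - 1)).
  assert (Hb' : isF (b + bp (e - m))).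
  { destruct (isF_canon b e Hb) as [N HN]; [rewrite Rabs_right; lra|].
    apply (isF_intro (N + 1) (e - m)); try lia.
    - rewrite plus_IZR, HN at 1. ring.
    - replace (e - m + m + 1)%Z with (e + 1)%Z by lia.
      rewrite Rabs_right by lra.
      apply (isF_gap (bp (e + 1)) b e); auto. apply isF_bp. exps; lia. }
  destruct (Rle_lt_dec (b + bp (e - m)) (rn x)) as [|C]; auto. exfalso.
  assert (rn x <= b).
  { destruct (Rle_lt_dec (rn x) b) as [|D]; auto.
    pose proof (isF_gap _ _ e (rn_F x H) Hb H1 D). lra. }
  pose proof (rn_near x _ H Hb') as P. revert P.
  unfold Rabs; repeat destruct Rcase_abs; intros; lra.
Qed.

(** A power of two has an even mantissa, so a tie just above it rounds down to it. Thanks to this a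
    range bounded by a power of two does not grow with each addition. *)
Lemma rn_bp_tie x q : safe x -> (emin <= q)%Z -> (q <= emax)%Z ->
  x <= bp q + bp (q - m - 1) -> rn x <= bp q.
Proof.
  intros H Hq Hq' Hx. exps.
  assert (HF : isF (bp q)) by (apply isF_bp; lia).
  destruct (Rle_lt_dec (rn x) (bp q)) as [|C]; auto. exfalso.
  pose proof (isF_gap _ _ q (rn_F x H) HF (Rle_refl _) C) as G.
  pose proof (rn_near x _ H HF) as P.
  assert (Hs : bp (q - m) = 2 * bp (q - m - 1)) by (rewrite <- bp_S; f_equal; lia).
  pose proof (bp_pos (q - m - 1)).
  assert (Hx' : x = bp q + bp (q - m - 1) /\ rn x = bp q + bp (q - m)).
  { revert P. unfold Rabs; repeat destruct Rcase_abs; intros; split; lra. }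
  destruct Hx' as [X1 X2].
  destruct (rn_spec x H) as (_ & _ & T). destruct (T (bp q) HF) as [k Hk].
  - lra.
  - rewrite X2, X1, Hs. unfold Rabs; repeat destruct Rcase_abs; lra.
  - rewrite X2 in Hk. replace (bp q + bp (q - m) - bp q) with (bp (q - m)) in Hk by ring.
    rewrite Rabs_right in Hk by (pose proof (bp_pos (q - m)); lra).
    replace (bp q) with (IZR (2 ^ m) * bp (q - m)) in Hk
      by (rewrite <- bp_IZR, <- bp_plus by lia; f_equal; lia).
    assert (Hz : IZR (2 ^ m + 1) = IZR (2 * k)).
    { rewrite plus_IZR, mult_IZR. pose proof (bp_pos (q - m)).
      apply Rmult_eq_reg_r with (bp (q - m)); lra. }
    apply eq_IZR in Hz.
    replace m with (1 + (m - 1))%Z in Hz by lia. rewrite Z.pow_add_r in Hz by lia. lia.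
Qed.

(** * Amplification of a gap by rounding *)

Notation run acc ts z := (fold_left (oplus E M) (map EF ts) (EF acc) = EF z).

Lemma run_cons a t ts z : safe (a + t) -> run (rn (a + t)) ts z -> run a (t :: ts) z.
Proof. intros H H'. simpl. now rewrite rnd_rn. Qed.

Lemma run_app a b c ts us : run a ts b -> run b us c -> run a (ts ++ us) c.
Proof. intros H H'. now rewrite map_app, fold_left_app, H. Qed.

Lemma bp_bounds : bp 7 = 128 /\ 128 * bp 7 <= bp (emax - 1) /\ bp emax = 4 * bp (emax - 2) /\
  bp (emax - 1) = 2 * bp (emax - 2) /\ bp (emax + 1) = 8 * bp (emax - 2).
Proof.
  exps. repeat split.
  - unfold bp; simpl; lra.
  - replace 128 with (bp 7) by (unfold bp; simpl; lra). rewrite <- bp_plus. apply bp_le; lia.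
  - rel constr:(emax) (emax - 2)%Z 2%nat. lra.
  - rel (emax - 1)%Z (emax - 2)%Z 1%nat. lra.
  - rel (emax + 1)%Z (emax - 2)%Z 3%nat. lra.
Qed.

Lemma safe_intro x : - (3 / 2 * bp emax) <= x <= 3 / 2 * bp emax -> safe x.
Proof. apply Rabs_intro. Qed.

Lemma rn_abs x f : isF f -> Rabs x <= f -> safe x -> - f <= rn x <= f.
Proof.
  intros Hf Hx Hs. apply Rabs_elim in Hx. split.
  - apply rn_ge; auto; [now apply isF_opp|lra].
  - apply rn_le; auto; lra.
Qed.

Lemma isF_small N e : (Z.abs N < 16)%Z -> (emin - m <= e)%Z -> (e + 3 <= emax)%Z ->
  isF (IZR N * bp e).
Proof.
  intros HN H1 H2. exps.
  assert (HB : Rabs (IZR N * bp e) < bp (e + 4)).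
  { rewrite Rabs_mult, (Rabs_right (bp e)), <- abs_IZR by (pose proof (bp_pos e); lra).
    rel (e + 4)%Z e 4%nat. apply IZR_lt in HN. pose proof (bp_pos e). nra. }
  destruct (Z_le_gt_dec emin e).
  - apply (isF_strict (N * 2 ^ (m - 3)) (e + 3 - m)); try lia.
    + rewrite mult_IZR, <- bp_IZR, Rmult_assoc, <- bp_plus by lia. do 2 f_equal; lia.
    + eapply Rlt_le_trans; [exact HB|]. apply bp_le; lia.
  - apply (isF_intro N e); try lia; auto.
    left. eapply Rlt_le_trans; [exact HB|]. apply bp_le; lia.
Qed.

(** Adding [b] rounds to multiples of [2 ^ (k + 1)]; the offset [d] makes [2 ^ k] round up and [0] round down. *)
Lemma amplify k d b p : isF d -> isF b -> isF p ->
  bp (k - 1) <= d < bp k -> bp (m + k + 1) <= b < bp (m + k + 2) ->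
  (emin - m + 1 <= k)%Z -> (k <= 4 - m)%Z -> Rabs p <= bp (emax - 1) ->
  exists p', run p [d; b; - b] p' /\ isF p' /\
    (p <= 0 -> p' <= 0) /\
    (bp k <= p -> bp (k + 1) <= p') /\
    (forall q, (k <= q)%Z -> (q <= emax - 1)%Z -> - bp q <= p -> - bp q <= p') /\
    (forall q, (m + k + 3 <= q)%Z -> (q <= emax - 1)%Z -> p <= bp q -> p' <= bp q) /\
    (- bp (k - 1) <= p -> 0 <= p').
Proof.
  intros Fd Fb Fp Hd Hb Hk1 Hk2 Hp. exps. destruct bp_bounds as (B7 & B1 & B2 & B3 & B4).
  pose proof (bp_pos (k - 1)) as Pk.
  assert (Ek : bp k = 2 * bp (k - 1)) by (rewrite <- bp_S; f_equal; lia).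
  assert (Ek1 : bp (k + 1) = 2 * bp k) by (rewrite <- bp_S; f_equal; lia).
  assert (Hk3 : bp k <= bp 7) by (apply bp_le; lia).
  assert (Hb3 : bp (m + k + 2) <= bp 7) by (apply bp_le; lia).
  assert (Hb0 : 0 < b) by (pose proof (bp_pos (m + k + 1)); lra).
  apply Rabs_elim in Hp.
  set (y1 := rn (p + d)). set (y2 := rn (y1 + b)). set (y3 := rn (y2 + - b)).
  assert (F3 : isF (3 * bp (emax - 2))).
  { replace (3 * bp (emax - 2)) with (12 * bp (emax - 4)) by (rel (emax - 2)%Z (emax - 4)%Z 2%nat; ring).
    apply isF_small; lia. }
  assert (S1 : safe (p + d)) by (apply safe_intro; lra).
  assert (G1 : - (3 * bp (emax - 2)) <= y1 <= 3 * bp (emax - 2)).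
  { apply rn_abs; auto. apply Rabs_intro. lra. }
  assert (S2 : safe (y1 + b)) by (apply safe_intro; lra).
  assert (G2 : - bp emax <= y2 <= bp emax).
  { apply rn_abs; auto; [apply isF_bp; lia|]. apply Rabs_intro. lra. }
  assert (S3 : safe (y2 + - b)) by (apply safe_intro; lra).
  assert (F1 : isF y1) by now apply rn_F.
  assert (F2 : isF y2) by now apply rn_F.
  exists y3. split; [|split; [now apply rn_F|repeat split]].
  - apply run_cons; auto. apply run_cons; auto. apply run_cons; auto.
  - intros H. assert (y1 <= d) by (apply rn_le; auto; lra).
    assert (y2 <= b).
    { apply (rn_half_lo b _ (m + k + 1)); auto; try lra.
      replace (m + k + 1 - m - 1)%Z with k by lia. lra. }
    apply rn_le; auto; [apply isF_0|lra].
  - intros H.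
    assert (F4 : isF (3 * bp (k - 1))) by (apply isF_small; lia).
    assert (3 * bp (k - 1) <= y1) by (apply rn_ge; auto; lra).
    assert (b + bp (k + 1) <= y2).
    { replace (k + 1)%Z with (m + k + 1 - m)%Z by lia.
      apply (rn_half_hi b _ (m + k + 1)); auto; try lra; try lia.
      - replace (m + k + 1 + 1)%Z with (m + k + 2)%Z by lia. lra.
      - replace (m + k + 1 - m - 1)%Z with k by lia. lra. }
    apply rn_ge; auto; [apply isF_bp; lia|lra].
  - intros q Q1 Q2 H.
    assert (Fq : isF (bp q)) by (apply isF_bp; lia).
    destruct (Z_le_gt_dec q (m + k + 2)) as [Q3|Q3].
    (* Up to about the size of [b], the number [b - bp q] is a multiple of the spacing [bp (k + 1)]
       and thus a float. The exception is [q = k], where the offset has already halved the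
       undershoot. *)
    + assert (b - bp q <= y2).
      { destruct (Z.eq_dec q k) as [->|Q4].
        - assert (- bp (k - 1) <= y1).
          { apply rn_ge; auto; [apply isF_opp, isF_bp; lia|lra]. }
          replace (b - bp k) with (b - 2 * bp (k - 1)) by lra.
          apply rn_dev_lo; auto; lra.
        - assert (- bp q <= y1) by (apply rn_ge; auto; [now apply isF_opp|lra]).
          apply rn_ge; auto; [|lra].
          destruct (isF_canon b (m + k + 1) Fb) as [N HN]; [rewrite Rabs_right; lra|].
          apply (isF_intro (N - 2 ^ (q - k - 1)) (k + 1)); try lia.
          + rewrite minus_IZR, Rmult_minus_distr_r, <- bp_IZR, <- bp_plus by lia.
            replace (q - k - 1 + (k + 1))%Z with q by lia.
            rewrite HN at 1. do 3 f_equal. lia.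
          + replace (k + 1 + m + 1)%Z with (m + k + 2)%Z by lia.
            assert (bp q <= bp (m + k + 2)) by (apply bp_le; lia).
            pose proof (bp_pos q). apply Rabs_intro; lra. }
      apply rn_ge; auto; [now apply isF_opp|lra].
    (* For larger undershoots the error of adding [b] stays within half a spacing at [bp q], so the
       final subtraction rounds to [- bp q] at worst. *)
    + assert (- bp q <= y1) by (apply rn_ge; auto; [now apply isF_opp|lra]).
      assert (Hq : bp (m + k + 2) <= bp q) by (apply bp_le; lia).
      assert (Hq' : bp q <= bp (emax - 1)) by (apply bp_le; lia).
      assert (S0 : safe (- bp q + b)) by (apply safe_intro; lra).
      assert (Hr : Rabs (rn (- bp q + b) - (- bp q + b)) <= bp (q - m - 2)).
      { apply rn_err; try lia. apply Rabs_intro; lra. }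
      apply Rabs_elim in Hr.
      assert (rn (- bp q + b) <= y2) by (apply rn_mono; auto; lra).
      assert (bp (q - m - 2) <= bp (q - m - 1)) by (apply bp_le; lia).
      assert (S4 : safe (- (y2 + - b))) by (unfold safe; now rewrite Rabs_Ropp).
      assert (rn (- (y2 + - b)) <= bp q) by (apply rn_bp_tie; auto; try lia; lra).
      rewrite rn_opp in * by auto. unfold y3. lra.
  - intros q Q1 Q2 H.
    assert (Hq' : bp q <= bp (emax - 1)) by (apply bp_le; lia).
    pose proof (bp_pos q).
    assert (Hk : bp k <= bp (q - m - 1)) by (apply bp_le; lia).
    assert (y1 <= bp q) by (apply rn_bp_tie; auto; try lia; lra).
    assert (Hq : bp (m + k + 2) <= bp q) by (apply bp_le; lia).
    assert (Eq : bp (q + 1) = 2 * bp q) by (now rewrite bp_S).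
    assert (S0 : safe (bp q + b)) by (apply safe_intro; lra).
    assert (Hr : Rabs (rn (bp q + b) - (bp q + b)) <= bp (q + 1 - m - 2)).
    { apply rn_err; try lia. apply Rabs_intro; lra. }
    replace (q + 1 - m - 2)%Z with (q - m - 1)%Z in Hr by lia.
    apply Rabs_elim in Hr.
    assert (y2 <= rn (bp q + b)) by (apply rn_mono; auto; lra).
    apply rn_bp_tie; auto; try lia; lra.
  - intros H. assert (0 <= y1) by (apply rn_ge; auto; [apply isF_0|lra]).
    assert (b <= y2) by (apply rn_ge; auto; lra).
    apply rn_ge; auto; [apply isF_0|lra].
Qed.

(** Each triple doubles the gap. The constants are only confined to a binade, because they have to
    be products of weights with values of [sigma] and cannot be prescribed exactly. *)
Inductive chain : Z -> list R -> Z -> Prop :=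
| chain_nil k : chain k [] k
| chain_cons k d b cs k' : isF d -> isF b ->
    bp (k - 1) <= d < bp k -> bp (m + k + 1) <= b < bp (m + k + 2) ->
    chain (k + 1) cs k' -> chain k (d :: b :: - b :: cs) k'.

(** An undershoot of half the final gap or more is merely kept from growing. A smaller one [bp q]
    disappears at the step starting from [q + 1], whose offset is at least [bp q]. The exponent 7
    dominates the [m + k + 3] of [amplify] for all [k] up to [4 - m]. *)
Lemma chain_run k cs k' : chain k cs k' -> (emin - m + 1 <= k)%Z -> (k' <= 5 - m)%Z ->
  forall p, isF p -> Rabs p <= bp (emax - 1) ->
  exists p', run p cs p' /\ isF p' /\ (k <= k')%Z /\
    (p <= 0 -> p' <= 0) /\
    (bp k <= p -> bp k' <= p') /\
    (forall q, (k' - 1 <= q)%Z -> (q <= emax - 1)%Z -> - bp q <= p -> - bp q <= p') /\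
    (forall q, (7 <= q)%Z -> (q <= emax - 1)%Z -> p <= bp q -> p' <= bp q) /\
    (0 <= p -> 0 <= p') /\
    (forall q, (k - 1 <= q)%Z -> (q < k' - 1)%Z -> - bp q <= p -> 0 <= p').
Proof.
  intros Hc. induction Hc as [k|k d b cs k' Fd Fb Hd Hb Hc IH]; intros H1 H2 p Fp Hp.
  - exists p. repeat split; auto; try lia; try lra.
  - exps.
    assert (Hkk : (k + 1 <= k')%Z).
    { clear -Hc. induction Hc; lia. }
    destruct (amplify k d b p) as (p1 & R1 & F1 & A1 & A2 & A3 & A4 & A5); auto; try lia.
    assert (Hp1 : Rabs p1 <= bp (emax - 1)).
    { apply Rabs_elim in Hp. apply Rabs_intro. split.
      - apply A3; try lia; lra.
      - apply A4; try lia; lra. }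
    destruct IH with (p := p1) as (p' & R2 & F2 & _ & C1 & C2 & C3 & C4 & C5 & C6); auto; try lia.
    assert (Z1 : 0 <= p1 -> 0 <= p') by auto.
    exists p'. split; [|split; [auto|repeat split]].
    + change (d :: b :: - b :: cs) with ([d; b; - b] ++ cs). now apply run_app with p1.
    + lia.
    + auto.
    + auto.
    + intros q Q1 Q2 Q3. apply C3; auto. apply A3; auto; lia.
    + intros q Q1 Q2 Q3. apply C4; auto. apply A4; auto; lia.
    + intros Q. apply Z1, A5. pose proof (bp_pos (k - 1)). lra.
    + intros q Q1 Q2 Q3. destruct (Z.eq_dec q (k - 1)) as [->|Q4].
      * apply Z1, A5. auto.
      * apply (C6 q); try lia. apply A3; auto; lia.
Qed.

(** The first offset lies in the binade from [bp (k0 - 1)], the least positive float; no smaller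
    power-of-two gap leaves room for one. *)
Notation k0 := (emin - m + 1)%Z.

(** The gap is amplified until it covers the step from [eta] to [etap]. Since [eta] is added as the
    bias, at the end, the sign of the amplified difference decides on which side the neuron lands;
    rounding this addition may double an undershoot. *)
Lemma tail_run eta etap A y cs : isF eta -> isF etap -> Rabs eta <= 4 ->
  etap <= eta + bp (1 - m) -> isF A -> isF y -> Rabs (y - A) <= bp (emax - 1) ->
  chain k0 cs (1 - m) ->
  exists p x, run y (- A :: cs) p /\ isF p /\ oplus E M (EF p) (EF eta) = EF x /\ isF x /\
    (y <= A -> x <= eta) /\ (A + bp k0 <= y -> etap <= x) /\
    (forall q, (- m <= q)%Z -> (q <= emax - 1)%Z -> A - bp q <= y -> eta - 2 * bp q <= x) /\
    x <= eta + bp emax.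
Proof.
  intros Fe Fe' He He' FA Fy Hy Hc. exps. destruct bp_bounds as (B7 & B1 & B2 & B3 & B4).
  pose proof (bp_pos (emax - 2)).
  assert (S0 : safe (y + - A)).
  { apply safe_bp. apply Rabs_elim in Hy. apply Rabs_intro. lra. }
  assert (Hp0 : Rabs (rn (y + - A)) <= bp (emax - 1)).
  { apply Rabs_intro. apply rn_abs; auto. apply isF_bp; lia. }
  destruct (chain_run k0 cs (1 - m) Hc) with (p := rn (y + - A))
    as (p & R & Fp & _ & C1 & C2 & C3 & C4 & _ & _); auto; try lia; [now apply rn_F|].
  apply Rabs_elim in Hp0, He.
  assert (Hp : - bp (emax - 1) <= p <= bp (emax - 1)).
  { split; [apply C3|apply C4]; try lia; lra. }
  assert (S1 : safe (p + eta)) by (apply safe_intro; lra).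
  exists p, (rn (p + eta)).
  split; [now apply run_cons|]. split; [auto|]. split; [now apply rnd_rn|].
  split; [now apply rn_F|]. repeat split.
  - intros H1. apply rn_le; auto. enough (p <= 0) by lra. apply C1.
    apply rn_le; auto; [apply isF_0|lra].
  - intros H1. apply rn_ge; auto. enough (bp (1 - m) <= p) by lra. apply C2.
    apply rn_ge; auto; [apply isF_bp; lia|lra].
  - intros q Q1 Q2 H1. apply rn_dev_lo; auto; [pose proof (bp_pos q); lra|].
    enough (- bp q <= p) by lra. apply C3; auto; try lia.
    apply rn_ge; auto; [apply isF_opp, isF_bp; lia|lra].
  - replace (bp emax) with (2 * bp (emax - 1)) by lra. apply rn_dev_hi; auto; lra.
Qed.

Lemma small_bound e : (e <= 2)%Z -> bp e <= bp (emax - 8).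
Proof. intros H. exps. apply bp_le; lia. Qed.

Lemma head_run A t cs : isF A -> isF t -> Rabs A <= bp (5 - m) ->
  A - bp (- m) <= t <= 3 * bp (emax - 4) -> chain k0 cs (5 - m) ->
  exists p, run t (- A :: cs) p /\ isF p /\ 0 <= p <= bp (emax - 2) /\
    (t <= A -> p = 0) /\ (A + bp k0 <= t -> bp (5 - m) <= p).
Proof.
  intros FA Ft HA Ht Hc. exps.
  assert (B1 : bp (5 - m) <= bp (emax - 8)) by (apply small_bound; lia).
  assert (B2 : bp (- m) <= bp (emax - 8)) by (apply small_bound; lia).
  assert (B3 : bp (emax - 4) = 16 * bp (emax - 8)) by (rel (emax - 4)%Z (emax - 8)%Z 4%nat; lra).
  assert (B4 : bp (emax - 2) = 64 * bp (emax - 8)) by (rel (emax - 2)%Z (emax - 8)%Z 6%nat; lra).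
  assert (B5 : bp (emax - 1) = 128 * bp (emax - 8)) by (rel (emax - 1)%Z (emax - 8)%Z 7%nat; lra).
  assert (B6 : bp emax = 256 * bp (emax - 8)) by (rel constr:(emax) (emax - 8)%Z 8%nat; lra).
  pose proof (bp_pos (emax - 8)). apply Rabs_elim in HA.
  assert (S0 : safe (t + - A)) by (apply safe_intro; lra).
  assert (L : - bp (- m) <= rn (t + - A)).
  { apply rn_ge; auto; [apply isF_opp, isF_bp; lia|lra]. }
  assert (U : rn (t + - A) <= bp (emax - 2)).
  { apply rn_le; auto; [apply isF_bp; lia|lra]. }
  destruct (chain_run k0 cs (5 - m) Hc) with (p := rn (t + - A))
    as (p & R & Fp & _ & C1 & C2 & C3 & C4 & C5 & C6); auto; try lia; [now apply rn_F| |].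
  { apply Rabs_intro. lra. }
  assert (P0 : 0 <= p) by (apply (C6 (- m)%Z); auto; lia).
  exists p. split; [now apply run_cons|]. split; [auto|]. split; [|split].
  - split; auto. apply C4; auto; lia.
  - intros H1. apply Rle_antisym; auto. apply C1. apply rn_le; auto; [apply isF_0|lra].
  - intros H1. apply C2. apply rn_ge; auto; [apply isF_bp; lia|lra].
Qed.

(** After the first block the partial sum is [0] or at least [2 ^ (5 - M)], which outweighs the possible undershoot of the second operand. *)
Lemma gate_mid A p t : isF A -> isF t -> isF p -> Rabs A <= bp (5 - m) ->
  A - bp (- m) <= t <= 3 * bp (emax - 4) -> 0 <= p <= bp (emax - 2) ->
  safe (p + t) /\ Rabs (rn (p + t) - A) <= bp (emax - 1) /\
  A - bp (- m) <= rn (p + t) /\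
  (p = 0 -> t <= A -> rn (p + t) <= A) /\
  (A + bp k0 <= t \/ bp (5 - m) <= p -> A + bp k0 <= rn (p + t)).
Proof.
  intros FA Ft Fp HA Ht Hp. exps.
  assert (B1 : bp (5 - m) <= bp (emax - 8)) by (apply small_bound; lia).
  assert (B2 : bp (5 - m) = 32 * bp (- m)) by (rel (5 - m)%Z (- m)%Z 5%nat; lra).
  assert (B3 : bp (emax - 4) = 16 * bp (emax - 8)) by (rel (emax - 4)%Z (emax - 8)%Z 4%nat; lra).
  assert (B4 : bp (emax - 2) = 64 * bp (emax - 8)) by (rel (emax - 2)%Z (emax - 8)%Z 6%nat; lra).
  assert (B5 : bp (emax - 1) = 128 * bp (emax - 8)) by (rel (emax - 1)%Z (emax - 8)%Z 7%nat; lra).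
  assert (B6 : bp emax = 256 * bp (emax - 8)) by (rel constr:(emax) (emax - 8)%Z 8%nat; lra).
  pose proof (bp_pos (emax - 8)). pose proof (bp_pos (- m)). apply Rabs_elim in HA.
  assert (S0 : safe (p + t)) by (apply safe_intro; lra).
  assert (St : safe t) by (apply safe_intro; lra).
  assert (L : t <= rn (p + t)) by (apply rn_ge; auto; lra).
  assert (U : rn (p + t) <= 7 * bp (emax - 4)).
  { apply rn_le; auto; [apply isF_small; lia|lra]. }
  split; [auto|]. split; [apply Rabs_intro; lra|]. split; [lra|]. split.
  - intros -> H1. rewrite Rplus_0_l, rn_id; auto.
  - intros [H1|H1]; [lra|].
    (* Of the 32 units [bp (- m)] in [p], one pays for the undershoot of [t]. The rest plus [A] is
       below 64 units, so rounding costs at most two more because [m] is at least 3. *)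
    assert (S1 : safe (31 * bp (- m) + A)) by (apply safe_intro; lra).
    assert (Hr : Rabs (rn (31 * bp (- m) + A) - (31 * bp (- m) + A)) <= bp (6 - m - m - 2)).
    { apply rn_err; [lia|]. replace (bp (6 - m)) with (64 * bp (- m)) by (rel (6 - m)%Z (- m)%Z 6%nat; lra).
      apply Rabs_intro. lra. }
    apply Rabs_elim in Hr.
    assert (B7 : bp (6 - m - m - 2) <= bp (1 - m)) by (apply bp_le; lia).
    assert (B8 : bp (1 - m) = 2 * bp (- m)) by (rel (1 - m)%Z (- m)%Z 1%nat; lra).
    assert (B9 : bp k0 <= bp (- m)) by (apply bp_le; lia).
    assert (rn (31 * bp (- m) + A) <= rn (p + t)) by (apply rn_mono; auto; lra).
    lra.
Qed.

(** * Weights and constants *)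

Lemma chain_app k a k' b k'' : chain k a k' -> chain k' b k'' -> chain k (a ++ b) k''.
Proof. induction 1; simpl; auto. intros. apply chain_cons; auto. Qed.

(** The scaled [b] is normal, hence exact. If [a] is at least [bp (i - 1)], the scaled [a] is exact
    too, and floats from [bp (emin + 1)] on are spaced by at least [bp k0]. Otherwise the scaled
    numbers are separated by [bp (i - 1 + w)]. *)
Lemma rn_scale_gap a b i w : isF a -> isF b -> a < b -> Rabs a <= b -> bp i <= b < bp (i + 1) ->
  (emin + 2 <= i + w)%Z -> (w <= 0)%Z -> (i < emax)%Z -> safe (a * bp w) ->
  rn (a * bp w) + bp k0 <= rn (b * bp w).
Proof.
  intros Fa Fb Hab Ha Hb H1 H2 H3 Sa. exps. pose proof (bp_pos w). pose proof (bp_pos i).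
  assert (Fb' : isF (b * bp w)) by (apply (isF_scale b i); auto; [rewrite Rabs_right; lra|lia]).
  assert (Ub : b * bp w < bp (i + 1 + w)) by (rewrite bp_plus; apply Rmult_lt_compat_r; lra).
  assert (Lb : bp (i + w) <= b * bp w) by (rewrite bp_plus; apply Rmult_le_compat_r; lra).
  assert (Sb : safe (b * bp w)).
  { apply safe_bp, Rabs_intro. assert (bp w <= 1) by (rewrite <- bp_0; apply bp_le; lia).
    assert (b * bp w <= b) by nra. assert (0 < bp (i + w)) by apply bp_pos.
    assert (bp (i + 1 + w) <= bp emax) by (apply bp_le; lia). lra. }
  rewrite (rn_id (b * bp w)) by auto.
  assert (Ei : bp i = 2 * bp (i - 1)) by (rewrite <- bp_S; f_equal; lia).
  destruct (Rle_lt_dec (bp (i - 1)) a) as [Hi|Hi].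
  - assert (La : bp (i + w - 1) <= a * bp w).
    { replace (i + w - 1)%Z with (i - 1 + w)%Z by lia. rewrite bp_plus.
      apply Rmult_le_compat_r; lra. }
    assert (Fa' : isF (a * bp w)).
    { assert (0 < bp (i - 1)) by apply bp_pos. destruct (Rlt_le_dec a (bp i)) as [C|C].
      - apply (isF_scale a (i - 1)); auto; [|lia]. rewrite Rabs_right by lra.
        replace (i - 1 + 1)%Z with i by lia. lra.
      - apply (isF_scale a i); auto; [|lia]. rewrite Rabs_right; lra. }
    rewrite rn_id by auto.
    assert (Hlt : a * bp w < b * bp w) by (apply Rmult_lt_compat_r; lra).
    pose proof (isF_gap _ _ _ Fb' Fa' La Hlt).
    assert (bp k0 <= bp (i + w - 1 - m)) by (apply bp_le; lia). lra.
  - assert (rn (a * bp w) <= bp (i - 1 + w)).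
    { apply rn_le; auto; [apply isF_bp; lia|]. rewrite bp_plus. apply Rmult_le_compat_r; lra. }
    assert (bp (i + w) = 2 * bp (i - 1 + w)) by (rewrite <- bp_S; f_equal; lia).
    assert (bp k0 <= bp (i - 1 + w)) by (apply bp_le; lia). lra.
Qed.

(** The larger of [s0] and [s1] is scaled to about [2 ^ (emin + 2)], where it is still normal with bits to spare; only if
    the weight would underflow is it scaled to more. The bound [/ 8] makes the layers contract. *)
Lemma exists_weight s0 s1 lam : isF s0 -> isF s1 -> s0 <> s1 ->
  bp (emin + 5) <= Rabs s0 < bp (emax - 4) -> bp (emin + 5) <= Rabs s1 < bp (emax - 4) ->
  0 <= lam -> lam <= bp (emax - 7) * Rabs s0 -> lam <= bp (emax - 7) * bp (m + 3) ->
  exists w, (emin - m <= w <= 0)%Z /\ lam * bp w <= / 8 /\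
    (Rabs s0 * bp w < bp emin -> lam * bp w <= / 64) /\
    Rabs s0 * bp w <= bp (5 - m) /\ Rabs s1 * bp w <= bp (5 - m) /\
    (s0 < s1 -> rn (s0 * bp w) + bp k0 <= rn (s1 * bp w)) /\
    (s1 < s0 -> rn (s1 * bp w) + bp k0 <= rn (s0 * bp w)).
Proof.
  intros F0 F1 Hne H0 H1 L0 L1 L2. exps.
  set (S := Rmax (Rabs s0) (Rabs s1)).
  assert (S0 : Rabs s0 <= S) by apply Rmax_l. assert (S1 : Rabs s1 <= S) by apply Rmax_r.
  pose proof (bp_pos (emin + 5)).
  destruct (binade S) as [i [Hi1 Hi2]]; [lra|].
  assert (SU : S < bp (emax - 4)) by (unfold S, Rmax; destruct Rle_dec; lra).
  assert (Ii : (emin + 5 <= i <= emax - 5)%Z).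
  { assert (emin + 5 < i + 1)%Z by (apply bp_lt_inv; lra).
    assert (i < emax - 4)%Z by (apply bp_lt_inv; lra). lia. }
  set (w := Z.max (emin + 2 - i) (emin - m)).
  pose proof (bp_pos w).
  assert (SW : S * bp w <= bp (5 - m)).
  { destruct (Z_le_gt_dec (emin - m) (emin + 2 - i)).
    - replace w with (emin + 2 - i)%Z by lia.
      apply Rle_trans with (bp (i + 1) * bp (emin + 2 - i)).
      + apply Rmult_le_compat_r; [pose proof (bp_pos (emin + 2 - i))|]; lra.
      + rewrite <- bp_plus. apply bp_le; lia.
    - replace w with (emin - m)%Z by lia.
      apply Rle_trans with (bp (emax - 4) * bp (emin - m)).
      + apply Rmult_le_compat_r; [pose proof (bp_pos (emin - m))|]; lra.
      + rewrite <- bp_plus. apply bp_le; lia. }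
  assert (gap : forall a b, isF a -> isF b -> a < b -> Rmax (Rabs a) (Rabs b) = S ->
            rn (a * bp w) + bp k0 <= rn (b * bp w)).
  { intros a b Fa Fb Hab HS.
    assert (Ha : Rabs a <= S) by (rewrite <- HS; apply Rmax_l).
    assert (Hb : Rabs b <= S) by (rewrite <- HS; apply Rmax_r).
    assert (sf : forall x, Rabs x <= S -> safe (x * bp w)).
    { intros x Hx. apply safe_bp. rewrite Rabs_mult, (Rabs_right (bp w)) by lra.
      assert (bp (5 - m) <= bp emax) by (apply bp_le; lia).
      assert (Rabs x * bp w <= S * bp w) by (apply Rmult_le_compat_r; lra). lra. }
    (* The number of larger magnitude is either the upper one and positive or the lower one and
       negative; the second case is the mirror image of the first. *)
    assert (Hc : b = S \/ a = - S).
    { revert HS Ha Hb Hab. unfold Rmax, Rabs. destruct Rle_dec; repeat destruct Rcase_abs; intros; lra. }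
    destruct Hc as [Hc|Hc].
    - apply (rn_scale_gap a b i w); auto; try lia; rewrite Hc; auto.
    - replace (b * bp w) with (- (- b * bp w)) by ring.
      replace (a * bp w) with (- (- a * bp w)) by ring.
      rewrite !rn_opp by (apply sf; now rewrite Rabs_Ropp).
      enough (rn (- b * bp w) + bp k0 <= rn (- a * bp w)) by lra.
      apply (rn_scale_gap (- b) (- a) i w); auto using isF_opp; try lia; try lra;
        rewrite ?Rabs_Ropp; try lra. apply sf. now rewrite Rabs_Ropp. }
  exists w. split; [lia|]. split; [|split; [|split; [|split; [|split]]]].
  (* The two bounds on [lam] in (C3) serve the two possible values of [w]; as [emin + emax = 1],
     each gives exactly [bp (-3)]. *)
  - destruct (Z_le_gt_dec (emin - m) (emin + 2 - i)).
    + apply Rle_trans with (bp (emax - 7) * bp (i + 1) * bp w).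
      * apply Rmult_le_compat_r; [lra|]. eapply Rle_trans; [exact L1|].
        apply Rmult_le_compat_l; [left; apply bp_pos|lra].
      * rewrite <- !bp_plus. replace (/ 8) with (bp (-3)) by (unfold bp; simpl; lra).
        apply bp_le; lia.
    + apply Rle_trans with (bp (emax - 7) * bp (m + 3) * bp w).
      * apply Rmult_le_compat_r; lra.
      * rewrite <- !bp_plus. replace (/ 8) with (bp (-3)) by (unfold bp; simpl; lra).
        apply bp_le; lia.
  - intros Hs. apply Rle_trans with (bp (emax - 7) * (Rabs s0 * bp w)).
    + rewrite <- Rmult_assoc. apply Rmult_le_compat_r; lra.
    + apply Rle_trans with (bp (emax - 7) * bp emin).
      * apply Rmult_le_compat_l; [left; apply bp_pos|lra].
      * rewrite <- bp_plus. replace (/ 64) with (bp (-6)) by (unfold bp; simpl; lra).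
        apply bp_le; lia.
  - apply Rle_trans with (S * bp w); auto. apply Rmult_le_compat_r; lra.
  - apply Rle_trans with (S * bp w); auto. apply Rmult_le_compat_r; lra.
  - intros Hlt. apply gap; auto.
  - intros Hlt. apply gap; auto. unfold S. apply Rmax_comm.
Qed.

(** A summand [kappa] is obtained with the weight [w] from a neuron of the previous layer with zero weights, bias [c] and
    value [v]. *)
Definition src (sigma : ext -> ext) (kappa : R) (p : R * R * R) : Prop :=
  let '(c, v, w) := p in
  isF c /\ isF w /\ isF v /\ sigma (EF c) = EF v /\ safe (v * w) /\ rn (v * w) = kappa.

Lemma src_scale sigma c v i t : isF c -> isF v -> sigma (EF c) = EF v ->
  bp i <= Rabs v < bp (i + 1) -> (emin - m <= t <= emax)%Z -> (emin <= i + t)%Z -> (i + t < emax)%Z ->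
  exists k p q, isF k /\ bp (i + t) <= k < bp (i + t + 1) /\ src sigma k p /\ src sigma (- k) q.
Proof.
  intros Fc Fv Hs Hi Ht H1 H2. pose proof (bp_pos t).
  set (w := if Rle_dec 0 v then bp t else - bp t).
  assert (Fw : isF w).
  { unfold w. destruct Rle_dec; [|apply isF_opp]; now apply isF_bp. }
  assert (Hw : v * w = Rabs v * bp t).
  { unfold w, Rabs. destruct Rle_dec; destruct Rcase_abs; try ring; try lra; assert (v = 0) by lra; subst; ring. }
  assert (HF : isF (v * w)).
  { rewrite Hw. apply (isF_scale (Rabs v) i); [|now rewrite Rabs_Rabsolu|lia].
    unfold Rabs. destruct Rcase_abs; auto. now apply isF_opp. }
  assert (HB : bp (i + t) <= v * w < bp (i + t + 1)).
  { rewrite Hw. replace (i + t + 1)%Z with (i + 1 + t)%Z by lia. rewrite (bp_plus i t), (bp_plus (i + 1) t). split.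
    - apply Rmult_le_compat_r; lra.
    - apply Rmult_lt_compat_r; lra. }
  assert (HS : safe (v * w)).
  { pose proof (bp_pos (i + t)). assert (bp (i + t + 1) <= bp emax) by (apply bp_le; lia).
    apply safe_bp, Rabs_intro. lra. }
  exists (v * w), (c, v, w), (c, v, - w). split; [auto|]. split; [auto|]. split.
  - repeat split; auto. now apply rn_id.
  - assert (E1 : v * - w = - (v * w)) by ring.
    split; [auto|]. split; [now apply isF_opp|]. split; [auto|]. split; [auto|]. rewrite E1.
    split; [unfold safe; now rewrite Rabs_Ropp|]. rewrite rn_opp by auto. now rewrite rn_id.
Qed.

(** No single source reaches every exponent. The value [r2] reaches down to the subnormals, but
    above [emax - m - 2] its weight might overflow, and [s0] takes over. Negatives are wanted only
    for the [b] of a triple, which is normal. *)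
Lemma src_avail sigma eta s0 c2 r2 e : isF eta -> isF s0 -> sigma (EF eta) = EF s0 ->
  isF c2 -> isF r2 -> sigma (EF c2) = EF r2 ->
  bp (emin + 5) <= Rabs s0 < bp (emax - 4) -> bp (- m - 2) <= Rabs r2 < 5 / 4 ->
  (emin - m <= e <= 5)%Z ->
  exists k p, isF k /\ bp e <= k < bp (e + 1) /\ src sigma k p /\
    ((emin <= e)%Z -> exists q, src sigma (- k) q).
Proof.
  intros Fe Fs Hs Fc Fr Hr Bs Br He. exps.
  destruct (binade (Rabs r2)) as [i Hi]; [pose proof (bp_pos (- m - 2)); lra|].
  assert (Ii : (- m - 2 <= i <= 0)%Z).
  { assert (- m - 2 < i + 1)%Z by (apply bp_lt_inv; lra).
    assert (i < 1)%Z by (apply bp_lt_inv; rewrite bp_1; lra). lia. }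
  destruct (Z_le_gt_dec emin e) as [C1|C1].
  - destruct (Z_le_gt_dec e (emax - m - 2)) as [C2|C2].
    + destruct (src_scale sigma c2 r2 i (e - i)) as (k & p & q & K1 & K2 & K3 & K4); auto; try lia.
      replace (i + (e - i))%Z with e in K2 by lia. exists k, p. repeat split; auto; try lra. now exists q.
    + destruct (binade (Rabs s0)) as [j Hj]; [pose proof (bp_pos (emin + 5)); lra|].
      assert (Ij : (emin + 5 <= j <= emax - 5)%Z).
      { assert (emin + 5 < j + 1)%Z by (apply bp_lt_inv; lra).
        assert (j < emax - 4)%Z by (apply bp_lt_inv; lra). lia. }
      destruct (src_scale sigma eta s0 j (e - j)) as (k & p & q & K1 & K2 & K3 & K4); auto; try lia.
      replace (j + (e - j))%Z with e in K2 by lia. exists k, p. repeat split; auto; try lra. now exists q.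
  - (* A subnormal target: the product may round up to [2 ^ (e + 1)], and then half the weight gives [2 ^ e]. *)
    assert (Hgen : forall t, (emin - m <= t <= emax)%Z -> (i + t < emax)%Z -> exists w, isF w /\
              r2 * w = Rabs r2 * bp t /\ safe (r2 * w) /\ bp (i + t) <= r2 * w < bp (i + t + 1)).
    { intros t Ht Ht'. pose proof (bp_pos t). exists (if Rle_dec 0 r2 then bp t else - bp t).
      assert (Hw : r2 * (if Rle_dec 0 r2 then bp t else - bp t) = Rabs r2 * bp t).
      { unfold Rabs. destruct Rle_dec; destruct Rcase_abs; try ring; try lra; assert (r2 = 0) by lra; subst; ring. }
      rewrite Hw.
      assert (HB : bp (i + t) <= Rabs r2 * bp t < bp (i + t + 1)).
      { replace (i + t + 1)%Z with (i + 1 + t)%Z by lia. rewrite (bp_plus i t), (bp_plus (i + 1) t). split.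
        - apply Rmult_le_compat_r; lra.
        - apply Rmult_lt_compat_r; lra. }
      split; [destruct Rle_dec; [|apply isF_opp]; now apply isF_bp|]. split; [auto|]. split; [|auto].
      pose proof (bp_pos (i + t)). assert (bp (i + t + 1) <= bp emax) by (apply bp_le; lia).
      apply safe_bp, Rabs_intro. lra. }
    destruct (Hgen (e - i)%Z) as (w & Fw & Ew & Sw & Bw); try lia.
    replace (i + (e - i))%Z with e in Bw by lia.
    assert (Fb : isF (bp e)) by (apply isF_bp; lia).
    assert (Fb1 : isF (bp (e + 1))) by (apply isF_bp; lia).
    assert (L1 : bp e <= rn (r2 * w)) by (apply rn_ge; auto; lra).
    assert (L2 : rn (r2 * w) <= bp (e + 1)) by (apply rn_le; auto; lra).
    assert (Ee : bp (e + 1) = 2 * bp e) by apply bp_S.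
    pose proof (bp_pos e).
    destruct (Req_dec (rn (r2 * w)) (bp (e + 1))) as [C|C].
    (* For [i = 0] the halved weight might lie below the least positive float. In that case the
       bound 5/4 of (C1) keeps the product closer to [bp e] than to [bp (e + 1)]. *)
    + assert (i <> 0%Z).
      { intros ->. assert (r2 * w <= 5 / 4 * bp e).
        { rewrite Ew. replace (e - 0)%Z with e by lia. apply Rmult_le_compat_r; lra. }
        pose proof (rn_near (r2 * w) (bp e) Sw Fb) as P. rewrite C in P. revert P.
        unfold Rabs; repeat destruct Rcase_abs; intros; lra. }
      destruct (Hgen (e - i - 1)%Z) as (w' & Fw' & Ew' & Sw' & Bw'); try lia.
      assert (Hh : r2 * w = 2 * (r2 * w')).
      { rewrite Ew, Ew'. replace (bp (e - i)) with (2 * bp (e - i - 1)); [ring|].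
        rewrite <- bp_S. f_equal; lia. }
      (* Rounding up to [bp (e + 1)] bounds the distance by half the subnormal spacing; the halved
         product is then within a quarter of it from [bp e], and no other float is as near. *)
      assert (HN : bp (e + 1) - bp (emin - m) / 2 <= 2 * (r2 * w')).
      { assert (Fz : isF (bp (e + 1) - bp (emin - m))).
        { apply (isF_intro (2 ^ (e + 1 - (emin - m)) - 1) (emin - m)); try lia.
          - rewrite minus_IZR, <- bp_IZR, Rmult_minus_distr_r, <- bp_plus by lia.
            replace (e + 1 - (emin - m) + (emin - m))%Z with (e + 1)%Z by lia. ring.
          - assert (bp (emin - m) <= bp (e + 1)) by (apply bp_le; lia).
            assert (bp (e + 1) <= bp (emin - m + m + 1)) by (apply bp_le; lia).
            pose proof (bp_pos (emin - m)). apply Rabs_intro. lra. }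
        pose proof (rn_near (r2 * w) _ Sw Fz) as P. rewrite C in P. revert P.
        pose proof (bp_pos (emin - m)).
        unfold Rabs; repeat destruct Rcase_abs; intros; lra. }
      assert (R1 : rn (r2 * w') = bp e).
      { assert (L3 : rn (r2 * w') <= bp e) by (apply rn_le; auto; lra).
        destruct (Req_dec (rn (r2 * w')) (bp e)) as [|C']; auto. exfalso.
        pose proof (isF_gap_sub _ _ Fb (rn_F _ Sw') ltac:(lra)) as G.
        pose proof (rn_near (r2 * w') _ Sw' Fb) as P. revert P. pose proof (bp_pos (emin - m)).
        unfold Rabs; repeat destruct Rcase_abs; intros; lra. }
      exists (bp e), (c2, r2, w'). split; [auto|]. split; [lra|]. split; [|lia].
      repeat split; auto.
    + exists (rn (r2 * w)), (c2, r2, w). split; [now apply rn_F|]. split; [lra|]. split; [|lia].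
      repeat split; auto.
Qed.

Lemma chain_exists sigma eta s0 c2 r2 n : isF eta -> isF s0 -> sigma (EF eta) = EF s0 ->
  isF c2 -> isF r2 -> sigma (EF c2) = EF r2 ->
  bp (emin + 5) <= Rabs s0 < bp (emax - 4) -> bp (- m - 2) <= Rabs r2 < 5 / 4 ->
  forall k, (k0 <= k)%Z -> (k + Z.of_nat n <= 5 - m)%Z ->
  exists cs ps, chain k cs (k + Z.of_nat n) /\ Forall2 (src sigma) cs ps.
Proof.
  intros. revert k H7 H8. exps. induction n as [|n IH]; intros k H7 H8.
  - exists [], []. split; [|constructor]. replace (k + Z.of_nat 0)%Z with k by lia. constructor.
  - destruct (IH (k + 1)%Z) as (cs & ps & C1 & C2); try lia.
    destruct (src_avail sigma eta s0 c2 r2 (k - 1)) as (d & p & Fd & Bd & Sd & _); auto; try lia.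
    destruct (src_avail sigma eta s0 c2 r2 (m + k + 1)) as (b & q & Fb & Bb & Sb & Sb'); auto; try lia.
    destruct Sb' as [q' Sq']; [lia|].
    exists (d :: b :: - b :: cs), (p :: q :: q' :: ps). split.
    + apply chain_cons; auto.
      * now replace (k - 1 + 1)%Z with k in Bd by lia.
      * now replace (m + k + 1 + 1)%Z with (m + k + 2)%Z in Bb by lia.
      * now replace (k + Z.of_nat (S n))%Z with (k + 1 + Z.of_nat n)%Z by lia.
    + repeat constructor; auto.
Qed.

(** * Neurons and their interval abstraction *)

(** Adding 0 must be harmless for every float, also beyond [safe]; so the overflow threshold is
    compared with the largest float directly. *)
Lemma rnd_F x : isF x -> rnd E M x = EF x.
Proof.
  intros H. unfold rnd. destruct Rle_dec as [C|C].
  - exfalso. destruct H as (n & e & Hn & He & ->).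
    change (powerRZ 2 (e - m)) with (bp (e - m)) in C. unfold Omega, eps in C.
    change (powerRZ 2 emax) with (bp emax) in C. change (powerRZ 2 (- m)) with (bp (- m)) in C.
    change (powerRZ 2 (- m - 1)) with (bp (- m - 1)) in C.
    rewrite Rabs_mult, (Rabs_right (bp (e - m))), <- abs_IZR in C by (pose proof (bp_pos (e - m)); lra).
    assert (H1 : IZR (Z.abs n) <= bp (m + 1) - 1).
    { rewrite bp_IZR by lia. rewrite <- minus_IZR. now apply IZR_le. }
    assert (H2 : bp (e - m) <= bp (emax - m)) by (apply bp_le; lia).
    assert (H3 : bp (emax - m) = bp emax * bp (- m)) by (rewrite <- bp_plus; f_equal; lia).
    assert (H4 : bp (m + 1) * bp (- m) = 2).
    { rewrite <- bp_plus. replace (m + 1 + - m)%Z with 1%Z by lia. apply bp_1. }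
    pose proof (bp_pos (e - m)). pose proof (bp_pos (- m - 1)). pose proof (bp_pos emax).
    assert (0 <= IZR (Z.abs n)) by (apply IZR_le; lia).
    assert (H8 : IZR (Z.abs n) * bp (e - m) <= (bp (m + 1) - 1) * bp (emax - m)).
    { apply Rmult_le_compat; lra. }
    rewrite H3 in H8. replace ((bp (m + 1) - 1) * (bp emax * bp (- m)))
      with (bp emax * (bp (m + 1) * bp (- m) - bp (- m))) in H8 by ring. rewrite H4 in H8.
    assert (0 < bp emax * bp (- m - 1)) by now apply Rmult_lt_0_compat. lra.
  - f_equal. assert (Hx : rnd_spec E M x x).
    { split; [auto|split].
      - intros z _. rewrite Rminus_diag, Rabs_R0. apply Rabs_pos.
      - intros z _ Hz He. rewrite Rminus_diag, Rabs_R0 in He. exfalso. apply Hz.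
        revert He. unfold Rabs; destruct Rcase_abs; intros; lra. }
    apply (rnd_spec_unique x); auto. apply epsilon_spec. now exists x.
Qed.

#[local] Arguments oplus : simpl never.
#[local] Arguments otimes : simpl never.

Lemma oplus_0_r x : isF x -> oplus E M (EF x) (EF 0) = EF x.
Proof. intros H. unfold oplus. rewrite Rplus_0_r. now apply rnd_F. Qed.

Lemma oplus_0_l x : isF x -> oplus E M (EF 0) (EF x) = EF x.
Proof. intros H. unfold oplus. rewrite Rplus_0_l. now apply rnd_F. Qed.

Lemma otimes_0_r x : otimes E M (EF x) (EF 0) = EF 0.
Proof. unfold otimes. rewrite Rmult_0_r. apply rnd_F, isF_0. Qed.

Lemma otimes_rn v w : safe (v * w) -> otimes E M (EF v) (EF w) = EF (rn (v * w)).
Proof. apply rnd_rn. Qed.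

(** * Weighted sums padded with zero weights *)

Definition terms (xs : list ext) (ws : list R) : list ext :=
  map (fun q => otimes E M (fst q) (EF (snd q))) (combine xs ws).

Definition neuron (row : list R) (b : R) (xs : list ext) : ext :=
  oplus E M (fsum E M (terms xs row)) (EF b).

Notation dot acc vs ws z := (fold_left (oplus E M) (terms (map EF vs) ws) (EF acc) = EF z).

Lemma terms_app xs ys ws us : length xs = length ws ->
  terms (xs ++ ys) (ws ++ us) = terms xs ws ++ terms ys us.
Proof.
  intros H. unfold terms. revert ws H. induction xs as [|x xs IH]; intros [|w ws] H;
    try discriminate; auto. simpl. f_equal. apply IH. now injection H.
Qed.

Lemma dot_zero vs n a : isF a -> dot a vs (repeat 0 n) a.
Proof.
  intros Ha. revert n. induction vs as [|v vs IH]; intros [|n]; auto.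
  unfold terms. simpl. rewrite otimes_0_r, oplus_0_r by auto. apply IH.
Qed.

Lemma dot_app a b c vs us ws zs : length vs = length ws ->
  dot a vs ws b -> dot b us zs c -> dot a (vs ++ us) (ws ++ zs) c.
Proof.
  intros Hl H1 H2. rewrite map_app, terms_app by now rewrite length_map.
  now rewrite fold_left_app, H1.
Qed.

Lemma dot_cons a b v w vs ws z : safe (v * w) -> oplus E M (EF a) (EF (rn (v * w))) = EF b ->
  dot b vs ws z -> dot a (v :: vs) (w :: ws) z.
Proof.
  intros H1 H2 H3. unfold terms. simpl. rewrite otimes_rn by auto. now rewrite H2.
Qed.

Lemma dot_cons0 a v vs ws z : isF a -> dot a vs ws z -> dot a (v :: vs) (0 :: ws) z.
Proof.
  intros H1 H2. unfold terms. simpl. rewrite otimes_0_r, oplus_0_r; auto.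
Qed.

(** [fsum] starts from its first product and [dot] from an accumulator; they agree because 0 is
    neutral on floats. *)
Lemma fsum_fold v w vs ws z : safe (v * w) -> dot 0 (v :: vs) (w :: ws) z ->
  fsum E M (terms (map EF (v :: vs)) (w :: ws)) = EF z.
Proof.
  intros H1 H2. unfold terms in *. simpl in *. rewrite otimes_rn in * by auto.
  rewrite oplus_0_l in H2; auto. now apply rn_F.
Qed.

Lemma safe_0 : safe 0.
Proof. apply safe_bp. rewrite Rabs_R0. left; apply bp_pos. Qed.

Lemma neuron_row v1 v v2 v3 w ws b n1 n3 p : safe (v * w) -> length v1 = n1 ->
  length v2 = length ws -> isF p -> dot (rn (v * w)) v2 ws p ->
  neuron (repeat 0 n1 ++ (w :: ws) ++ repeat 0 n3) b (map EF (v1 ++ (v :: v2) ++ v3)) =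
  oplus E M (EF p) (EF b).
Proof.
  intros S H1 H2 Hp Hd. unfold neuron. f_equal.
  assert (Hall : dot 0 (v1 ++ (v :: v2) ++ v3) (repeat 0 n1 ++ (w :: ws) ++ repeat 0 n3) p).
  { apply dot_app with 0; [now rewrite repeat_length| |].
    - apply dot_zero, isF_0.
    - apply dot_app with p; [simpl; lia| |now apply dot_zero].
      apply dot_cons with (rn (v * w)); auto. apply oplus_0_l. now apply rn_F. }
  destruct v1 as [|u v1]; destruct n1 as [|n1]; try discriminate H1.
  - simpl in *. now apply fsum_fold.
  - simpl in *. apply fsum_fold; auto. rewrite Rmult_0_r. apply safe_0.
Qed.

Lemma neuron_zero vs n b : isF b -> neuron (repeat 0 n) b (map EF vs) = EF b.
Proof.
  intros Hb. unfold neuron.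
  assert (H : fsum E M (terms (map EF vs) (repeat 0 n)) = EF 0).
  { destruct vs as [|v vs]; [auto|]. destruct n as [|n]; [auto|].
    change (repeat 0 (S n)) with (0 :: repeat 0 n). apply fsum_fold.
    - rewrite Rmult_0_r. apply safe_0.
    - apply (dot_zero (v :: vs) (S n)), isF_0. }
  rewrite H. now apply oplus_0_l.
Qed.

(** * Predicates on wires and the layers that transport them *)

Notation pred := (R -> Prop).
Notation sat := (Forall2 (fun (P : pred) (v : R) => P v)).

Lemma float_list : exists l, forall x, isF x -> In x l.
Proof.
  set (zr := fun (a : Z) (n : nat) => map (fun i => (a + Z.of_nat i)%Z) (seq 0 n)).
  assert (Hzr : forall a n z, (a <= z < a + Z.of_nat n)%Z -> In z (zr a n)).
  { intros a n z Hz. apply in_map_iff. exists (Z.to_nat (z - a)). split; [lia|].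
    apply in_seq. lia. }
  exists (map (fun p => IZR (fst p) * powerRZ 2 (snd p - m))
    (list_prod (zr (- 2 ^ (m + 1))%Z (Z.to_nat (2 * 2 ^ (m + 1)))) (zr emin (Z.to_nat (emax - emin + 1))))).
  intros x (n & e & Hn & He & ->). apply in_map_iff. exists (n, e). split; auto.
  apply in_prod; apply Hzr; lia.
Qed.

Definition computes (Ps : list pred) (rb : list R * R) (Q : pred) : Prop :=
  forall vs, sat Ps vs -> exists z, neuron (fst rb) (snd rb) (map EF vs) = EF z /\ Q z.

(** [sharp] inspects all floats between the endpoints of an interval, whereas [holdsI] constrains
    only the endpoints. Convexity of [P] among the floats closes this gap. *)
Definition activates (sigma : ext -> ext) (P Q : pred) : Prop :=
  (forall a, P a -> isF a) /\ (forall a b c, P a -> P b -> isF c -> a <= c <= b -> P c) /\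
  (forall a, P a -> exists v, sigma (EF a) = EF v /\ Q v).

Definition mk_layer (L : list (list R * R)) : layer := Layer (map fst L) (map snd L).

Definition rows_ok (k : nat) (L : list (list R * R)) : Prop :=
  Forall (fun rb => length (fst rb) = k /\ Forall isF (fst rb) /\ isF (snd rb)) L.

Lemma combine_mk (L : list (list R * R)) : combine (map fst L) (map snd L) = L.
Proof. induction L as [|[r b] L IH]; simpl; congruence. Qed.

Lemma layer_ok_mk k L : rows_ok k L -> layer_ok E M k (length L) (mk_layer L).
Proof.
  intros H. unfold layer_ok, mk_layer. simpl. rewrite !length_map.
  repeat split; auto; apply Forall_map; (eapply Forall_impl; [|exact H]); simpl; tauto.
Qed.

Inductive reach (sigma : ext -> ext) : list pred -> list (list (list R * R)) -> list pred -> Prop :=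
| reach_nil Ps : reach sigma Ps [] Ps
| reach_cons Ps L Ls Qs Rs :
    Forall2 (fun rb Q => exists P, computes Ps rb P /\ activates sigma P Q) L Qs ->
    reach sigma Qs Ls Rs -> reach sigma Ps (L :: Ls) Rs.

Lemma reach_app sigma Ps A Qs B Rs : reach sigma Ps A Qs -> reach sigma Qs B Rs ->
  reach sigma Ps (A ++ B) Rs.
Proof. induction 1; simpl; auto. intros. econstructor; eauto. Qed.

(** The concrete network and its interval abstraction are both instances of the following evaluation. *)
Section Domain.
Variable X : Type.
Variables add mul : X -> X -> X.
Variable cst : R -> X.
Variable act : X -> X.
Variable sigma : ext -> ext.
Variable holds : pred -> X -> Prop.
Hypothesis holds_inh : forall P x, holds P x -> exists a, P a.
Hypothesis holds_mono : forall (P Q : pred) x, (forall a, P a -> Q a) -> holds P x -> holds Q x.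
Hypothesis holds_cst : forall (P : pred) c, P c -> holds P (cst c).
Hypothesis holds_add : forall (P Q S : pred) x y, holds P x -> holds Q y ->
  (forall a b, P a -> Q b -> exists c, oplus E M (EF a) (EF b) = EF c /\ S c) -> holds S (add x y).
Hypothesis holds_mul : forall (P Q S : pred) x y, holds P x -> holds Q y ->
  (forall a b, P a -> Q b -> exists c, otimes E M (EF a) (EF b) = EF c /\ S c) -> holds S (mul x y).
Hypothesis holds_act : forall (P Q : pred) x, holds P x ->
  (forall a, P a -> isF a) -> (forall a b c, P a -> P b -> isF c -> a <= c <= b -> P c) ->
  (forall a, P a -> exists v, sigma (EF a) = EF v /\ Q v) -> holds Q (act x).

Definition gterms (xs : list X) (ws : list R) : list X :=
  map (fun q => mul (fst q) (cst (snd q))) (combine xs ws).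
Definition gsum (l : list X) : X :=
  match l with [] => cst 0 | t :: ts => fold_left add ts t end.
Definition gaff (l : layer) (x : list X) : list X :=
  map (fun p => add (gsum (gterms x (fst p))) (cst (snd p))) (combine (lW l) (lb l)).
Fixpoint ghid (ls : list layer) (x : list X) : list X :=
  match ls with [] => x | l :: ls' => ghid ls' (map act (gaff l x)) end.

Lemma fold_finite ts e z : fold_left (oplus E M) ts e = EF z -> exists r, e = EF r.
Proof.
  revert e. induction ts as [|t ts IH]; simpl; intros e H; [now exists z|].
  apply IH in H. destruct H as [r Hr]. destruct e as [r'| | |]; [now exists r'| | |];
    destruct t; discriminate.
Qed.

Lemma oplus_finite_r a t r : oplus E M (EF a) t = EF r -> exists s, t = EF s.
Proof. destruct t as [s| | |]; simpl; try discriminate. now exists s. Qed.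

Lemma sat_inh Ps xs : Forall2 holds Ps xs -> exists vs, sat Ps vs.
Proof.
  induction 1 as [|P x Ps xs H _ [vs IH]]; [now exists []|].
  destruct (holds_inh P x H) as [v Hv]. exists (v :: vs). now constructor.
Qed.

(** The invariant of a partial sum is the set of all its possible values, so no bounds on partial
    sums have to be stated. Wires range independently, hence treating them one at a time loses
    nothing. Partial sums are finite because an infinity or NaN never becomes finite again;
    [sat_inh] supplies values for the terms still to come. *)
Lemma fold_holds Ps xs : Forall2 holds Ps xs -> forall ws (A S : pred) x0, holds A x0 ->
  (forall a vs, A a -> sat Ps vs -> exists z, dot a vs ws z /\ S z) ->
  holds S (fold_left add (gterms xs ws) x0).
Proof.
  induction 1 as [|P x Ps xs HP HPs IH]; intros ws A S x0 H0 HS.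
  - simpl. apply holds_mono with A; auto. intros a Ha.
    destruct (HS a [] Ha) as [z [H1 H2]]; [constructor|]. simpl in H1. injection H1 as ->. auto.
  - destruct ws as [|w ws].
    + simpl. apply holds_mono with A; auto. intros a Ha.
      destruct (sat_inh (P :: Ps) (x :: xs)) as [vs Hvs]; [now constructor|].
      destruct (HS a vs Ha Hvs) as [z [H1 H2]].
      unfold terms in H1. rewrite combine_nil in H1. simpl in H1. injection H1 as ->. auto.
    + unfold gterms. simpl. destruct (sat_inh Ps xs HPs) as [us Hus].
      destruct (holds_inh A x0 H0) as [a0 Ha0].
      assert (fin : forall a v, A a -> P v -> exists t c,
                otimes E M (EF v) (EF w) = EF t /\ oplus E M (EF a) (EF t) = EF c).
      { intros a v Ha Hv. destruct (HS a (v :: us) Ha) as [z [H1 _]]; [now constructor|].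
        unfold terms in H1. simpl map in H1. simpl fold_left in H1.
        destruct (fold_finite _ _ _ H1) as [c Hc].
        destruct (oplus_finite_r _ _ _ Hc) as [t Ht]. rewrite Ht in Hc. now exists t, c. }
      apply (IH ws (fun c => exists a v t, A a /\ P v /\ otimes E M (EF v) (EF w) = EF t /\
                       oplus E M (EF a) (EF t) = EF c)).
      * apply holds_add with A (fun t => exists v, P v /\ otimes E M (EF v) (EF w) = EF t); auto.
        -- apply holds_mul with P (fun c => c = w); auto.
           intros v c Hv ->. destruct (fin a0 v Ha0 Hv) as (t & c & H1 & _). exists t. eauto.
        -- intros a t Ha (v & Hv & Ht). destruct (fin a v Ha Hv) as (t' & c & H1 & H2).
           rewrite Ht in H1. injection H1 as <-. exists c. split; auto. now exists a, v, t.
      * intros c vs (a & v & t & Ha & Hv & Ht & Hc) Hvs.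
        destruct (HS a (v :: vs) Ha) as [z [H1 H2]]; [now constructor|].
        exists z. split; auto. unfold terms in H1. simpl map in H1. simpl fold_left in H1.
        now rewrite Ht, Hc in H1.
Qed.

Lemma neuron_holds Ps xs row b (S : pred) : Forall2 holds Ps xs ->
  (forall vs, sat Ps vs -> exists z, neuron row b (map EF vs) = EF z /\ S z) ->
  holds S (add (gsum (gterms xs row)) (cst b)).
Proof.
  intros H HS.
  apply holds_add with (fun p => exists vs, sat Ps vs /\ fsum E M (terms (map EF vs) row) = EF p)
    (fun c => c = b); auto.
  - assert (fin : forall vs, sat Ps vs -> exists p, fsum E M (terms (map EF vs) row) = EF p).
    { intros vs Hvs. destruct (HS vs Hvs) as [z [H1 _]]. unfold neuron in H1.
      exact (fold_finite [EF b] _ z H1). }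
    destruct H as [|P x Ps xs HP HPs].
    + simpl. apply holds_cst. exists []. split; [constructor|auto].
    + destruct row as [|w row].
      * simpl. apply holds_cst. destruct (sat_inh (P :: Ps) (x :: xs)) as [vs Hvs]; [now constructor|].
        exists vs. split; auto. unfold terms. now rewrite combine_nil.
      * destruct (sat_inh Ps xs HPs) as [us Hus].
        unfold gterms. simpl.
        apply (fold_holds Ps xs HPs row (fun t => exists v, P v /\ otimes E M (EF v) (EF w) = EF t)).
        -- apply holds_mul with P (fun c => c = w); auto. intros v c Hv ->.
           destruct (fin (v :: us)) as [p Hp]; [now constructor|].
           unfold terms in Hp. simpl map in Hp. unfold fsum in Hp.
           destruct (fold_finite _ _ _ Hp) as [t Ht]. exists t. split; [exact Ht|]. now exists v.
        -- intros t vs (v & Hv & Ht) Hvs. destruct (fin (v :: vs)) as [p Hp]; [now constructor|].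
           exists p. split; [|exists (v :: vs); split; auto; now constructor].
           unfold terms in Hp. simpl map in Hp. unfold fsum in Hp.
           simpl in Hp. now rewrite Ht in Hp.
  - intros p c (vs & Hvs & Hp) ->. destruct (HS vs Hvs) as [z [H1 H2]]. exists z. split; auto.
    unfold neuron in H1. now rewrite Hp in H1.
Qed.

Lemma layer_holds Ps xs L Qs : Forall2 holds Ps xs ->
  Forall2 (fun rb Q => computes Ps rb Q) L Qs -> Forall2 holds Qs (gaff (mk_layer L) xs).
Proof.
  intros H HL. unfold gaff, mk_layer. simpl lW. simpl lb. rewrite combine_mk.
  induction HL as [|[row b] Q L Qs HQ _ IH]; simpl; constructor; auto.
  apply neuron_holds with Ps; auto.
Qed.

Lemma reach_holds Ps Ls Rs : reach sigma Ps Ls Rs -> forall xs, Forall2 holds Ps xs ->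
  Forall2 holds Rs (ghid (map mk_layer Ls) xs).
Proof.
  induction 1 as [Ps|Ps L Ls Qs Rs HL _ IH]; intros xs Hxs; simpl; auto. apply IH. clear IH.
  unfold gaff, mk_layer. simpl lW. simpl lb. rewrite combine_mk.
  induction HL as [|[row b] Q L Qs (P & HP & A1 & A2 & A3) _ IHL]; simpl; constructor; auto.
  apply (holds_act P); auto. apply neuron_holds with Ps; auto.
Qed.

End Domain.

Fixpoint hwf (k : nat) (Ls : list (list (list R * R))) (k' : nat) : Prop :=
  match Ls with [] => k = k' | L :: Ls' => rows_ok k L /\ hwf (length L) Ls' k' end.

Lemma hid_wf Ls : forall k k' O, hwf k Ls k' -> rows_ok k' O ->
  wf_net E M k (map mk_layer Ls ++ [mk_layer O]) (length O).
Proof.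
  induction Ls as [|L Ls IH]; simpl; intros k k' O H HO.
  - subst. exists (length O). split; [now apply layer_ok_mk|]. now left.
  - destruct H as [H1 H2]. exists (length L). split; [now apply layer_ok_mk|].
    right. split; [now destruct Ls|]. now apply IH with k'.
Qed.

Lemma eval_net_hid sigma ls l : forall x, eval_net E M sigma (ls ++ [l]) x =
  gaff ext (oplus E M) (otimes E M) EF l (ghid ext (oplus E M) (otimes E M) EF sigma ls x).
Proof.
  induction ls as [|l0 ls IH]; intros x; [reflexivity|].
  cbn [ghid]. rewrite <- IH. simpl. now destruct ls.
Qed.

Definition point (c : R) : itv := Itv (EF c) (EF c).

Lemma eval_sharp_hid sigma ls l : forall X, eval_sharp E M sigma (ls ++ [l]) X =
  gaff itv (isharp (oplus E M)) (isharp (otimes E M)) point l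
    (ghid itv (isharp (oplus E M)) (isharp (otimes E M)) point (sharp E M sigma) ls X).
Proof.
  induction ls as [|l0 ls IH]; intros X; [reflexivity|].
  cbn [ghid]. rewrite <- IH. simpl. now destruct ls.
Qed.

(** * Predicates on concrete values and on intervals *)

Definition holdsC (P : pred) (x : ext) : Prop := exists r, x = EF r /\ P r.
(** Only the endpoints are constrained. This is stable under [isharp], whose endpoints are results on endpoints, so no
    monotonicity of the operations is needed. *)
Definition holdsI (P : pred) (I : itv) : Prop :=
  exists a b, I = Itv (EF a) (EF b) /\ a <= b /\ P a /\ P b.

Lemma holdsC_inh P x : holdsC P x -> exists a, P a.
Proof. intros (r & _ & H). now exists r. Qed.

Lemma holdsC_mono (P Q : pred) x : (forall a, P a -> Q a) -> holdsC P x -> holdsC Q x.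
Proof. intros H (r & H1 & H2). exists r. auto. Qed.

Lemma holdsC_cst (P : pred) c : P c -> holdsC P (EF c).
Proof. now exists c. Qed.

Lemma holdsC_op op (P Q S : pred) x y : holdsC P x -> holdsC Q y ->
  (forall a b, P a -> Q b -> exists c, op (EF a) (EF b) = EF c /\ S c) -> holdsC S (op x y).
Proof. intros (a & -> & Pa) (b & -> & Qb) H. now apply H. Qed.

Lemma holdsC_act sigma (P Q : pred) x : holdsC P x ->
  (forall a, P a -> isF a) -> (forall a b c, P a -> P b -> isF c -> a <= c <= b -> P c) ->
  (forall a, P a -> exists v, sigma (EF a) = EF v /\ Q v) -> holdsC Q (sigma x).
Proof. intros (a & -> & Pa) _ _ H. now apply H. Qed.

Lemma holdsI_inh P x : holdsI P x -> exists a, P a.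
Proof. intros (a & b & _ & _ & H & _). now exists a. Qed.

Lemma holdsI_mono (P Q : pred) x : (forall a, P a -> Q a) -> holdsI P x -> holdsI Q x.
Proof. intros H (a & b & H1 & H2 & H3 & H4). exists a, b. auto. Qed.

Lemma holdsI_cst (P : pred) c : P c -> holdsI P (point c).
Proof. intros H. exists c, c. repeat split; auto; lra. Qed.

Lemma min_max_ends (S : pred) a b c d : S a -> S b -> S c -> S d ->
  exists x y, min_ext (min_ext (EF a) (EF b)) (min_ext (EF c) (EF d)) = EF x /\
    max_ext (max_ext (EF a) (EF b)) (max_ext (EF c) (EF d)) = EF y /\ x <= y /\ S x /\ S y.
Proof.
  intros Ha Hb Hc Hd.
  assert (mn : forall x y, S x -> S y -> exists z, min_ext (EF x) (EF y) = EF z /\ S z /\ z <= x /\ z <= y).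
  { intros x y Hx Hy. unfold min_ext, leb_ext. destruct Rle_dec; eexists; split; eauto;
      repeat split; auto; lra. }
  assert (mx : forall x y, S x -> S y -> exists z, max_ext (EF x) (EF y) = EF z /\ S z /\ x <= z /\ y <= z).
  { intros x y Hx Hy. unfold max_ext, leb_ext. destruct Rle_dec; eexists; split; eauto;
      repeat split; auto; lra. }
  destruct (mn a b) as (x1 & -> & X1 & X2 & X3); auto. destruct (mn c d) as (x2 & -> & X4 & X5 & X6); auto.
  destruct (mx a b) as (y1 & -> & Y1 & Y2 & Y3); auto. destruct (mx c d) as (y2 & -> & Y4 & Y5 & Y6); auto.
  destruct (mn x1 x2) as (x & -> & X7 & X8 & X9); auto. destruct (mx y1 y2) as (y & -> & Y7 & Y8 & Y9); auto.
  exists x, y. repeat split; auto. lra.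
Qed.

Lemma holdsI_op op (P Q S : pred) x y : holdsI P x -> holdsI Q y ->
  (forall a b, P a -> Q b -> exists c, op (EF a) (EF b) = EF c /\ S c) -> holdsI S (isharp op x y).
Proof.
  intros (a & b & -> & _ & Pa & Pb) (c & d & -> & _ & Qc & Qd) H. unfold isharp.
  destruct (H a c) as (z1 & -> & Z1); auto. destruct (H a d) as (z2 & -> & Z2); auto.
  destruct (H b c) as (z3 & -> & Z3); auto. destruct (H b d) as (z4 & -> & Z4); auto.
  simpl orb. cbv iota.
  destruct (min_max_ends S z1 z2 z3 z4) as (u & v & -> & -> & Huv & Su & Sv); auto.
  exists u, v. auto.
Qed.

(** [sharp] is defined by choice, so an interval meeting [sharp_spec] has to be exhibited; its
    endpoints are attained because there are finitely many floats. *)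
Lemma holdsI_act sigma (P Q : pred) x : holdsI P x ->
  (forall a, P a -> isF a) -> (forall a b c, P a -> P b -> isF c -> a <= c <= b -> P c) ->
  (forall a, P a -> exists v, sigma (EF a) = EF v /\ Q v) -> holdsI Q (sharp E M sigma x).
Proof.
  intros (a & b & -> & Hab & Pa & Pb) HF HC HA.
  set (I := Itv (EF a) (EF b)).
  assert (HI : forall y, in_gamma E M I y -> exists r, y = EF r /\ isF r /\ a <= r <= b).
  { intros y (H1 & H2 & H3). destruct y as [r| | |]; simpl in *; try tauto. now exists r. }
  assert (HI' : forall r, isF r -> a <= r <= b -> in_gamma E M I (EF r)).
  { intros r Fr Hr. simpl. tauto. }
  (* The default 0 never occurs for floats between [a] and [b]. *)
  set (g := fun r => match sigma (EF r) with EF v => v | _ => 0 end).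
  assert (Hg : forall r, isF r -> a <= r <= b -> sigma (EF r) = EF (g r) /\ Q (g r)).
  { intros r Fr Hr. destruct (HA r) as (v & H1 & H2); [now apply HC with a b|].
    unfold g. now rewrite H1. }
  destruct float_list as [l Hl].
  assert (Hex : exists r, In r l /\ (isF r /\ a <= r <= b)).
  { exists a. repeat split; auto; lra. }
  assert (Hs : exists J, sharp_spec E M sigma I J).
  { destruct (argmin l _ g Hex) as (r1 & _ & [F1 B1] & M1).
    destruct (argmin l _ (fun r => - g r) Hex) as (r2 & _ & [F2 B2] & M2).
    exists (Itv (EF (g r1)) (EF (g r2))). right. split.
    - intros (y & Hy & Hn). destruct (HI y Hy) as (r & -> & Fr & Br).
      destruct (Hg r Fr Br) as [H _]. congruence.
    - exists (EF (g r1)), (EF (g r2)). split; auto. split; [|split].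
      + exists (EF r1). split; auto. now apply Hg.
      + exists (EF r2). split; auto. now apply Hg.
      + intros y (z & Hz & <-). destruct (HI z Hz) as (r & -> & Fr & Br).
        destruct (Hg r Fr Br) as [-> _]. specialize (M1 r (Hl r Fr) (conj Fr Br)).
        specialize (M2 r (Hl r Fr) (conj Fr Br)). simpl. lra. }
  assert (Hsp : sharp_spec E M sigma I (sharp E M sigma I)) by (unfold sharp; now apply epsilon_spec).
  destruct Hsp as [[(y & Hy & Hn) _]|[_ (u & v & -> & (y1 & H1 & <-) & (y2 & H2 & <-) & HS)]].
  - destruct (HI y Hy) as (r & -> & Fr & Br). destruct (Hg r Fr Br) as [H _]. congruence.
  - destruct (HS (sigma y2)) as [H3 _]; [now exists y2|].
    destruct (HI y1 H1) as (r1 & -> & F1 & B1). destruct (HI y2 H2) as (r2 & -> & F2 & B2).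
    destruct (Hg r1 F1 B1) as [E1 Q1]. destruct (Hg r2 F2 B2) as [E2 Q2]. rewrite E1, E2 in *.
    exists (g r1), (g r2). auto.
Qed.

(** A status [s] is the pair of propositions (surely true, surely false); neither holds when a box straddles the
    decision boundary. *)
Definition decided (lo hi : R) (s : Prop * Prop) (y : R) : Prop :=
  isF y /\ (fst s -> hi <= y) /\ (snd s -> y <= lo).

Notation box := (nat -> R -> Prop).
Notation sg := (box -> Prop * Prop).

(** * Gates *)

Section Gates.
Variable sigma : ext -> ext.
Variables eta etap s0 s1 dir lam : R.
Variable om : Z.
Variables cs1 cs2 : list R.
Variables L1 L2 : list (R * R * R).
Hypothesis Hdir : dir = 1 \/ dir = -1.
Hypothesis Feta : isF eta.
Hypothesis Fetap : isF etap.
Hypothesis Heta : Rabs eta <= 4.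
Hypothesis Hee : eta < etap.
Hypothesis Hetap : etap <= eta + bp (1 - m).
Hypothesis Hdich : forall x, isF x -> x <= eta \/ etap <= x.
Hypothesis Fs0 : isF s0.
Hypothesis Fs1 : isF s1.
Hypothesis Hs0 : sigma (EF eta) = EF s0.
Hypothesis Hs1 : sigma (EF etap) = EF s1.
Hypothesis Hn0 : bp (emin + 5) <= Rabs s0.
Hypothesis Hlt : dir * s0 < dir * s1.
Hypothesis Hlam : 0 <= lam.
Hypothesis Hlo : forall x, isF x -> x <= eta ->
  exists v, sigma (EF x) = EF v /\ isF v /\ dir * s0 - lam * (eta - x) <= dir * v <= dir * s0.
Hypothesis Hhi : forall x, isF x -> etap <= x ->
  exists v, sigma (EF x) = EF v /\ isF v /\ dir * s1 <= dir * v <= dir * s1 + lam * (x - etap).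
Hypothesis Hom : (emin - m <= om <= 0)%Z.
Hypothesis Hom1 : lam * bp om <= / 8.
Hypothesis Hom2 : Rabs s0 * bp om < bp emin -> lam * bp om <= / 64.
Hypothesis Hom3 : Rabs s0 * bp om <= bp (5 - m).
Hypothesis Hom4 : Rabs s1 * bp om <= bp (5 - m).
Hypothesis Hgap : rn (dir * s0 * bp om) + bp k0 <= rn (dir * s1 * bp om).
Hypothesis Hc1 : chain k0 cs1 (1 - m).
Hypothesis Hc2 : chain (1 - m) cs2 (5 - m).
Hypothesis HL1 : Forall2 (src sigma) cs1 L1.
Hypothesis HL2 : Forall2 (src sigma) cs2 L2.

(** The range is kept because it is all that is known of an undetermined wire. Multiplying by [dir]
    lets [sigma] be treated as increasing at [eta]. *)
Definition wire (RL RH : R) (s : Prop * Prop) (v : R) : Prop :=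
  isF v /\ dir * s0 - lam * RL <= dir * v <= dir * s1 + lam * RH /\
  (fst s -> dir * s1 <= dir * v) /\ (snd s -> dir * v <= dir * s0).

Definition pre (RL RH : R) (s : Prop * Prop) (x : R) : Prop :=
  isF x /\ eta - RL <= x <= eta + RH /\ (fst s -> etap <= x) /\ (snd s -> x <= eta).

Lemma pre_wire RL RH s : 0 <= RL -> 0 <= RH -> activates sigma (pre RL RH s) (wire RL RH s).
Proof.
  intros HL HH. repeat split.
  - intros a Ha. apply Ha.
  - auto.
  - destruct H as (_ & B & _). lra.
  - destruct H0 as (_ & B & _). lra.
  - destruct H as (_ & _ & B & _). intros C. specialize (B C). lra.
  - destruct H0 as (_ & _ & _ & B). intros C. specialize (B C). lra.
  - intros x (Fx & Bx & Tx & Gx). destruct (Hdich x Fx) as [C|C].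
    + destruct (Hlo x Fx C) as (v & E1 & E2 & E3). exists v.
      assert (lam * (eta - x) <= lam * RL) by (apply Rmult_le_compat_l; lra).
      assert (0 <= lam * RH) by (apply Rmult_le_pos; lra).
      repeat split; auto; try lra. intros T. specialize (Tx T). lra.
    + destruct (Hhi x Fx C) as (v & E1 & E2 & E3). exists v.
      assert (lam * (x - etap) <= lam * RH) by (apply Rmult_le_compat_l; lra).
      assert (0 <= lam * RL) by (apply Rmult_le_pos; lra).
      repeat split; auto; try lra. intros T. specialize (Gx T). lra.
Qed.

Definition sgn (pol : bool) : R := if pol then dir else - dir.
Definition sF (pol : bool) : R := if pol then dir * s0 else - (dir * s1).
Definition sT (pol : bool) : R := if pol then dir * s1 else - (dir * s0).
(** Being the rounded image of the false level, it bounds every surely false signal by monotonicity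
    of rounding alone. *)
Definition thr (pol : bool) : R := rn (sF pol * bp om).
Definition flip (pol : bool) (s : Prop * Prop) : Prop * Prop :=
  if pol then s else (snd s, fst s).

Lemma Rabs_dir x : Rabs (dir * x) = Rabs x.
Proof.
  destruct Hdir as [-> | ->]; [now rewrite Rmult_1_l|].
  rewrite <- (Rabs_Ropp x). f_equal; ring.
Qed.

Lemma bp5_small : bp (5 - m) <= bp (emax - 8).
Proof. apply small_bound; lia. Qed.

Lemma const_small x : Rabs x * bp om <= bp (5 - m) ->
  safe (x * bp om) /\ Rabs (rn (x * bp om)) <= bp (5 - m).
Proof.
  intros H. exps. pose proof (bp_pos om).
  assert (H1 : Rabs (x * bp om) <= bp (5 - m)) by (rewrite Rabs_mult, (Rabs_right (bp om)); lra).
  assert (S : safe (x * bp om)).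
  { apply safe_bp. assert (bp (5 - m) <= bp emax) by (apply bp_le; lia). lra. }
  split; auto. apply Rabs_intro, rn_abs; auto. apply isF_bp; lia.
Qed.

Lemma sF_small pol : safe (sF pol * bp om) /\ Rabs (thr pol) <= bp (5 - m).
Proof.
  apply const_small. destruct pol; simpl; rewrite ?Rabs_Ropp, Rabs_dir; auto.
Qed.

Lemma thr_F pol : isF (thr pol).
Proof. apply rn_F, sF_small. Qed.

Lemma thr_gap pol : safe (sT pol * bp om) /\ thr pol + bp k0 <= rn (sT pol * bp om).
Proof.
  assert (S : safe (sT pol * bp om)).
  { apply const_small. destruct pol; simpl; rewrite ?Rabs_Ropp, Rabs_dir; auto. }
  split; auto. unfold thr. destruct pol; simpl; auto.
  rewrite !Ropp_mult_distr_l_reverse, !rn_opp; [lra| |].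
  - destruct (sF_small true). auto.
  - apply const_small. now rewrite Rabs_dir.
Qed.

Definition wt (pol : bool) : R := sgn pol * bp om.

Lemma wt_F pol : isF (wt pol).
Proof.
  exps. unfold wt. assert (isF (bp om)) by (apply isF_bp; lia).
  assert (sgn pol = 1 \/ sgn pol = -1) as [-> | ->].
  { destruct pol, Hdir; simpl; lra. }
  - now rewrite Rmult_1_l.
  - replace (-1 * bp om) with (- bp om) by ring. now apply isF_opp.
Qed.

(** The weight turns the range [RL] into an undershoot of at most [RL / 8], which rounding may
    double; hence the exponent [r - 2]. The bound is confined to positive polarity because under
    negation the undershoot stems from [RH], which is not contracted. *)
Lemma signal pol RL RH s v : wire RL RH s v ->
  0 <= RL <= 3 * bp (emax - 1) -> 0 <= RH <= 3 * bp (emax - 1) ->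
  safe (v * wt pol) /\ isF (rn (v * wt pol)) /\ Rabs (rn (v * wt pol)) <= bp (emax - 2) /\
  (fst (flip pol s) -> thr pol + bp k0 <= rn (v * wt pol)) /\
  (snd (flip pol s) -> rn (v * wt pol) <= thr pol) /\
  (RL <= bp emax -> RH <= bp emax -> rn (v * wt pol) <= 3 * bp (emax - 4)) /\
  (pol = true -> forall r, (2 - m <= r)%Z -> RL <= bp r -> thr pol - bp (r - 2) <= rn (v * wt pol)).
Proof.
  intros (Fv & Bv & Tv & Gv) HL HH. exps. pose proof (bp_pos om).
  pose proof bp5_small.
  assert (B3 : bp (emax - 4) = 16 * bp (emax - 8)) by (rel (emax - 4)%Z (emax - 8)%Z 4%nat; lra).
  assert (B4 : bp (emax - 2) = 64 * bp (emax - 8)) by (rel (emax - 2)%Z (emax - 8)%Z 6%nat; lra).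
  assert (B5 : bp (emax - 1) = 128 * bp (emax - 8)) by (rel (emax - 1)%Z (emax - 8)%Z 7%nat; lra).
  assert (B6 : bp emax = 256 * bp (emax - 8)) by (rel constr:(emax) (emax - 8)%Z 8%nat; lra).
  pose proof (bp_pos (emax - 8)).
  set (u := sgn pol * v).
  assert (Ey : v * wt pol = u * bp om) by (unfold u, wt; ring). rewrite Ey.
  set (R1 := if pol then RL else RH). set (R2 := if pol then RH else RL).
  assert (Bu : sF pol - lam * R1 <= u <= sT pol + lam * R2).
  { unfold u, R1, R2. destruct pol; simpl; lra. }
  assert (Tu : fst (flip pol s) -> sT pol <= u).
  { unfold u. destruct pol; simpl; intros T; [apply Tv in T|apply Gv in T]; lra. }
  assert (Gu : snd (flip pol s) -> u <= sF pol).
  { unfold u. destruct pol; simpl; intros T; [apply Gv in T|apply Tv in T]; lra. }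
  assert (HR1 : 0 <= R1 <= 3 * bp (emax - 1)) by (unfold R1; destruct pol; lra).
  assert (HR2 : 0 <= R2 <= 3 * bp (emax - 1)) by (unfold R2; destruct pol; lra).
  assert (E1 : lam * R1 * bp om <= R1 / 8).
  { replace (lam * R1 * bp om) with (lam * bp om * R1) by ring.
    assert (lam * bp om * R1 <= / 8 * R1) by (apply Rmult_le_compat_r; lra). lra. }
  assert (E2 : lam * R2 * bp om <= R2 / 8).
  { replace (lam * R2 * bp om) with (lam * bp om * R2) by ring.
    assert (lam * bp om * R2 <= / 8 * R2) by (apply Rmult_le_compat_r; lra). lra. }
  assert (Hb : forall x, Rabs x * bp om <= bp (5 - m) -> - bp (5 - m) <= x * bp om <= bp (5 - m)).
  { intros x Hx. apply Rabs_elim. rewrite Rabs_mult, (Rabs_right (bp om)); lra. }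
  assert (SFb : - bp (5 - m) <= sF pol * bp om <= bp (5 - m)).
  { apply Hb. destruct pol; simpl; rewrite ?Rabs_Ropp, Rabs_dir; auto. }
  assert (STb : - bp (5 - m) <= sT pol * bp om <= bp (5 - m)).
  { apply Hb. destruct pol; simpl; rewrite ?Rabs_Ropp, Rabs_dir; auto. }
  assert (Y1 : sF pol * bp om - lam * R1 * bp om <= u * bp om).
  { rewrite <- Rmult_minus_distr_r. apply Rmult_le_compat_r; lra. }
  assert (Y2 : u * bp om <= sT pol * bp om + lam * R2 * bp om).
  { rewrite <- Rmult_plus_distr_r. apply Rmult_le_compat_r; lra. }
  assert (Sy : safe (u * bp om)) by (apply safe_intro; lra).
  destruct (sF_small pol) as [SF1 SF2]. destruct (thr_gap pol) as [ST1 ST2].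
  split; [auto|]. split; [now apply rn_F|]. split; [|split; [|split; [|split]]].
  - apply Rabs_intro, rn_abs; auto; [apply isF_bp; lia|]. apply Rabs_intro. lra.
  - intros T. eapply Rle_trans; [exact ST2|]. apply rn_mono; auto.
    apply Rmult_le_compat_r; [lra|auto].
  - intros T. apply rn_mono; auto. apply Rmult_le_compat_r; [lra|auto].
  - intros RL' RH'. apply rn_le; auto; [apply isF_small; lia|].
    assert (R2 <= bp emax) by (unfold R2; destruct pol; lra). lra.
  - intros -> r Hr Hr'. simpl in R1. unfold R1 in *.
    assert (Er : bp r = 64 * bp (r - 6)) by (rel r (r - 6)%Z 6%nat; lra).
    assert (Er2 : bp (r - 2) = 16 * bp (r - 6)) by (rel (r - 2)%Z (r - 6)%Z 4%nat; lra).
    pose proof (bp_pos (r - 6)).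
    replace (bp (r - 2)) with (2 * (8 * bp (r - 6))) by lra.
    apply rn_dev_lo; auto; [apply thr_F|lra|].
    enough (thr true - 8 * bp (r - 6) <= sF true * bp om - lam * RL * bp om) by lra.
    (* A threshold in the subnormal range may be inexact, and its error eats into the allowance
       [bp (r - 3)]; the factor 1/64 makes room for it. Otherwise the threshold is exact and 1/8
       suffices. *)
    destruct (Rlt_le_dec (Rabs s0 * bp om) (bp emin)) as [C|C].
    + specialize (Hom2 C).
      assert (E3 : lam * RL * bp om <= RL / 64).
      { replace (lam * RL * bp om) with (lam * bp om * RL) by ring.
        assert (lam * bp om * RL <= / 64 * RL) by (apply Rmult_le_compat_r; lra). lra. }
      assert (E4 : Rabs (thr true - sF true * bp om) <= bp (emin + 1 - m - 2)).
      { apply rn_err; [lia|]. rewrite Rabs_mult, (Rabs_right (bp om)) by lra. simpl.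
        rewrite Rabs_dir. rewrite bp_S. pose proof (bp_pos emin). lra. }
      assert (bp (emin + 1 - m - 2) <= bp (r - 6 + 2)) by (apply bp_le; lia).
      assert (bp (r - 6 + 2) = 4 * bp (r - 6)) by (rel (r - 6 + 2)%Z (r - 6)%Z 2%nat; lra).
      apply Rabs_elim in E4. lra.
    + enough (thr true = sF true * bp om) by lra. apply rn_id; auto. simpl.
      destruct (binade (Rabs (dir * s0))) as [i Hi].
      { rewrite Rabs_dir. pose proof (bp_pos (emin + 5)). lra. }
      apply (isF_scale _ i); auto.
      * destruct Hdir as [-> | ->]; [now rewrite Rmult_1_l|].
        replace (-1 * s0) with (- s0) by ring. now apply isF_opp.
      * rewrite Rabs_dir in Hi. split.
        -- assert (emin < i + 1 + om)%Z; [|lia]. apply bp_lt_inv. rewrite bp_plus.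
           eapply Rle_lt_trans; [exact C|]. apply Rmult_lt_compat_r; lra.
        -- assert (i + om < emax + 1)%Z; [|lia]. apply bp_lt_inv. rewrite bp_plus, bp_S.
           apply Rle_lt_trans with (Rabs s0 * bp om); [apply Rmult_le_compat_r; lra|lra].
Qed.

(** * Bundles of wires and blocks of weights *)

Definition val (p : R * R * R) : R := snd (fst p).
Definition wgt (p : R * R * R) : R := snd p.
Definition inp (p : R * R * R) : R := fst (fst p).
Definition KV : list R := s0 :: s1 :: map val (L1 ++ L2).
Definition KC : list R := eta :: etap :: map inp (L1 ++ L2).

Definition bundle (RL RH : R) (s : Prop * Prop) : list pred :=
  wire RL RH s :: map (fun k v => v = k) KV.

Lemma sat_const ks vs : sat (map (fun k v => v = k) ks) vs -> vs = ks.
Proof.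
  revert vs. induction ks as [|k ks IH]; intros vs H; inversion H; subst; auto. f_equal. auto.
Qed.

Lemma sat_bundle RL RH s vs : sat (bundle RL RH s) vs -> exists v, vs = v :: KV /\ wire RL RH s v.
Proof.
  unfold bundle. intros H. inversion H as [|P v Ps us Hv Hus]; subst. apply (sat_const KV us) in Hus. subst. eauto.
Qed.

Lemma dot_run cs L a z : Forall2 (src sigma) cs L -> run a cs z -> dot a (map val L) (map wgt L) z.
Proof.
  intros H. revert a. induction H as [|k p cs L Hp _ IH]; intros a Hr; auto.
  destruct p as [[c v] w]. destruct Hp as (_ & _ & _ & _ & Sp & Ep).
  simpl map in *. simpl fold_left in Hr.
  destruct (fold_finite _ _ _ Hr) as [b Hb]. rewrite Hb in Hr.
  apply dot_cons with b; auto. unfold val, wgt; simpl. now rewrite Ep.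
Qed.

(** These weights act on the constant wires [s0] and [s1], and subtract the threshold [thr pol]. *)
Definition wthr (pol : bool) : list R :=
  if pol then [- (dir * bp om); 0] else [0; dir * bp om].
Definition buf_block (pol : bool) : list R :=
  wt pol :: wthr pol ++ map wgt L1 ++ repeat 0 (length L2).
(** Sums run from left to right, so the first wire is fully amplified before the second one
    enters. *)
Definition or_block : list R :=
  (wt true :: wthr true ++ map wgt (L1 ++ L2)) ++ buf_block true.

Lemma wthr_dot pol x : isF x -> safe (x + - thr pol) -> dot x [s0; s1] (wthr pol) (rn (x + - thr pol)).
Proof.
  intros Fx Hs. destruct (sF_small pol) as [S1 _].
  assert (S2 : safe (- (sF pol * bp om))) by (unfold safe; now rewrite Rabs_Ropp).
  unfold wthr, thr. destruct pol.
  - change (sF true) with (dir * s0) in *.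
    assert (E1 : s0 * - (dir * bp om) = - (dir * s0 * bp om)) by ring.
    apply dot_cons with (rn (x + - rn (dir * s0 * bp om))).
    + now rewrite E1.
    + rewrite E1, rn_opp by auto. now apply rnd_rn.
    + apply dot_cons0; auto. now apply rn_F.
  - change (sF false) with (- (dir * s1)) in *.
    assert (E1 : s1 * (dir * bp om) = - (- (dir * s1) * bp om)) by ring.
    apply dot_cons0; auto. apply dot_cons with (rn (x + - rn (- (dir * s1) * bp om))); auto.
    + now rewrite E1.
    + rewrite E1, rn_opp by auto. now apply rnd_rn.
Qed.

Lemma wthr_run pol x cs p : isF x -> safe (x + - thr pol) -> run x (- thr pol :: cs) p ->
  run (rn (x + - thr pol)) cs p.
Proof.
  intros Fx Hs H. simpl in H. change (oplus E M (EF x) (EF (- thr pol))) with (rnd E M (x + - thr pol)) in H.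
  now rewrite rnd_rn in H.
Qed.

Lemma buf_dot pol x p : isF x -> isF p -> safe (x + - thr pol) -> run x (- thr pol :: cs1) p ->
  dot x KV (wthr pol ++ map wgt L1 ++ repeat 0 (length L2)) p.
Proof.
  intros Fx Fp Hs Hr. apply wthr_run in Hr; auto. unfold KV. rewrite map_app.
  change (s0 :: s1 :: map val L1 ++ map val L2) with ([s0; s1] ++ map val L1 ++ map val L2).
  apply dot_app with (rn (x + - thr pol)).
  - now destruct pol.
  - now apply wthr_dot.
  - apply dot_app with p; [now rewrite !length_map| |now apply dot_zero].
    now apply dot_run with cs1.
Qed.

Lemma head_dot x p : isF x -> isF p -> safe (x + - thr true) -> run x (- thr true :: cs1 ++ cs2) p ->
  dot x KV (wthr true ++ map wgt (L1 ++ L2)) p.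
Proof.
  intros Fx Fp Hs Hr. apply wthr_run in Hr; auto. unfold KV.
  change (s0 :: s1 :: map val (L1 ++ L2)) with ([s0; s1] ++ map val (L1 ++ L2)).
  apply dot_app with (rn (x + - thr true)); auto.
  - now apply wthr_dot.
  - apply dot_run with (cs1 ++ cs2); auto. now apply Forall2_app.
Qed.

Lemma safe_half x : Rabs x <= bp (emax - 1) -> safe x.
Proof. intros H. exps. apply safe_bp. assert (bp (emax - 1) <= bp emax) by (apply bp_le; lia). lra. Qed.

Definition local (Ps : list pred) (blk : list R) (P : pred) : Prop :=
  forall us, sat Ps us -> exists v vs w ws p x, us = v :: vs /\ blk = w :: ws /\ safe (v * w) /\
    length vs = length ws /\ isF p /\ dot (rn (v * w)) vs ws p /\
    oplus E M (EF p) (EF eta) = EF x /\ P x.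

Lemma len_KV : length KV = (2 + length L1 + length L2)%nat.
Proof. unfold KV. simpl. rewrite length_map, length_app. lia. Qed.

Lemma len_buf pol : length (buf_block pol) = (3 + length L1 + length L2)%nat.
Proof.
  unfold buf_block. simpl. rewrite !length_app, length_map, repeat_length.
  destruct pol; simpl; lia.
Qed.

Lemma buf_local pol RL RH RL' s : 0 <= RL <= 3 * bp (emax - 1) -> 0 <= RH <= 3 * bp (emax - 1) ->
  RL' = bp emax \/ (pol = true /\ exists r, (2 - m <= r <= emax)%Z /\ RL <= bp r /\ RL' = bp (r - 1)) ->
  local (bundle RL RH s) (buf_block pol) (pre RL' (bp emax) (flip pol s)).
Proof.
  intros HL HH HR us Hus. exps. destruct (sat_bundle _ _ _ _ Hus) as (v & -> & Hv).
  destruct (signal pol RL RH s v Hv HL HH) as (S1 & Fx & Bx & Tx & Gx & _ & Px).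
  destruct (sF_small pol) as [_ Bt]. pose proof bp5_small.
  assert (B4 : bp (emax - 2) = 64 * bp (emax - 8)) by (rel (emax - 2)%Z (emax - 8)%Z 6%nat; lra).
  assert (B5 : bp (emax - 1) = 128 * bp (emax - 8)) by (rel (emax - 1)%Z (emax - 8)%Z 7%nat; lra).
  assert (B6 : bp emax = 2 * bp (emax - 1)) by (rewrite <- bp_S; f_equal; lia).
  pose proof (bp_pos (emax - 8)).
  set (x := rn (v * wt pol)) in *.
  apply Rabs_elim in Bx, Bt.
  assert (Hxa : Rabs (x - thr pol) <= bp (emax - 1)) by (apply Rabs_intro; lra).
  destruct (tail_run eta etap (thr pol) x cs1) as (p & z & R1 & Fp & Ez & Fz & Z1 & Z2 & Z3 & Z4); auto.
  { apply thr_F. }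
  exists v, KV, (wt pol), (wthr pol ++ map wgt L1 ++ repeat 0 (length L2)), p, z.
  split; [auto|]. split; [auto|]. split; [auto|]. split.
  { pose proof (len_buf pol) as HB. unfold buf_block in HB. cbn [length] in HB. pose proof len_KV. lia. }
  split; [auto|]. split; [apply buf_dot; auto; now apply safe_half|]. split; [auto|].
  split; [auto|]. split; [|split; auto].
  split; [|lra].
  destruct HR as [-> | (-> & r & Hr & Hr' & ->)].
  - rewrite B6. apply Z3; try lia. lra.
  - replace (bp (r - 1)) with (2 * bp (r - 2)) by (rewrite <- bp_S; f_equal; lia).
    apply Z3; try lia. apply Px; auto. lia.
Qed.

(** A range of [bp (2 - m)] becomes a signal undershoot of [bp (- m)], the most that [head_run] and
    [gate_mid] tolerate. *)
Lemma or_local RL RH s s' : 0 <= RL <= bp (2 - m) -> 0 <= RH <= bp emax ->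
  local (bundle RL RH s ++ bundle RL RH s') or_block
    (pre (bp emax) (bp emax) (fst s \/ fst s', snd s /\ snd s')).
Proof.
  intros HL HH us Hus. exps. apply Forall2_app_inv_l in Hus.
  destruct Hus as (us1 & us2 & H1 & H2 & ->).
  destruct (sat_bundle _ _ _ _ H1) as (v & -> & Hv). destruct (sat_bundle _ _ _ _ H2) as (v' & -> & Hv').
  assert (B5 : bp (emax - 1) = 128 * bp (emax - 8)) by (rel (emax - 1)%Z (emax - 8)%Z 7%nat; lra).
  assert (B3 : bp (emax - 4) = 16 * bp (emax - 8)) by (rel (emax - 4)%Z (emax - 8)%Z 4%nat; lra).
  assert (B6 : bp emax = 2 * bp (emax - 1)) by (rewrite <- bp_S; f_equal; lia).
  assert (B7 : bp (2 - m) <= bp (emax - 8)) by (apply small_bound; lia).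
  pose proof (bp_pos (emax - 8)). pose proof (bp_pos k0).
  assert (HL' : 0 <= RL <= 3 * bp (emax - 1)) by lra.
  assert (HH' : 0 <= RH <= 3 * bp (emax - 1)) by lra.
  destruct (signal true RL RH s v Hv HL' HH') as (S1 & Fx & Bx & Tx & Gx & Ux & Px).
  destruct (signal true RL RH s' v' Hv' HL' HH') as (S1' & Fx' & Bx' & Tx' & Gx' & Ux' & Px').
  destruct (sF_small true) as [_ Bt]. pose proof bp5_small.
  specialize (Px eq_refl (2 - m)%Z (Z.le_refl _) (proj2 HL)).
  specialize (Px' eq_refl (2 - m)%Z (Z.le_refl _) (proj2 HL)).
  replace (2 - m - 2)%Z with (- m)%Z in * by lia.
  specialize (Ux ltac:(lra) ltac:(lra)). specialize (Ux' ltac:(lra) ltac:(lra)).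
  set (x := rn (v * wt true)) in *. set (x' := rn (v' * wt true)) in *.
  simpl flip in *. pose proof (thr_F true) as Ft.
  destruct (head_run (thr true) x (cs1 ++ cs2)) as (p & R1 & Fp & Bp & P0 & P1); auto.
  { now apply chain_app with (1 - m)%Z. }
  destruct (gate_mid (thr true) p x') as (S2 & G1 & G2 & G3 & G4); auto.
  set (y := rn (p + x')) in *.
  destruct (tail_run eta etap (thr true) y cs1) as (p' & z & R2 & Fp' & Ez & Fz & Z1 & Z2 & Z3 & Z4); auto.
  { now apply rn_F. }
  exists v, (KV ++ v' :: KV), (wt true), (wthr true ++ map wgt (L1 ++ L2) ++ buf_block true), p', z.
  split; [auto|]. split; [unfold or_block; rewrite <- app_comm_cons; now rewrite <- app_assoc|].
  split; [auto|]. pose proof len_KV as HK. pose proof (len_buf true) as HB.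
  split.
  { rewrite !length_app, HB. cbn [length wthr]. rewrite length_map, length_app. lia. }
  split; [auto|]. apply Rabs_elim in Bt, Bx.
  assert (B8 : bp (emax - 2) = 64 * bp (emax - 8)) by (rel (emax - 2)%Z (emax - 8)%Z 6%nat; lra).
  split.
  { rewrite app_assoc. apply dot_app with p.
    - rewrite length_app. cbn [length wthr]. rewrite length_map, length_app. lia.
    - apply head_dot; auto. apply safe_half, Rabs_intro. fold x. lra.
    - apply dot_cons with y; auto.
      + now apply rnd_rn.
      + apply buf_dot; auto; [now apply rn_F|]. now apply safe_half. }
  split; [auto|]. split; [auto|]. split; [|split; simpl].
  - split; [|lra]. rewrite B6. apply Z3; try lia. assert (bp (- m) <= bp (emax - 1)) by (apply bp_le; lia).
    lra.
  - intros [T|T]; apply Z2, G4; [right|left]; auto.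
  - intros [T T']. apply Z1, G3; auto.
Qed.

(** * Layers and networks *)

Notation row_ok Ps := (fun rb Q => exists P, computes Ps rb P /\ activates sigma P Q).

Lemma KC_KV : Forall2 (fun c k => isF c /\ isF k /\ sigma (EF c) = EF k) KC KV.
Proof.
  unfold KC, KV. constructor; [auto|]. constructor; [auto|].
  assert (H : Forall2 (src sigma) (cs1 ++ cs2) (L1 ++ L2)) by now apply Forall2_app.
  induction H as [|k [[c v] w] cs L Hp _ IH]; simpl; constructor; auto.
  destruct Hp as (H1 & _ & H2 & H3 & _). auto.
Qed.

Definition const_rows (tot : nat) : list (list R * R) := map (fun c => (repeat 0 tot, c)) KC.

#[local] Arguments const_rows : simpl never.
#[local] Arguments bundle : simpl never.

Lemma const_rows_reach Ps tot :
  Forall2 (row_ok Ps) (const_rows tot) (map (fun k v => v = k) KV).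
Proof.
  unfold const_rows. induction KC_KV as [|c k cs ks (Fc & Fk & Hk) _ IH]; simpl; constructor; auto.
  exists (fun x => x = c). split.
  - intros vs _. exists c. split; auto. now apply neuron_zero.
  - repeat split.
    + now intros a ->.
    + intros a b x -> -> _ Hx. lra.
    + intros a ->. now exists k.
Qed.

Lemma wgt_F : Forall isF (map wgt L1) /\ Forall isF (map wgt L2).
Proof.
  assert (H : forall cs L, Forall2 (src sigma) cs L -> Forall isF (map wgt L)).
  { induction 1 as [|k [[c v] w] cs L Hp _ IH]; simpl; constructor; auto. apply Hp. }
  split; eapply H; eauto.
Qed.

Lemma repeat_F n : Forall isF (repeat 0 n).
Proof. induction n; simpl; constructor; auto using isF_0. Qed.

Lemma wthr_F pol : Forall isF (wthr pol).
Proof.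
  pose proof (wt_F true) as H. unfold wt in H. simpl in H.
  destruct pol; repeat constructor; auto using isF_0, isF_opp.
Qed.

Lemma buf_F pol : Forall isF (buf_block pol).
Proof.
  unfold buf_block. constructor; [apply wt_F|]. rewrite !Forall_app.
  split; [apply wthr_F|]. split; [apply wgt_F|apply repeat_F].
Qed.

Lemma or_F : Forall isF or_block.
Proof.
  unfold or_block. rewrite Forall_app. split; [|apply buf_F].
  constructor; [apply wt_F|]. rewrite map_app, !Forall_app.
  split; [apply wthr_F|]. apply wgt_F.
Qed.

Definition bundle_size : nat := S (length KV).

Lemma const_rows_length tot : length (const_rows tot) = length KV.
Proof. unfold const_rows, KC, KV. rewrite length_map. cbn [length]. now rewrite !length_map. Qed.

(** The wires are read block by block, and each neuron is followed by fresh copies of the constant wires. *)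
Fixpoint asm (tot before : nat) (blks : list (list R)) : list (list R * R) :=
  match blks with
  | [] => []
  | blk :: blks' =>
      (repeat 0 before ++ blk ++ repeat 0 (length (concat blks')), eta) :: const_rows tot ++
      asm tot (before + length blk) blks'
  end.

Lemma asm_rows tot : forall blks before, Forall (Forall isF) blks ->
  (before + length (concat blks) = tot)%nat -> rows_ok tot (asm tot before blks).
Proof.
  induction blks as [|blk blks IH]; intros before HF Ht; cbn [asm]; constructor.
  - cbn [fst snd concat] in *. rewrite length_app in Ht.
    split; [rewrite !length_app, !repeat_length; lia|]. split; auto. rewrite !Forall_app.
    apply Forall_inv in HF. repeat split; auto using repeat_F.
  - apply Forall_app. split.
    + unfold const_rows. apply Forall_map.
      assert (H : Forall isF KC).
      { pose proof KC_KV as H. induction H; constructor; auto. apply H. }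
      eapply Forall_impl; [|exact H]. simpl. intros c Hc. rewrite repeat_length.
      auto using repeat_F.
    + apply Forall_inv_tail in HF. apply IH; auto. cbn [concat] in Ht. rewrite length_app in Ht. lia.
Qed.

Lemma asm_length tot blks : forall before, length (asm tot before blks) = (length blks * bundle_size)%nat.
Proof.
  induction blks as [|blk blks IH]; intros before; cbn [asm length]; auto.
  rewrite length_app, IH, const_rows_length. unfold bundle_size. lia.
Qed.

Lemma sat_length Ps us : sat Ps us -> length Ps = length us.
Proof. induction 1; simpl; auto. Qed.

(** For the induction, [P0] collects the wires of the blocks already passed, matching the argument
    [before] of [asm]. *)
Lemma asm_reach tot RL RH : 0 <= RL -> 0 <= RH ->
  forall (items : list (list pred * list R * (Prop * Prop))) P0,
  Forall (fun it => let '(Ps, blk, s) := it in length Ps = length blk /\ local Ps blk (pre RL RH s)) items ->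
  Forall2 (row_ok (P0 ++ flat_map (fun it => fst (fst it)) items))
    (asm tot (length P0) (map (fun it => snd (fst it)) items))
    (flat_map (fun it => bundle RL RH (snd it)) items).
Proof.
  intros HL HH. induction items as [|[[Ps blk] s] items IH]; intros P0 H; cbn [asm map flat_map fst snd]; constructor.
  - destruct (Forall_inv H) as [Hlen Hloc]. exists (pre RL RH s).
    split; [|now apply pre_wire].
    intros us Hus. apply Forall2_app_inv_l in Hus. destruct Hus as (u1 & u2' & H1 & H2 & ->).
    apply Forall2_app_inv_l in H2. destruct H2 as (u2 & u3 & H2 & H3 & ->).
    destruct (Hloc u2 H2) as (v & vs & w & ws & p & x & -> & -> & Sv & Hl & Fp & Hd & Ho & Hx).
    exists x. split; auto. simpl fst. simpl snd. rewrite <- Ho. apply neuron_row; auto.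
    now rewrite (sat_length _ _ H1).
  - destruct (Forall_inv H) as [Hlen Hloc]. apply Forall_inv_tail in H as Hrest. apply Forall2_app.
    + apply const_rows_reach.
    + specialize (IH (P0 ++ Ps) Hrest). rewrite length_app, Hlen in IH.
      now rewrite <- app_assoc in IH.
Qed.

Lemma hwf_snoc Ls : forall k k' L k'', hwf k Ls k' -> rows_ok k' L -> length L = k'' ->
  hwf k (Ls ++ [L]) k''.
Proof.
  induction Ls as [|L0 Ls IH]; simpl; intros k k' L k'' H HL Hk.
  - subst. auto.
  - destruct H as [H1 H2]. split; auto. now apply IH with k'.
Qed.

(** * Networks carrying a list of statuses *)

Variable d : nat.
Definition good (b : box) : Prop := forall j x, (j < d)%nat -> b j x -> isF x /\ -1 <= x <= 1.

(** The layers are chosen before the box: one network serves all boxes, and only the statuses depend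
    on the box. *)
Definition Net (fs : list sg) (RL RH : R) : Prop :=
  exists Ls, hwf d Ls (length fs * bundle_size) /\ forall b, good b ->
    reach sigma (map b (seq 0 d)) Ls (flat_map (fun f => bundle RL RH (f b)) fs).

Lemma net_snoc fs RL RH L gs RL' RH' : Net fs RL RH -> rows_ok (length fs * bundle_size) L ->
  length L = (length gs * bundle_size)%nat ->
  (forall b, good b -> Forall2 (row_ok (flat_map (fun f => bundle RL RH (f b)) fs)) L
                (flat_map (fun f => bundle RL' RH' (f b)) gs)) -> Net gs RL' RH'.
Proof.
  intros (Ls & H1 & H2) H3 H4 H5. exists (Ls ++ [L]). split.
  - now apply hwf_snoc with (length fs * bundle_size)%nat.
  - intros b Hb. eapply reach_app; [now apply H2|]. econstructor; [now apply H5|constructor].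
Qed.

(** Comparing statuses box by box avoids functional extensionality. *)
Lemma net_ext fs gs RL RH : (forall b, map (fun f => f b) fs = map (fun f => f b) gs) ->
  Net fs RL RH -> Net gs RL RH.
Proof.
  intros H (Ls & H1 & H2). exists Ls. split.
  - replace (length gs) with (length fs); auto.
    rewrite <- (length_map (fun f => f (fun _ _ => True)) fs), H. apply length_map.
  - intros b Hb. specialize (H2 b Hb).
    assert (E1 : forall hs : list sg, flat_map (fun f => bundle RL RH (f b)) hs =
              flat_map (bundle RL RH) (map (fun f => f b) hs)).
    { induction hs as [|h hs IH]; simpl; congruence. }
    rewrite E1 in *. now rewrite <- H.
Qed.

Lemma len_concat_buf pols : length (concat (map buf_block pols)) = (length pols * bundle_size)%nat.
Proof.
  induction pols as [|p pols IH]; auto. cbn [map concat length]. rewrite length_app, IH, len_buf.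
  unfold bundle_size. rewrite len_KV. lia.
Qed.

Lemma bundle_length RL RH s : length (bundle RL RH s) = bundle_size.
Proof. unfold bundle, bundle_size. cbn [length]. now rewrite length_map. Qed.

Lemma net_buffer (l : list (bool * sg)) RL RH RL' : Net (map snd l) RL RH ->
  0 <= RL <= 3 * bp (emax - 1) -> 0 <= RH <= 3 * bp (emax - 1) ->
  (RL' = bp emax \/ (Forall (fun p => fst p = true) l /\
      exists r, (2 - m <= r <= emax)%Z /\ RL <= bp r /\ RL' = bp (r - 1))) ->
  Net (map (fun p b => flip (fst p) (snd p b)) l) RL' (bp emax).
Proof.
  intros HN HL HH HR.
  apply net_snoc with (fs := map snd l) (RL := RL) (RH := RH)
    (L := asm (length l * bundle_size) 0 (map buf_block (map fst l))); auto.
  - rewrite length_map. apply asm_rows.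
    + rewrite map_map. apply Forall_map. apply Forall_forall. intros. apply buf_F.
    + rewrite len_concat_buf, length_map. lia.
  - rewrite asm_length, !length_map. lia.
  - intros b Hb.
    set (items := map (fun p => (bundle RL RH (snd p b), buf_block (fst p), flip (fst p) (snd p b))) l).
    assert (HRL : 0 <= RL').
    { destruct HR as [-> | (_ & r & _ & _ & ->)]; left; apply bp_pos. }
    pose proof (asm_reach (length l * bundle_size) RL' (bp emax) HRL ltac:(left; apply bp_pos) items []) as A.
    simpl in A.
    assert (E1 : map (fun it => snd (fst it)) items = map buf_block (map fst l)).
    { unfold items. now rewrite !map_map. }
    assert (E2 : flat_map (fun it => fst (fst it)) items = flat_map (fun f => bundle RL RH (f b)) (map snd l)).
    { unfold items. clear. induction l as [|p l IH]; simpl; congruence. }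
    assert (E3 : flat_map (fun it => bundle RL' (bp emax) (snd it)) items =
      flat_map (fun f => bundle RL' (bp emax) (f b)) (map (fun p b => flip (fst p) (snd p b)) l)).
    { unfold items. clear. induction l as [|p l IH]; simpl; congruence. }
    rewrite E1, E2, E3 in A. apply A.
    unfold items. apply Forall_map, Forall_forall. intros p Hp. split.
    + rewrite bundle_length, len_buf. unfold bundle_size. rewrite len_KV. lia.
    + apply buf_local; auto. destruct HR as [-> | (Hall & HR)]; [now left|right].
      split; auto. rewrite Forall_forall in Hall. now apply Hall.
Qed.

Definition or_sg (f g : sg) : sg := fun b => (fst (f b) \/ fst (g b), snd (f b) /\ snd (g b)).

Lemma net_or (l : list (sg * sg)) : Net (flat_map (fun p => [fst p; snd p]) l) (bp (2 - m)) (bp emax) ->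
  Net (map (fun p => or_sg (fst p) (snd p)) l) (bp emax) (bp emax).
Proof.
  intros HN.
  assert (Hl : length (flat_map (fun p : sg * sg => [fst p; snd p]) l) = (2 * length l)%nat).
  { clear. induction l as [|p l IH]; simpl in *; lia. }
  assert (Hob : length or_block = (2 * bundle_size)%nat).
  { unfold or_block. rewrite length_app, len_buf. cbn [length]. rewrite length_app, length_map, length_app.
    unfold bundle_size. rewrite len_KV. simpl. lia. }
  assert (Hc : length (concat (map (fun _ : sg * sg => or_block) l)) = (2 * length l * bundle_size)%nat).
  { clear -Hob. induction l as [|p l IH]; auto. cbn [map concat length]. rewrite length_app, IH. lia. }
  apply net_snoc with (fs := flat_map (fun p => [fst p; snd p]) l) (RL := bp (2 - m)) (RH := bp emax)
    (L := asm (2 * length l * bundle_size) 0 (map (fun _ => or_block) l)); auto.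
  - rewrite Hl. apply asm_rows; [|lia]. apply Forall_map, Forall_forall. intros. apply or_F.
  - rewrite asm_length, !length_map. lia.
  - intros b Hb.
    set (items := map (fun p : sg * sg => (bundle (bp (2 - m)) (bp emax) (fst p b) ++
        bundle (bp (2 - m)) (bp emax) (snd p b), or_block, or_sg (fst p) (snd p) b)) l).
    pose proof (asm_reach (2 * length l * bundle_size) (bp emax) (bp emax) ltac:(left; apply bp_pos)
      ltac:(left; apply bp_pos) items []) as A. simpl app in A.
    assert (E1 : map (fun it => snd (fst it)) items = map (fun _ => or_block) l).
    { unfold items. now rewrite !map_map. }
    assert (E2 : flat_map (fun it => fst (fst it)) items = flat_map (fun f => bundle (bp (2 - m)) (bp emax) (f b))
       (flat_map (fun p => [fst p; snd p]) l)).
    { unfold items. clear. induction l as [|p l IH]; auto. cbn [map flat_map app fst].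
      rewrite <- app_assoc. do 2 f_equal. exact IH. }
    assert (E3 : flat_map (fun it => bundle (bp emax) (bp emax) (snd it)) items =
      flat_map (fun f => bundle (bp emax) (bp emax) (f b)) (map (fun p => or_sg (fst p) (snd p)) l)).
    { unfold items. clear. induction l as [|p l IH]; auto. cbn [map flat_map snd]. f_equal. exact IH. }
    rewrite E1, E2, E3 in A. apply A.
    unfold items. apply Forall_map, Forall_forall. intros p Hp. split.
    + rewrite length_app, !bundle_length, Hob. lia.
    + apply or_local; split; try apply Rle_refl; left; apply bp_pos.
Qed.

Lemma net_contract fs n : Net fs (bp emax) (bp emax) -> (2 - m <= emax - Z.of_nat n)%Z ->
  Net fs (bp (emax - Z.of_nat n)) (bp emax).
Proof.
  intros HN. exps.
  assert (B : forall e, (e <= emax)%Z -> 0 <= bp e <= 3 * bp (emax - 1)).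
  { intros e He. assert (bp e <= bp emax) by now apply bp_le.
    assert (bp emax = 2 * bp (emax - 1)) by (rewrite <- bp_S; f_equal; lia).
    pose proof (bp_pos e). pose proof (bp_pos (emax - 1)). lra. }
  induction n as [|n IH]; intros Hn.
  - now replace (emax - Z.of_nat 0)%Z with emax by lia.
  - specialize (IH ltac:(lia)).
    pose proof (net_buffer (map (fun f => (true, f)) fs) (bp (emax - Z.of_nat n)) (bp emax)
      (bp (emax - Z.of_nat (S n)))) as P.
    rewrite !map_map in P. cbn [fst snd flip] in P. rewrite map_id in P.
    replace (map (fun (x : sg) b => x b) fs) with fs in P by (symmetry; apply map_id).
    apply P; auto.
    + apply B; lia.
    + apply B; lia.
    + right. split; [apply Forall_map, Forall_forall; auto|].
      exists (emax - Z.of_nat n)%Z. split; [lia|]. split; [apply Rle_refl|]. f_equal. lia.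
Qed.

(** The flag is a polarity as in [flip]: [true] keeps the status, [false] negates it. *)
Definition neg_if (p : bool) (f : sg) : sg := fun b => flip p (f b).

(** Polarities are adjusted first, because a negation resets the lower range to [bp emax]; identity
    buffers then contract it to the [bp (2 - m)] required by the disjunction. *)
Lemma net_gate (l : list (bool * sg * (bool * sg))) R : 0 <= R <= 3 * bp (emax - 1) ->
  Net (flat_map (fun p => [snd (fst p); snd (snd p)]) l) R R ->
  Net (map (fun p => or_sg (neg_if (fst (fst p)) (snd (fst p))) (neg_if (fst (snd p)) (snd (snd p)))) l)
    (bp emax) (bp emax).
Proof.
  intros HR HN. exps.
  set (l' := map (fun p : bool * sg * (bool * sg) =>
     (neg_if (fst (fst p)) (snd (fst p)), neg_if (fst (snd p)) (snd (snd p)))) l).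
  pose proof (net_or l') as P. unfold l' in P at 2. rewrite map_map in P. apply P. clear P.
  pose proof (net_buffer (flat_map (fun p => [fst p; snd p]) l) R R (bp emax)) as P.
  assert (E1 : map snd (flat_map (fun p => [fst p; snd p]) l) = flat_map (fun p => [snd (fst p); snd (snd p)]) l).
  { clear. induction l as [|p l IH]; auto. cbn [map flat_map app]. do 2 f_equal. exact IH. }
  assert (E2 : map (fun (p : bool * sg) b => flip (fst p) (snd p b)) (flat_map (fun p => [fst p; snd p]) l) =
            flat_map (fun p => [fst p; snd p]) l').
  { unfold l'. clear. induction l as [|p l IH]; auto. cbn [map flat_map app]. do 2 f_equal. exact IH. }
  rewrite E1, E2 in P. specialize (P HN HR HR (or_introl eq_refl)).
  pose proof (net_contract _ (Z.to_nat (emax - (2 - m))) P) as Q.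
  replace (emax - Z.of_nat (Z.to_nat (emax - (2 - m))))%Z with (2 - m)%Z in Q by lia.
  apply Q. lia.
Qed.

(** * Thresholds of the inputs *)

(** The scale of an input is matched to that of the jump of [sigma]: consecutive inputs become multiples of the spacing [bp (j - m)] at [B]. *)
Lemma cut_at B s j c : isF B -> s = 1 \/ s = -1 -> bp j <= s * B < bp (j + 1) ->
  (emin + 4 <= j <= 1)%Z -> isF c -> 0 <= c <= 1 ->
  exists w b, isF w /\ isF b /\ Rabs b <= 4 /\ forall x, isF x -> -1 <= x <= 1 ->
    Rabs (x * w) <= bp emax /\
    (x <= c -> s * (rn (x * w) + b) <= s * B) /\
    (c < x -> s * B + bp (j - m) <= s * (rn (x * w) + b)).
Proof.
  intros FB Hs HB Hj Fc Hc. exps.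
  assert (Hi : exists i, (emin <= i <= 0)%Z /\ c < bp (i + 1) /\ (i = emin \/ bp i <= c)).
  { destruct (Rlt_le_dec c (bp emin)) as [C|C].
    - exists emin. split; [lia|]. split; [|auto]. rewrite bp_S. pose proof (bp_pos emin). lra.
    - destruct (binade c) as [i [Hi1 Hi2]]; [pose proof (bp_pos emin); lra|].
      exists i. split; [|auto]. split.
      + assert (emin < i + 1)%Z by (apply bp_lt_inv; lra). lia.
      + assert (i < 1)%Z by (apply bp_lt_inv; rewrite bp_1; lra). lia. }
  destruct Hi as (i & Ii & Ui & Di).
  (* From [j <= 1] and [emin <= i] it follows that [W] is at most [bp emax], so no product with an
     input in [-1, 1] overflows. The bound on [j] reflects that [eta] is below 4 in magnitude. *)
  set (W := bp (j - i)). pose proof (bp_pos (j - i)) as PW. fold W in PW.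
  assert (WU : W <= bp emax) by (apply bp_le; lia).
  assert (FW : isF W) by (apply isF_bp; lia).
  assert (EW : forall e, bp (e - m) * W = bp (e + (j - i) - m)).
  { intros e. unfold W. rewrite <- bp_plus. f_equal. lia. }
  assert (HN : exists N, c = IZR N * bp (i - m)).
  { destruct Di as [-> | Di]; [now apply isF_sub|]. apply isF_canon; auto. rewrite Rabs_right; lra. }
  destruct HN as [N HN].
  assert (HcW : c * W = IZR N * bp (j - m)).
  { rewrite HN, Rmult_assoc, EW. do 2 f_equal. lia. }
  assert (UcW : c * W < bp (j + 1)).
  { replace (j + 1)%Z with (i + 1 + (j - i))%Z by lia. rewrite bp_plus.
    apply Rmult_lt_compat_r; auto. }
  assert (LcW : 0 <= c * W) by (apply Rmult_le_pos; lra).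
  assert (UJ : bp (j + 1) <= 4).
  { replace 4 with (bp 2) by (unfold bp; simpl; lra). apply bp_le; lia. }
  assert (FcW : isF (c * W)).
  { apply (isF_strict N (j - m)); auto; try lia. replace (j - m + m + 1)%Z with (j + 1)%Z by lia.
    rewrite Rabs_right; lra. }
  assert (Fsc : forall x, isF x -> isF (s * x)).
  { intros x Fx. destruct Hs as [-> | ->]; [now rewrite Rmult_1_l|].
    replace (-1 * x) with (- x) by ring. now apply isF_opp. }
  assert (Hss : s * s = 1) by (destruct Hs as [-> | ->]; ring).
  pose proof (bp_pos (j - m)) as Pj. pose proof (bp_pos j) as Pj'.
  (* Both terms of the difference are multiples of [bp (j - m)] between 0 and [bp (j + 1)], so the
     bias is an exact float. *)
  exists (s * W), (s * (s * B - c * W)).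
  assert (Fb : isF (s * B - c * W)).
  { destruct (isF_canon (s * B) j) as [K HK]; [auto|rewrite Rabs_right; lra|].
    apply (isF_strict (K - N) (j - m)); try lia.
    - rewrite minus_IZR, HcW, HK. ring.
    - replace (j - m + m + 1)%Z with (j + 1)%Z by lia. unfold Rabs; destruct Rcase_abs; lra. }
  split; [auto|]. split; [auto|]. split.
  { rewrite Rabs_mult. replace (Rabs s) with 1.
    - rewrite Rmult_1_l. apply Rabs_intro. lra.
    - destruct Hs as [-> | ->]; unfold Rabs; destruct Rcase_abs; lra. }
  intros x Fx Hx.
  assert (Bx : Rabs (x * W) <= bp emax).
  { rewrite Rabs_mult, (Rabs_right W) by lra. assert (Rabs x <= 1) by (apply Rabs_intro; lra).
    assert (Rabs x * W <= 1 * W) by (apply Rmult_le_compat_r; lra). lra. }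
  assert (Sx : safe (x * W)) by now apply safe_bp.
  assert (Ex : x * (s * W) = s * (x * W)) by ring.
  assert (Er : rn (x * (s * W)) = s * rn (x * W)).
  { rewrite Ex. destruct Hs as [-> | ->]; [now rewrite !Rmult_1_l|].
    replace (-1 * (x * W)) with (- (x * W)) by ring. rewrite rn_opp by auto. ring. }
  rewrite Er. replace (s * (s * rn (x * W) + s * (s * B - c * W)))
    with (s * s * (rn (x * W) + (s * B - c * W))) by ring. rewrite Hss, Rmult_1_l.
  split; [|split].
  - rewrite Ex, Rabs_mult. replace (Rabs s) with 1; [lra|].
    destruct Hs as [-> | ->]; unfold Rabs; destruct Rcase_abs; lra.
  - intros C. assert (rn (x * W) <= c * W); [|lra].
    apply rn_le; auto. apply Rmult_le_compat_r; lra.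
  - intros C. enough (c * W + bp (j - m) <= rn (x * W)) by lra.
    assert (Fn : isF (c * W + bp (j - m))).
    { apply (isF_intro (N + 1) (j - m)); try lia.
      - rewrite plus_IZR, HcW. ring.
      - replace (j - m + m + 1)%Z with (j + 1)%Z by lia. rewrite Rabs_right by lra.
        replace (bp (j + 1)) with (IZR (2 ^ (m + 1)) * bp (j - m)) in *
          by (rewrite <- bp_IZR, <- bp_plus by lia; f_equal; lia).
        rewrite HcW in *. apply Rmult_lt_reg_r in UcW; auto. apply IZR_lt_le1 in UcW. nra. }
    apply rn_ge; auto.
    assert (c + bp (i - m) <= x).
    { destruct Di as [-> | Di]; [now apply isF_gap_sub|now apply isF_gap]. }
    replace (bp (j - m)) with (bp (i - m) * W) by (rewrite EW; f_equal; lia).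
    rewrite <- Rmult_plus_distr_r. apply Rmult_le_compat_r; lra.
Qed.

Definition lit (pol : bool) (P : Prop) (x : R) : Prop := if pol then P -> etap <= x else P -> x <= eta.

(** The step from [eta] to [etap] is governed by the binade of the one nearer to 0. That is [etap]
    for negative [eta]; there the construction is mirrored and the comparison comes out negated,
    which [pol] records. *)
Lemma cut_pos c : bp (emin + 5) <= Rabs eta -> Rabs eta < 4 -> isF c -> 0 <= c <= 1 ->
  exists pol w b, isF w /\ isF b /\ forall x, isF x -> -1 <= x <= 1 ->
    safe (x * w) /\ exists z, oplus E M (EF (rn (x * w))) (EF b) = EF z /\
    isF z /\ eta - 3 * bp (emax - 1) <= z <= eta + 3 * bp (emax - 1) /\
    lit pol (c < x) z /\ lit (negb pol) (x <= c) z.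
Proof.
  intros He1 He2 Fc Hc. exps.
  assert (HB : exists B s j, isF B /\ (s = 1 \/ s = -1) /\ bp j <= s * B < bp (j + 1) /\
            (emin + 4 <= j <= 1)%Z /\
            ((s = 1 /\ B = eta /\ etap <= eta + bp (j - m)) \/ (s = -1 /\ B = etap /\ etap - bp (j - m) <= eta))).
  { assert (next : forall B j, isF B -> bp j <= B < bp (j + 1) -> (emin + 4 <= j <= 1)%Z -> isF (B + bp (j - m))).
    { intros B j FB HB Hj. pose proof (bp_pos j). pose proof (bp_pos (j - m)).
      destruct (isF_canon B j FB) as [K HK]; [rewrite Rabs_right; lra|].
      apply (isF_intro (K + 1) (j - m)); try lia.
      - rewrite plus_IZR, HK. ring.
      - replace (j - m + m + 1)%Z with (j + 1)%Z by lia. rewrite Rabs_right by lra.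
        replace (bp (j + 1)) with (IZR (2 ^ (m + 1)) * bp (j - m)) in *
          by (rewrite <- bp_IZR, <- bp_plus by lia; f_equal; lia).
        rewrite HK in *. destruct HB as [_ HB]. apply Rmult_lt_reg_r in HB; auto. apply IZR_lt_le1 in HB. nra. }
    destruct (Rle_lt_dec 0 eta) as [C|C].
    - rewrite (Rabs_right eta) in * by lra. pose proof (bp_pos (emin + 5)).
      destruct (binade eta) as [j Hj]; [lra|].
      assert (Ij : (emin + 4 <= j <= 1)%Z).
      { assert (emin + 5 < j + 1)%Z by (apply bp_lt_inv; lra).
        assert (j < 2)%Z; [|lia]. apply bp_lt_inv. replace (bp 2) with 4 by (unfold bp; simpl; lra). lra. }
      exists eta, 1, j. rewrite Rmult_1_l. repeat split; auto; try lra; try lia.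
      left. repeat split; auto. pose proof (bp_pos (j - m)).
      destruct (Hdich (eta + bp (j - m))) as [D|D]; auto; lra.
    - rewrite (Rabs_left eta) in * by lra.
      (* Here [etap] may lie in the binade below that of [eta]; the float [- bp (emin + 4)] above
         [eta] keeps it from being smaller still. *)
      assert (L : etap <= - bp (emin + 4)).
      { assert (bp (emin + 5) = 2 * bp (emin + 4)) by (rewrite <- bp_S; f_equal; lia).
        pose proof (bp_pos (emin + 4)).
        destruct (Hdich (- bp (emin + 4))) as [D|D]; auto; [|lra]. apply isF_opp, isF_bp. lia. }
      pose proof (bp_pos (emin + 4)).
      destruct (binade (- etap)) as [j Hj]; [lra|].
      assert (Ij : (emin + 4 <= j <= 1)%Z).
      { assert (emin + 4 < j + 1)%Z by (apply bp_lt_inv; lra).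
        assert (j < 2)%Z; [|lia]. apply bp_lt_inv. replace (bp 2) with 4 by (unfold bp; simpl; lra). lra. }
      exists etap, (-1), j. replace (-1 * etap) with (- etap) by ring.
      repeat split; auto; try lra; try lia.
      right. repeat split; auto. pose proof (bp_pos (j - m)).
      destruct (Hdich (etap - bp (j - m))) as [D|D]; auto; [|lra].
      replace (etap - bp (j - m)) with (- (- etap + bp (j - m))) by ring.
      apply isF_opp, next; auto. now apply isF_opp. }
  destruct HB as (B & s & j & FB & Hs & HB & Hj & HB').
  destruct (cut_at B s j c FB Hs HB Hj Fc Hc) as (w & b & Fw & Fb & Bb & Hx).
  exists (if Rlt_dec 0 s then true else false), w, b. split; [auto|]. split; [auto|].
  intros x Fx Ix. destruct (Hx x Fx Ix) as (Bx & X1 & X2).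
  assert (Sx : safe (x * w)) by now apply safe_bp.
  assert (B4 : bp emax = 8 * bp (emax - 3)) by (rel constr:(emax) (emax - 3)%Z 3%nat; lra).
  assert (B5 : bp (emax - 1) = 4 * bp (emax - 3)) by (rel (emax - 1)%Z (emax - 3)%Z 2%nat; lra).
  assert (B6 : 4 <= bp (emax - 3)).
  { replace 4 with (bp 2) by (unfold bp; simpl; lra). apply bp_le; lia. }
  apply Rabs_elim in Bb.
  assert (Br : - bp emax <= rn (x * w) <= bp emax).
  { apply rn_abs; auto. apply isF_bp; lia. }
  assert (Sz : safe (rn (x * w) + b)) by (apply safe_intro; lra).
  assert (Bz : - (10 * bp (emax - 3)) <= rn (rn (x * w) + b) <= 10 * bp (emax - 3)).
  { apply rn_abs; auto; [apply isF_small; lia|]. apply Rabs_intro; lra. }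
  split; [auto|]. exists (rn (rn (x * w) + b)). split; [now apply rnd_rn|].
  split; [now apply rn_F|]. assert (He3 := Heta). apply Rabs_elim in He3. split; [lra|].
  destruct HB' as [(-> & -> & HF) | (-> & -> & HF)].
  - destruct (Rlt_dec 0 1); [|lra]. split; simpl; intros C.
    + apply rn_ge; auto. specialize (X2 C). lra.
    + apply rn_le; auto. specialize (X1 C). lra.
  - destruct (Rlt_dec 0 (-1)); [lra|]. split; simpl; intros C.
    + apply rn_le; auto. specialize (X2 C). lra.
    + apply rn_ge; auto. specialize (X1 C). lra.
Qed.

(** For negative [c] let [c'] be the next float, which is at most 0. Then [c < x] means
    [- x <= - c'], the negation of a comparison of [- x] with a nonnegative constant. *)
Lemma cut_any c : bp (emin + 5) <= Rabs eta -> Rabs eta < 4 -> isF c -> -1 <= c <= 1 ->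
  exists pol w b, isF w /\ isF b /\ forall x, isF x -> -1 <= x <= 1 ->
    safe (x * w) /\ exists z, oplus E M (EF (rn (x * w))) (EF b) = EF z /\
    isF z /\ eta - 3 * bp (emax - 1) <= z <= eta + 3 * bp (emax - 1) /\
    lit pol (c < x) z /\ lit (negb pol) (x <= c) z.
Proof.
  intros He1 He2 Fc Hc. destruct (Rle_lt_dec 0 c) as [C|C]; [apply cut_pos; auto; lra|].
  destruct float_list as [l Hl].
  destruct (argmin l (fun x => isF x /\ c < x) (fun x => x)) as (c' & _ & [Fc' Hc'] & Mc').
  { exists 0. split; [apply Hl, isF_0|]. split; [apply isF_0|auto]. }
  assert (c' <= 0) by (apply Mc'; [apply Hl, isF_0|split; [apply isF_0|auto]]).
  destruct (cut_pos (- c')) as (pol & w & b & Fw & Fb & Hx); auto.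
  { now apply isF_opp. } { lra. }
  exists (negb pol), (- w), b. split; [now apply isF_opp|]. split; [auto|].
  intros x Fx Ix. destruct (Hx (- x)) as (Sx & z & Ez & Fz & Bz & P1 & P2); [now apply isF_opp|lra|].
  replace (- x * w) with (x * - w) in * by ring.
  split; [auto|]. exists z. split; [auto|]. split; [auto|]. split; [auto|].
  assert (Q : c < x -> c' <= x) by (intros; apply Mc'; auto).
  destruct pol; simpl in *; split; intros D.
  - apply P2. specialize (Q D). lra.
  - apply P1. lra.
  - apply P2. specialize (Q D). lra.
  - apply P1. lra.
Qed.

(** A gate reads only the wires of one layer, so all its operands, and all outputs, must have the
    same depth; [expr_up] pads shallower formulas. *)
Inductive lev : nat -> sg -> Prop :=
| lev_cut j c : (j < d)%nat -> isF c -> -1 <= c <= 1 ->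
    lev 0 (fun b => (forall x, b j x -> c < x, forall x, b j x -> x <= c))
| lev_true : lev 0 (fun _ => (True, False))
| lev_or k p f q g : lev k f -> lev k g -> lev (S k) (or_sg (neg_if p f) (neg_if q g)).

Lemma flip_flip p s : flip p (flip p s) = s.
Proof. destruct p, s; reflexivity. Qed.

Lemma cut_row f : bp (emin + 5) <= Rabs eta -> Rabs eta < 4 -> lev 0 f ->
  exists pol row bias, length row = d /\ Forall isF row /\ isF bias /\ forall b, good b ->
    computes (map b (seq 0 d)) (row, bias) (pre (3 * bp (emax - 1)) (3 * bp (emax - 1)) (flip pol (f b))).
Proof.
  intros He1 He2 Hf. exps.
  assert (B5 : 4 <= bp (emax - 1)).
  { replace 4 with (bp 2) by (unfold bp; simpl; lra). apply bp_le; lia. }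
  inversion Hf as [j c Hj Fc Hc Ek Ef | Ek Ef |]; subst.
  - destruct (cut_any c He1 He2 Fc Hc) as (pol & w & bias & Fw & Fb & Hx).
    exists pol, (repeat 0 j ++ [w] ++ repeat 0 (d - j - 1)), bias.
    split; [rewrite !length_app, !repeat_length; simpl; lia|].
    split; [rewrite !Forall_app; repeat split; auto using repeat_F|]. split; [auto|].
    intros b Hb vs Hvs.
    assert (Es : seq 0 d = seq 0 j ++ j :: seq (S j) (d - j - 1)).
    { replace d with (j + S (d - j - 1))%nat at 1 by lia. now rewrite seq_app. }
    rewrite Es, map_app in Hvs. simpl in Hvs.
    apply Forall2_app_inv_l in Hvs. destruct Hvs as (v1 & v2 & H1 & H2 & ->).
    inversion H2 as [|P x Ps v3 Px H3]; subst.
    destruct (Hb j x Hj Px) as [Fx Ix].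
    destruct (Hx x Fx Ix) as (Sx & z & Ez & Fz & Bz & Z1 & Z2).
    exists z. split.
    + simpl fst. simpl snd. rewrite <- Ez. apply (neuron_row v1 x [] v3 w []); auto.
      * rewrite <- (sat_length _ _ H1). now rewrite length_map, length_seq.
      * now apply rn_F.
    + split; [auto|]. split; [auto|].
      destruct pol; simpl in *; split; intros T; auto.
  - exists true, (repeat 0 d), etap. split; [apply repeat_length|]. split; [apply repeat_F|].
    split; [auto|]. intros b Hb vs Hvs. exists etap. split; [now apply neuron_zero|].
    split; [auto|]. assert (bp (1 - m) <= 4).
    { replace 4 with (bp 2) by (unfold bp; simpl; lra). apply bp_le; lia. }
    split; [lra|]. simpl. split; [lra|tauto].
Qed.

(** The polarity of an input neuron is dictated by [cut_any]. A buffer with the same polarity undoes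
    it and brings the range back to [bp emax]. *)
Lemma net_cut fs : bp (emin + 5) <= Rabs eta -> Rabs eta < 4 -> Forall (lev 0) fs ->
  Net fs (bp emax) (bp emax).
Proof.
  intros He1 He2 Hfs. exps. pose proof (bp_pos (emax - 1)).
  assert (H0 : 0 <= 3 * bp (emax - 1) <= 3 * bp (emax - 1)) by lra.
  destruct (Forall_choice (fun f (p : bool * (list R * R)) => length (fst (snd p)) = d /\
      Forall isF (fst (snd p)) /\ isF (snd (snd p)) /\ forall b, good b ->
      computes (map b (seq 0 d)) (snd p) (pre (3 * bp (emax - 1)) (3 * bp (emax - 1)) (flip (fst p) (f b)))) fs)
    as [ps Hps].
  { eapply Forall_impl; [|exact Hfs]. intros f Hf.
    destruct (cut_row f He1 He2 Hf) as (pol & row & bias & H1 & H2 & H3 & H4).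
    exists (pol, (row, bias)). auto. }
  set (L := flat_map (fun p : bool * (list R * R) => snd p :: const_rows d) ps).
  set (l := map (fun q : sg * (bool * (list R * R)) => (fst (snd q), neg_if (fst (snd q)) (fst q))) (combine fs ps)).
  assert (HN : Net (map snd l) (3 * bp (emax - 1)) (3 * bp (emax - 1))).
  { exists [L]. split.
    - cbn [hwf]. unfold L, l. clear Hfs. split.
      + induction Hps as [|f p fs ps (H1 & H2 & H3 & _) _ IH]; cbn [flat_map]; constructor; auto.
        apply Forall_app. split; auto.
        unfold const_rows. apply Forall_map.
        assert (HK : Forall isF KC).
        { pose proof KC_KV as HK. induction HK; constructor; auto. apply H4. }
        eapply Forall_impl; [|exact HK]. simpl. intros c Hc. rewrite repeat_length.
        auto using repeat_F.
      + induction Hps as [|f p fs ps _ _ IH]; auto. cbn [flat_map combine map length].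
        rewrite length_app, IH. cbn [length]. rewrite const_rows_length. unfold bundle_size. lia.
    - intros b Hb. econstructor; [|constructor]. unfold L, l. clear Hfs.
      induction Hps as [|f p fs ps (H1 & H2 & H3 & H4) _ IH]; cbn [flat_map combine map fst snd]; constructor.
      + eexists. split; [now apply H4|]. apply pre_wire; lra.
      + apply Forall2_app; auto. apply const_rows_reach. }
  pose proof (net_buffer l _ _ (bp emax) HN H0 H0 (or_introl eq_refl)) as P.
  eapply net_ext; [|exact P]. intros b. unfold l. clear -Hps.
  induction Hps as [|f p fs ps _ _ IH]; auto. cbn [combine map fst snd]. f_equal; [|exact IH].
  unfold neg_if. apply flip_flip.
Qed.

Lemma net_lev k : bp (emin + 5) <= Rabs eta -> Rabs eta < 4 -> forall fs, Forall (lev k) fs ->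
  Net fs (bp emax) (bp emax).
Proof.
  intros He1 He2. exps. induction k as [|k IH]; intros fs Hfs; [now apply net_cut|].
  assert (Hl : exists l : list (bool * sg * (bool * sg)),
    fs = map (fun p => or_sg (neg_if (fst (fst p)) (snd (fst p))) (neg_if (fst (snd p)) (snd (snd p)))) l /\
    Forall (lev k) (flat_map (fun p => [snd (fst p); snd (snd p)]) l)).
  { induction Hfs as [|f fs Hf _ (l & -> & Hl)]; [now exists []|].
    inversion Hf as [| |k' p g q h Hg Hh]; subst.
    exists ((p, g, (q, h)) :: l). split; auto. cbn [flat_map app]. repeat constructor; auto. }
  destruct Hl as (l & -> & Hl). apply net_gate with (bp emax); [|now apply IH].
  assert (bp emax = 2 * bp (emax - 1)) by (rewrite <- bp_S; f_equal; lia).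
  pose proof (bp_pos (emax - 1)). lra.
Qed.

(** No activation follows the last layer, so the outputs are the signals themselves, with the gap
    guaranteed by the choice of the weight. *)
Notation out := (decided (thr true) (thr true + bp k0)).

Fixpoint out_rows (before n : nat) : list (list R * R) :=
  match n with
  | O => []
  | S n' => (repeat 0 before ++ [wt true] ++ repeat 0 (length KV + n' * bundle_size), 0)
            :: out_rows (before + bundle_size) n'
  end.

Lemma out_rows_ok n : forall before tot, (before + n * bundle_size = tot)%nat -> rows_ok tot (out_rows before n).
Proof.
  induction n as [|n IH]; intros before tot Ht; cbn [out_rows]; constructor.
  - cbn [fst snd]. split; [rewrite !length_app, !repeat_length; unfold bundle_size in *; simpl in *; lia|].
    split; [|apply isF_0]. rewrite !Forall_app. repeat split; auto using repeat_F, wt_F.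
  - apply IH. lia.
Qed.

Lemma out_rows_length n : forall before, length (out_rows before n) = n.
Proof. induction n; intros; simpl; auto. Qed.

Lemma out_computes RL RH ss : 0 <= RL <= 3 * bp (emax - 1) -> 0 <= RH <= 3 * bp (emax - 1) ->
  forall P0, Forall2 (fun rb Q => computes (P0 ++ flat_map (bundle RL RH) ss) rb Q)
    (out_rows (length P0) (length ss)) (map out ss).
Proof.
  intros HL HH. induction ss as [|s ss IH]; intros P0; cbn [length out_rows map]; constructor.
  - intros us Hus. cbn [flat_map] in Hus. apply Forall2_app_inv_l in Hus.
    destruct Hus as (u1 & u2' & H1 & H2 & ->). apply Forall2_app_inv_l in H2.
    destruct H2 as (u2 & u3 & H2 & H3 & ->).
    destruct (sat_bundle _ _ _ _ H2) as (v & -> & Hv).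
    destruct (signal true RL RH s v Hv HL HH) as (S1 & Fx & _ & Tx & Gx & _).
    exists (rn (v * wt true)). split; [|split; auto].
    rewrite <- (oplus_0_r (rn (v * wt true))) by auto. cbn [fst snd].
    apply (neuron_row u1 v [] (KV ++ u3) (wt true) []); auto.
    now rewrite (sat_length _ _ H1).
  - specialize (IH (P0 ++ bundle RL RH s)). rewrite length_app, bundle_length in IH.
    now rewrite <- app_assoc in IH.
Qed.

Lemma net_eval k fs : bp (emin + 5) <= Rabs eta -> Rabs eta < 4 -> Forall (lev k) fs ->
  exists ls, wf_net E M d ls (length fs) /\ forall b, good b ->
    (forall x, Forall2 holdsC (map b (seq 0 d)) x ->
      Forall2 holdsC (map (fun f => out (f b)) fs) (eval_net E M sigma ls x)) /\
    (forall X, Forall2 holdsI (map b (seq 0 d)) X ->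
      Forall2 holdsI (map (fun f => out (f b)) fs) (eval_sharp E M sigma ls X)).
Proof.
  intros He1 He2 Hfs. exps. destruct (net_lev k He1 He2 fs Hfs) as (Ls & H1 & H2).
  set (O := out_rows 0 (length fs)).
  assert (B : 0 <= bp emax <= 3 * bp (emax - 1)).
  { assert (bp emax = 2 * bp (emax - 1)) by (rewrite <- bp_S; f_equal; lia).
    pose proof (bp_pos (emax - 1)). lra. }
  exists (map mk_layer Ls ++ [mk_layer O]). split.
  { replace (length fs) with (length O) by apply out_rows_length.
    apply hid_wf with (length fs * bundle_size)%nat; auto. now apply out_rows_ok. }
  intros b Hb. specialize (H2 b Hb).
  pose proof (out_computes (bp emax) (bp emax) (map (fun f => f b) fs) B B []) as HO.
  rewrite length_map, map_map in HO. cbn [app length] in HO.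
  assert (E1 : flat_map (bundle (bp emax) (bp emax)) (map (fun f => f b) fs) =
            flat_map (fun f => bundle (bp emax) (bp emax) (f b)) fs).
  { clear. induction fs as [|f fs IH]; simpl; congruence. }
  rewrite E1 in HO. split.
  - intros x Hx. rewrite eval_net_hid.
    apply (layer_holds _ _ _ _ holdsC holdsC_inh holdsC_mono holdsC_cst (holdsC_op _) (holdsC_op _)
      (flat_map (fun f => bundle (bp emax) (bp emax) (f b)) fs)); auto.
    apply (reach_holds _ _ _ _ _ sigma holdsC holdsC_inh holdsC_mono holdsC_cst (holdsC_op _) (holdsC_op _)
      (holdsC_act sigma) _ _ _ H2); auto.
  - intros x Hx. rewrite eval_sharp_hid.
    apply (layer_holds _ _ _ _ holdsI holdsI_inh holdsI_mono holdsI_cst (holdsI_op _) (holdsI_op _)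
      (flat_map (fun f => bundle (bp emax) (bp emax) (f b)) fs)); auto.
    apply (reach_holds _ _ _ _ _ sigma holdsI holdsI_inh holdsI_mono holdsI_cst (holdsI_op _) (holdsI_op _)
      (holdsI_act sigma) _ _ _ H2); auto.
Qed.

End Gates.

(** * Networks for formulas *)

Lemma next_up_spec eta : isF eta -> Rabs eta < 4 -> next_spec E M (EF eta) (next_up E M (EF eta)).
Proof.
  intros Fe He. exps. unfold next_up. apply epsilon_spec. destruct float_list as [l Hl].
  assert (E4 : bp 2 = 4) by (unfold bp; simpl; lra).
  assert (F4 : isF (bp 2)) by (apply isF_bp; lia).
  destruct (argmin l (fun x => isF x /\ eta < x) (fun x => x)) as (x & _ & [Fx Hx] & Mx).
  { exists (bp 2). split; [auto|]. split; auto. revert He. unfold Rabs; destruct Rcase_abs; lra. }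
  exists (EF x). split; [auto|]. split; [discriminate|]. split.
  - split; [simpl; lra|]. intros C. injection C. lra.
  - intros z Hz Hn [H1 H2]. destruct z as [r| | |]; simpl in *; auto.
    apply Mx; auto. split; auto. destruct H1 as [H1|H1]; auto. subst. now contradiction H2.
Qed.

Lemma network_exists (sigma : ext -> ext) (d : nat) :
  (forall x, inFbar E M x -> inFbar E M (sigma x)) -> condition1 E M sigma ->
  exists lo hi, lo < hi /\ forall k fs, Forall (lev d k) fs ->
    exists ls, wf_net E M d ls (length fs) /\ forall b, good d b ->
    (forall x, Forall2 holdsC (map b (seq 0 d)) x ->
      Forall2 holdsC (map (fun f => decided lo hi (f b)) fs) (eval_net E M sigma ls x)) /\
    (forall X, Forall2 holdsI (map b (seq 0 d)) X ->
      Forall2 holdsI (map (fun f => decided lo hi (f b)) fs) (eval_sharp E M sigma ls X)).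
Proof.
  intros Hsig [(c1 & c2 & r2 & _ & Fc2 & _ & Hr2 & Br2 & _) (eta & HC2 & HC3)]. exps.
  destruct HC3 as (lam & s0 & s1 & etap & Hs0 & Hnx & Hs1 & [Hl0 Hl1] & Hlip).
  destruct HC2 as (Feta & Beta & (s0' & Hs0' & Bs0) & (s1' & Hs1' & Bs1) & Hmon).
  rewrite Hs0 in Hs0'. injection Hs0' as <-. rewrite Hnx, Hs1 in Hs1'. injection Hs1' as <-.
  change (powerRZ 2 (emin + 5)) with (bp (emin + 5)) in *.
  change (powerRZ 2 (emax - 6)) with (bp (emax - 6)) in *.
  change (powerRZ 2 (emax - 7)) with (bp (emax - 7)) in *.
  change (powerRZ 2 (m + 3)) with (bp (m + 3)) in *.
  assert (Heps : 0 < eps M) by apply (bp_pos (- m - 1)).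
  assert (Heps2 : eps M = 2 * bp (- m - 2)).
  { unfold eps. change (powerRZ 2 (- m - 1)) with (bp (- m - 1)). rewrite <- bp_S. f_equal. lia. }
  assert (He4 : Rabs eta < 4) by lra.
  assert (B64 : bp (emax - 4) = bp (emax - 6) * 4).
  { rel (emax - 4)%Z (emax - 6)%Z 2%nat. ring. }
  pose proof (bp_pos (emax - 6)).
  assert (Bs0' : bp (emin + 5) <= Rabs s0 < bp (emax - 4)) by nra.
  assert (Bs1' : bp (emin + 5) <= Rabs s1 < bp (emax - 4)) by nra.
  destruct (next_up_spec eta Feta He4) as (Fetap & _ & [Hlt Hne] & Hnext). rewrite Hnx in *.
  simpl in Fetap, Hlt.
  assert (Hee : eta < etap) by (destruct Hlt as [| ->]; auto; now contradiction Hne).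
  assert (Hdich : forall x, isF x -> x <= eta \/ etap <= x).
  { intros x Fx. destruct (Rle_lt_dec x eta) as [C|C]; auto. right.
    apply (Hnext (EF x)); auto; [discriminate|]. split; [simpl; lra|]. intros D. injection D. lra. }
  assert (Hetap : etap <= eta + bp (1 - m)).
  { pose proof (bp_pos (emin + 5)). destruct (binade (Rabs eta)) as [i [Hi1 Hi2]]; [lra|].
    assert (Ii : (emin + 4 <= i <= 1)%Z).
    { assert (emin + 5 < i + 1)%Z by (apply bp_lt_inv; lra).
      assert (i < 2)%Z; [|lia]. apply bp_lt_inv. replace (bp 2) with 4 by (unfold bp; simpl; lra). lra. }
    destruct (isF_canon eta i Feta Hi1) as [N HN]. pose proof (bp_pos (i - m)).
    assert (Fn : isF (eta + bp (i - m))).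
    { apply (isF_intro (N + 1) (i - m)); try lia.
      - rewrite plus_IZR, HN. ring.
      - replace (i - m + m + 1)%Z with (i + 1)%Z by lia.
        apply Rabs_intro.
        replace (bp (i + 1)) with (IZR (2 ^ (m + 1)) * bp (i - m)) in *
          by (rewrite <- bp_IZR, <- bp_plus by lia; f_equal; lia).
        rewrite HN in *. rewrite Rabs_mult, (Rabs_right (bp (i - m))), <- abs_IZR in Hi2 by lra.
        apply Rmult_lt_reg_r in Hi2; auto. apply IZR_lt_le1 in Hi2.
        rewrite abs_IZR in Hi2. revert Hi2. unfold Rabs. destruct Rcase_abs; intros; nra. }
    destruct (Hdich _ Fn) as [D|D]; [lra|].
    assert (bp (i - m) <= bp (1 - m)) by (apply bp_le; lia). lra. }
  assert (Fs0 : isF s0) by (specialize (Hsig (EF eta) Feta); now rewrite Hs0 in Hsig).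
  assert (Fs1 : isF s1) by (specialize (Hsig (EF etap) Fetap); now rewrite Hs1 in Hsig).
  assert (Fr2 : isF r2) by (specialize (Hsig (EF c2) Fc2); now rewrite Hr2 in Hsig).
  assert (Br2' : bp (- m - 2) <= Rabs r2 < 5 / 4).
  { assert (0 <= eps M ^ 2) by (apply pow_le; lra). lra. }
  assert (L1 : lam <= bp (emax - 7) * Rabs s0).
  { eapply Rle_trans; [exact Hl1|]. apply Rmult_le_compat_l; [left; apply bp_pos|apply Rmin_l]. }
  assert (L2 : lam <= bp (emax - 7) * bp (m + 3)).
  { eapply Rle_trans; [exact Hl1|]. apply Rmult_le_compat_l; [left; apply bp_pos|apply Rmin_r]. }
  (* (C2) offers the two directions for each pair separately, but the strict inequality between [s0]
     and [s1] selects the same one for all pairs. *)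
  assert (Hdir : exists dir, (dir = 1 \/ dir = -1) /\ dir * s0 < dir * s1 /\
    (forall x, isF x -> x <= eta -> exists v, sigma (EF x) = EF v /\ isF v /\
        dir * s0 - lam * (eta - x) <= dir * v <= dir * s0) /\
    (forall x, isF x -> etap <= x -> exists v, sigma (EF x) = EF v /\ isF v /\
        dir * s1 <= dir * v <= dir * s1 + lam * (x - etap))).
  { rewrite Hs0, Hs1 in Hmon.
    assert (Hv : forall x v, isF x -> sigma (EF x) = EF v -> isF v).
    { intros x v Fx Hx. specialize (Hsig (EF x) Fx). now rewrite Hx in Hsig. }
    assert (neq : forall a b, lt_ext (EF a) (EF b) -> a < b).
    { intros a b [H1 H2]. simpl in H1. destruct H1 as [| ->]; auto. now contradiction H2. }
    destruct (Hmon eta etap Feta Fetap ltac:(lra) ltac:(simpl; lra)) as [(_ & HL & _)|(_ & HL & _)];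
      apply neq in HL.
    - exists 1. split; [auto|]. split; [lra|]. split; intros x Fx Hx.
      + destruct (Hlip x etap Fx Fetap Hx ltac:(lra)) as [(v & E1 & E2) _]. exists v.
        split; [auto|]. split; [now apply Hv with x|].
        rewrite (Rabs_minus_sym x), (Rabs_right (eta - x)) in E2 by lra. apply Rabs_elim in E2.
        destruct (Hmon x etap Fx Fetap Hx ltac:(simpl; lra)) as [(H1 & _)|(_ & H1 & _)].
        * rewrite E1 in H1. simpl in H1. lra.
        * apply neq in H1. lra.
      + destruct (Hlip eta x Feta Fx ltac:(lra) Hx) as [_ (v & E1 & E2)]. exists v.
        split; [auto|]. split; [now apply Hv with x|].
        rewrite (Rabs_right (x - etap)) in E2 by lra. apply Rabs_elim in E2.
        destruct (Hmon eta x Feta Fx ltac:(lra) Hx) as [(_ & _ & H1)|(_ & H1 & _)].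
        * rewrite E1 in H1. simpl in H1. lra.
        * apply neq in H1. lra.
    - exists (-1). split; [auto|]. split; [lra|]. split; intros x Fx Hx.
      + destruct (Hlip x etap Fx Fetap Hx ltac:(lra)) as [(v & E1 & E2) _]. exists v.
        split; [auto|]. split; [now apply Hv with x|].
        rewrite (Rabs_minus_sym x), (Rabs_right (eta - x)) in E2 by lra. apply Rabs_elim in E2.
        destruct (Hmon x etap Fx Fetap Hx ltac:(simpl; lra)) as [(_ & H1 & _)|(H1 & _)].
        * apply neq in H1. lra.
        * rewrite E1 in H1. simpl in H1. lra.
      + destruct (Hlip eta x Feta Fx ltac:(lra) Hx) as [_ (v & E1 & E2)]. exists v.
        split; [auto|]. split; [now apply Hv with x|].
        rewrite (Rabs_right (x - etap)) in E2 by lra. apply Rabs_elim in E2.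
        destruct (Hmon eta x Feta Fx ltac:(lra) Hx) as [(_ & H1 & _)|(_ & _ & H1)].
        * apply neq in H1. lra.
        * rewrite E1 in H1. simpl in H1. lra. }
  destruct Hdir as (dir & Hdir & HL & Hlo & Hhi).
  destruct (exists_weight s0 s1 lam) as (om & O1 & O2 & O3 & O4 & O5 & O6 & O7); auto.
  { intros ->. lra. }
  assert (Hgap : rn (dir * s0 * bp om) + bp k0 <= rn (dir * s1 * bp om)).
  { assert (sf : forall s, Rabs s * bp om <= bp (5 - m) -> safe (s * bp om)).
    { intros s Hs. apply safe_bp. rewrite Rabs_mult, (Rabs_right (bp om)) by (pose proof (bp_pos om); lra).
      assert (bp (5 - m) <= bp emax) by (apply bp_le; lia). lra. }
    destruct Hdir as [-> | ->].
    - rewrite !Rmult_1_l. apply O6. lra.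
    - replace (-1 * s0 * bp om) with (- (s0 * bp om)) by ring.
      replace (-1 * s1 * bp om) with (- (s1 * bp om)) by ring.
      rewrite !rn_opp by auto. specialize (O7 ltac:(lra)). lra. }
  (* There are [- emin] doublings from [bp k0] to [bp (1 - m)], and four more to [bp (5 - m)]. *)
  destruct (chain_exists sigma eta s0 c2 r2 (Z.to_nat (- emin)) Feta Fs0 Hs0 Fc2 Fr2 Hr2 Bs0' Br2' k0)
    as (cs1 & ps1 & X1 & Y1); try lia.
  destruct (chain_exists sigma eta s0 c2 r2 4 Feta Fs0 Hs0 Fc2 Fr2 Hr2 Bs0' Br2' (1 - m))
    as (cs2 & ps2 & X2 & Y2); try lia.
  replace (k0 + Z.of_nat (Z.to_nat (- emin)))%Z with (1 - m)%Z in X1 by lia.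
  replace (1 - m + Z.of_nat 4)%Z with (5 - m)%Z in X2 by lia.
  exists (thr s0 s1 dir om true), (thr s0 s1 dir om true + bp k0).
  split; [pose proof (bp_pos k0); lra|].
  intros k fs Hfs. eapply (net_eval sigma eta etap s0 s1 dir lam om cs1 cs2 ps1 ps2); eauto; lra.
Qed.

(** * Separating formulas *)

(** [P] only prescribes statuses; on all other boxes the formula is free. The outer polarity [p]
    makes negation possible without raising the level. *)
Definition expr (d k : nat) (P : box -> Prop * Prop) : Prop :=
  exists p f, lev d k f /\ forall b,
    (fst (P b) -> fst (flip p (f b))) /\ (snd (P b) -> snd (flip p (f b))).

Lemma expr_weaken d k (P Q : box -> Prop * Prop) :
  (forall b, (fst (Q b) -> fst (P b)) /\ (snd (Q b) -> snd (P b))) -> expr d k P -> expr d k Q.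
Proof.
  intros H (p & f & H1 & H2). exists p, f. split; auto. intros b.
  specialize (H b). specialize (H2 b). tauto.
Qed.

Lemma expr_or d k P Q : expr d k P -> expr d k Q -> expr d (S k) (or_sg P Q).
Proof.
  intros (p & f & H1 & H2) (q & g & H3 & H4). exists true, (or_sg (neg_if p f) (neg_if q g)).
  split; [now constructor|]. intros b. specialize (H2 b). specialize (H4 b).
  unfold or_sg, neg_if. simpl. tauto.
Qed.

Lemma expr_up d k n P : expr d k P -> expr d (k + n) P.
Proof.
  intros H. induction n as [|n IH]; [now rewrite Nat.add_0_r|].
  rewrite Nat.add_succ_r. eapply expr_weaken; [|exact (expr_or _ _ _ _ IH IH)].
  intros b. unfold or_sg. simpl. tauto.
Qed.

Lemma expr_not d k P : expr d k P -> expr d k (fun b => (snd (P b), fst (P b))).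
Proof.
  intros (p & f & H1 & H2). exists (negb p), f. split; auto. intros b. specialize (H2 b).
  destruct p; simpl in *; tauto.
Qed.

Lemma expr_or_any d j k P Q : expr d j P -> expr d k Q -> exists i, expr d i (or_sg P Q).
Proof.
  intros HP HQ. exists (S (j + k)). apply expr_or; [now apply expr_up|].
  rewrite Nat.add_comm. now apply expr_up.
Qed.

Lemma expr_and_any d j k P Q : expr d j P -> expr d k Q ->
  exists i, expr d i (fun b => (fst (P b) /\ fst (Q b), snd (P b) \/ snd (Q b))).
Proof.
  intros HP HQ. destruct (expr_or_any d j k _ _ (expr_not _ _ _ HP) (expr_not _ _ _ HQ)) as [i Hi].
  exists i. eapply expr_weaken; [|exact (expr_not _ _ _ Hi)]. intros b. unfold or_sg. simpl. tauto.
Qed.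

(** * Boxes around the points of a robust classifier *)

Section Classifier.
Variables d n : nat.
Variable delta : R.
Hypothesis Hdelta : 0 < delta.
Variable D : list ext -> Prop.
Hypothesis HD : forall x, D x -> inX E M d x.
Variable cls : list ext -> nat.
Variable f : list ext -> list ext.
Hypothesis Hrob : robust E M d cls f delta D.

Definition nb (x : list ext) : box := fun j r =>
  isF r /\ -1 <= r <= 1 /\ exists c, nth_error x j = Some (EF c) /\ Rabs (c - r) <= delta.

Lemma nb_good x : good d (nb x).
Proof. intros j r _ (H1 & H2 & _). auto. Qed.

Lemma inX_nth x j : inX E M d x -> (j < d)%nat -> exists r, nth_error x j = Some (EF r) /\ isF r /\ -1 <= r <= 1.
Proof.
  intros [H1 H2] Hj. destruct (nth_error x j) as [v|] eqn:Ev.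
  - rewrite Forall_forall in H2. destruct (H2 v) as (r & -> & Hr); [now apply nth_error_In with j|].
    now exists r.
  - apply nth_error_None in Ev. lia.
Qed.

Lemma inN_iff x0 x : D x0 -> inN E M d delta x0 x <->
  Forall2 (fun j v => exists r, v = EF r /\ nb x0 j r) (seq 0 d) x.
Proof.
  intros H0. pose proof (HD x0 H0) as X0. split.
  - intros [HX HN]. apply Forall2_seq; [apply HX|]. intros j Hj. simpl.
    destruct (inX_nth x j HX Hj) as (r & Er & Fr & Br). exists (EF r). split; auto.
    exists r. split; auto. split; auto. split; auto.
    clear -HN Er. revert j Er. induction HN as [|a b x0 x (c & s & -> & -> & Hcs) _ IH]; intros j Er.
    + now destruct j.
    + destruct j as [|j]; simpl in *; auto. injection Er as <-. now exists c.
  - intros H. destruct (Forall2_seq_inv _ _ _ _ H) as [Hl Hn]. split.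
    + split; auto. apply Forall_forall. intros v Hv. apply In_nth_error in Hv. destruct Hv as [j Hj].
      assert (Hjd : (j < d)%nat) by (rewrite <- Hl; apply nth_error_Some; congruence).
      destruct (Hn j) as (a & H1 & r & -> & Fr & Br & _); auto. rewrite Hj in H1. injection H1 as ->.
      now exists r.
    + destruct X0 as [L0 _]. simpl in Hn. clear H. revert x0 H0 L0 x Hl Hn.
      assert (G : forall k x0 x, length x0 = k -> length x = k ->
        (forall j, (j < k)%nat -> exists a, nth_error x j = Some a /\ exists r, a = EF r /\ nb x0 j r) ->
        Forall2 (fun a b => exists r s, a = EF r /\ b = EF s /\ Rabs (r - s) <= delta) x0 x).
      { induction k as [|k IH]; intros [|a x0] [|v x] L0 L1 Hn; try discriminate; constructor.
        - destruct (Hn 0%nat) as (a' & E1 & r & -> & _ & _ & c & E2 & Hc); [lia|].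
          simpl in E1, E2. injection E1 as ->. injection E2 as ->. now exists c, r.
        - apply IH; try (now injection L0); try (now injection L1).
          intros j Hj. destruct (Hn (S j)) as (a' & E1 & r & -> & H); [lia|].
          exists (EF r). split; auto. now exists r. }
      intros x0 _ L0 x Hl Hn. now apply G with d.
Qed.

Lemma nb_self x : D x -> Forall2 (fun j v => exists r, v = EF r /\ nb x j r) (seq 0 d) x.
Proof.
  intros Hx. pose proof (HD x Hx) as HX. apply Forall2_seq; [apply HX|]. intros j Hj. simpl.
  destruct (inX_nth x j HX Hj) as (r & Er & Fr & Br). exists (EF r). split; auto. exists r.
  split; auto. split; auto. split; auto. exists r. split; auto. rewrite Rminus_diag, Rabs_R0. lra.
Qed.

Lemma inN_self x : D x -> inN E M d delta x x.
Proof. intros H. apply inN_iff; auto. now apply nb_self. Qed.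

(** Otherwise a common point of both boxes could be chosen coordinate by coordinate, and robustness
    at the two centres would give it both classes. *)
Lemma nb_disjoint x1 x0 : D x1 -> D x0 -> cls (f x1) <> cls (f x0) ->
  exists j, (j < d)%nat /\ forall r, nb x1 j r -> nb x0 j r -> False.
Proof.
  intros H1 H0 Hne. apply NNPP. intros C. apply Hne.
  assert (Hc : Forall (fun j => exists v, exists r, v = EF r /\ nb x1 j r /\ nb x0 j r) (seq 0 d)).
  { apply Forall_forall. intros j Hj. apply in_seq in Hj. apply NNPP. intros D'. apply C.
    exists j. split; [lia|]. intros r R1 R0. apply D'. now exists (EF r), r. }
  apply Forall_choice in Hc. destruct Hc as [x Hx].
  assert (N1 : inN E M d delta x1 x).
  { apply inN_iff; auto. eapply Forall2_impl; [|exact Hx]. simpl. intros j v (r & -> & R1 & _). now exists r. }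
  assert (N0 : inN E M d delta x0 x).
  { apply inN_iff; auto. eapply Forall2_impl; [|exact Hx]. simpl. intros j v (r & -> & _ & R1). now exists r. }
  rewrite (Hrob x1 H1 x1 x (inN_self x1 H1) N1). apply (Hrob x0 H0 x x0 N0 (inN_self x0 H0)).
Qed.

(** The threshold is the largest float of the lower box. If a point of the upper box did not exceed
    it, convexity would put that point or [c0] into both boxes. *)
Lemma nb_below x1 x0 j c1 c0 : nth_error x1 j = Some (EF c1) -> nth_error x0 j = Some (EF c0) ->
  nb x1 j c1 -> nb x0 j c0 -> (forall r, nb x1 j r -> nb x0 j r -> False) -> c0 < c1 ->
  exists u, isF u /\ -1 <= u <= 1 /\ (forall r, nb x0 j r -> r <= u) /\ (forall r, nb x1 j r -> u < r).
Proof.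
  intros E1 E0 N1 N0 Hdis Hlt. destruct float_list as [l Hl].
  destruct (argmin l (nb x0 j) (fun r => - r)) as (u & _ & Nu & Mu).
  { exists c0. split; auto. apply Hl, N0. }
  assert (Hu : forall r, nb x0 j r -> r <= u).
  { intros r Hr. enough (- u <= - r) by lra. apply Mu; auto. apply Hl, Hr. }
  exists u. split; [apply Nu|]. split; [apply Nu|]. split; auto.
  intros r Nr. destruct (Rle_lt_dec r u) as [C|]; auto. exfalso.
  destruct Nu as (_ & _ & c & Ec & Hc). rewrite E0 in Ec. injection Ec as <-.
  destruct Nr as (Fr & Br & c' & Ec' & Hc'). rewrite E1 in Ec'. injection Ec' as <-.
  apply Rabs_elim in Hc, Hc'.
  destruct (Rle_lt_dec c0 r) as [C'|C'].
  - apply (Hdis r); split; auto; split; auto; [exists c1|exists c0]; split; auto; apply Rabs_intro; lra.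
  - apply (Hdis c0); auto. split; [apply N0|]. split; [apply N0|]. exists c1. split; auto.
    apply Rabs_intro. lra.
Qed.

Lemma expr_separate x1 x0 : D x1 -> D x0 -> cls (f x1) <> cls (f x0) ->
  expr d 0 (fun b => (b = nb x1, b = nb x0)).
Proof.
  intros H1 H0 Hne. destruct (nb_disjoint x1 x0 H1 H0 Hne) as (j & Hj & Hdis).
  assert (Hc : forall x, D x -> exists c, nth_error x j = Some (EF c) /\ nb x j c).
  { intros x Hx. destruct (inX_nth x j (HD x Hx) Hj) as (c & Ec & Fc & Bc). exists c.
    split; auto. split; auto. split; auto. exists c. split; auto. rewrite Rminus_diag, Rabs_R0. lra. }
  destruct (Hc x1 H1) as (c1 & E1 & N1). destruct (Hc x0 H0) as (c0 & E0 & N0).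
  destruct (Rtotal_order c0 c1) as [C|[C|C]].
  - destruct (nb_below x1 x0 j c1 c0) as (u & Fu & Bu & U0 & U1); auto.
    eexists true, _. split; [now apply (lev_cut d j u)|]. intros b. simpl. split; intros ->; auto.
  - subst. exfalso. eauto.
  - destruct (nb_below x0 x1 j c0 c1) as (u & Fu & Bu & U0 & U1); eauto.
    eexists false, _. split; [now apply (lev_cut d j u)|]. intros b. simpl. split; intros ->; auto.
Qed.

(** The equations between boxes only record on which boxes the formula must be true or false. *)
Lemma expr_point x1 L : D x1 ->
  exists k, expr d k (fun b => (b = nb x1, exists x0, In x0 L /\ D x0 /\ cls (f x1) <> cls (f x0) /\ b = nb x0)).
Proof.
  intros H1. induction L as [|x0 L [k IH]].
  - exists 0%nat, true, (fun _ => (True, False)). split; [constructor|]. intros b. simpl.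
    split; auto. intros (x0 & [] & _).
  - destruct (classic (D x0 /\ cls (f x1) <> cls (f x0))) as [[H0 Hne]|C].
    + destruct (expr_and_any d 0 k _ _ (expr_separate x1 x0 H1 H0 Hne) IH) as [i Hi]. exists i.
      eapply expr_weaken; [|exact Hi]. intros b. simpl. split; auto.
      intros (x & [<-|Hx] & Hr); [left; tauto|right; eauto].
    + exists k. eapply expr_weaken; [|exact IH]. intros b. simpl. split; auto.
      intros (x & [<-|Hx] & Hr); [tauto|eauto].
Qed.

Lemma expr_class i L L0 :
  exists k, expr d k (fun b => (exists x1, In x1 L /\ D x1 /\ cls (f x1) = i /\ b = nb x1,
                            exists x0, In x0 L0 /\ D x0 /\ cls (f x0) <> i /\ b = nb x0)).
Proof.
  induction L as [|x1 L [k IH]].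
  - exists 0%nat, false, (fun _ => (True, False)). split; [constructor|]. intros b. simpl.
    split; auto. intros (x0 & [] & _).
  - destruct (classic (D x1 /\ cls (f x1) = i)) as [[H1 Hi]|C].
    + destruct (expr_point x1 L0 H1) as [k' H']. destruct (expr_or_any d k' k _ _ H' IH) as [k'' H''].
      exists k''. eapply expr_weaken; [|exact H'']. intros b. unfold or_sg. simpl. split.
      * intros (x & [<-|Hx] & Hr); [left; tauto|right; eauto].
      * intros (x0 & Hx & H0 & Hne & Hb). split; [|eauto]. exists x0. repeat split; auto. congruence.
    + exists k. eapply expr_weaken; [|exact IH]. intros b. simpl. split; auto.
      intros (x & [<-|Hx] & Hr); [tauto|eauto].
Qed.

(** Finiteness of the input space makes the disjunctions and conjunctions over points of [D] finite;
    membership in [D] is decided classically along the list. *)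
Lemma input_list : exists L, forall x, inX E M d x -> In x L.
Proof.
  destruct float_list as [l Hl]. unfold inX. clear -Hl. induction d as [|d' [L HL]].
  - exists [[]]. intros [|v x] [H _]; [now left|discriminate].
  - exists (map (fun p => EF (fst p) :: snd p) (list_prod l L)). intros [|v x] [H1 H2]; [discriminate|].
    inversion H2 as [|? ? (r & -> & Fr & _) H3]; subst. apply in_map_iff. exists (r, x).
    split; auto. apply in_prod; [now apply Hl|]. apply HL. split; auto.
Qed.

Lemma classifier_formulas : exists k fs, length fs = n /\ Forall (lev d k) fs /\
  forall x, D x -> Forall2 (fun i g => (cls (f x) = i -> fst (g (nb x))) /\ (cls (f x) <> i -> snd (g (nb x))))
    (seq 0 n) fs.
Proof.
  destruct input_list as [L HL].
  set (P := fun (i : nat) (b : box) => (exists x1, In x1 L /\ D x1 /\ cls (f x1) = i /\ b = nb x1,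
                            exists x0, In x0 L /\ D x0 /\ cls (f x0) <> i /\ b = nb x0)).
  assert (Hk : forall ns, exists k, Forall (fun i => expr d k (P i)) ns).
  { induction ns as [|i ns [k IH]]; [exists 0%nat; constructor|].
    destruct (expr_class i L L) as [k' Hk']. exists (k + k')%nat. constructor.
    - rewrite Nat.add_comm. now apply expr_up.
    - eapply Forall_impl; [|exact IH]. intros a Ha. now apply expr_up. }
  destruct (Hk (seq 0 n)) as [k Hk'].
  assert (Hc : Forall (fun i => exists g, lev d (S k) g /\ forall b,
            (fst (P i b) -> fst (g b)) /\ (snd (P i b) -> snd (g b))) (seq 0 n)).
  { eapply Forall_impl; [|exact Hk']. intros i (p & g & H1 & H2).
    (* [lev] has no outer polarity, so that of [expr] is absorbed by a disjunction of the formula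
       with itself, at the cost of one level. *)
    exists (or_sg (neg_if p g) (neg_if p g)). split; [now constructor|]. intros b.
    specialize (H2 b). unfold or_sg, neg_if. simpl. tauto. }
  apply Forall_choice in Hc. destruct Hc as [fs Hfs]. exists (S k), fs. split; [|split].
  - apply Forall2_length in Hfs. now rewrite length_seq in Hfs.
  - clear -Hfs. induction Hfs; constructor; auto. apply H.
  - intros x Hx. eapply Forall2_impl; [|exact Hfs]. intros i g [_ Hg]. specialize (Hg (nb x)).
    split; intros Hi; apply Hg; exists x; auto.
Qed.

(** [B] is known only through its concretization. Replacing one coordinate of [x0] by an endpoint
    gives a point of the box, hence of the neighbourhood; [Top] is impossible because it would admit
    NaN. *)
Lemma box_holds x0 B : D x0 -> Forall (valid_itv E M) B ->
  (forall x, gamma_box E M B x <-> inN E M d delta x0 x) ->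
  Forall2 holdsI (map (nb x0) (seq 0 d)) B.
Proof.
  intros H0 HV HB. pose proof (proj2 (HB x0) (inN_self x0 H0)) as G.
  apply Forall2_map_l.
  assert (Hset : forall j v I, nth_error B j = Some I -> in_gamma E M I v -> (j < d)%nat ->
            exists r, v = EF r /\ nb x0 j r).
  { intros j v I HI Hv Hj.
    assert (Gx : gamma_box E M B (firstn j x0 ++ v :: skipn (S j) x0)).
    { clear -G HI Hv. revert j HI. induction G as [|I0 y B x0 Hy HG IH]; intros j HI.
      - now destruct j.
      - destruct j as [|j]; simpl in *.
        + injection HI as ->. constructor; auto.
        + constructor; auto. now apply IH. }
    apply HB in Gx. apply inN_iff in Gx; auto.
    destruct (Forall2_seq_inv _ _ _ _ Gx) as [_ Hn]. destruct (Hn j Hj) as (a & E1 & E2).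
    destruct (HD x0 H0) as [L0 _].
    rewrite nth_error_app2 in E1 by (rewrite length_firstn; lia).
    replace (j - length (firstn j x0))%nat with 0%nat in E1 by (rewrite length_firstn; lia).
    simpl in E1. injection E1 as <-. exact E2. }
  assert (LB : length B = d).
  { apply Forall2_length in G. destruct (HD x0 H0) as [L0 _]. congruence. }
  apply Forall2_seq; auto. intros j Hj. simpl.
  destruct (nth_error B j) as [I|] eqn:EI; [|apply nth_error_None in EI; lia].
  exists I. split; auto. rewrite Forall_forall in HV.
  specialize (HV I (nth_error_In _ _ EI)). destruct I as [a b|].
  - destruct HV as (Va & Vb & Na & Nb & Hab).
    assert (ra : le_ext a a) by (destruct a; simpl in *; auto; lra).
    assert (rb : le_ext b b) by (destruct b; simpl in *; auto; lra).
    destruct (Hset j a _ EI) as (r & -> & Hr); [simpl; auto|auto|].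
    destruct (Hset j b _ EI) as (s & -> & Hs); [simpl; auto|auto|].
    exists r, s. auto.
  - destruct (Hset j ENaN _ EI) as (r & Hr & _); [simpl; auto|auto|discriminate].
Qed.

End Classifier.
End Floats.

Theorem theorem2 (E M : nat) (HE : (5 <= E)%nat) (HM : (3 <= M)%nat)
  (HEM : (M <= 2 ^ (E - 1))%nat)
  (d n : nat) (delta : R) (Hdelta : 0 < delta)
  (D : list ext -> Prop) (HD : forall x, D x -> inX E M d x)
  (cls : list ext -> nat) (Hcls : is_class n cls)
  (f : list ext -> list ext) (Hf : forall x, inX E M d x -> inFvec E M n (f x))
  (Hrob : robust E M d cls f delta D)
  (sigma : ext -> ext) (Hsigma : forall x, inFbar E M x -> inFbar E M (sigma x))
  (Hcond : condition1 E M sigma) :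
  exists ls : list layer,
    wf_net E M d ls n /\
    provably_robust E M d cls sigma ls delta D /\
    forall x, D x -> cls (eval_net E M sigma ls x) = cls (f x).
Proof.
  destruct (network_exists E M HE HM HEM sigma d Hsigma Hcond) as (lo & hi & Hlt & Hnet).
  destruct (classifier_formulas E M HE HM HEM d n delta Hdelta D HD cls f Hrob) as (k & fs & Hl & Hlev & Hfs).
  destruct (Hnet k fs Hlev) as (ls & Hwf & Hev). rewrite Hl in Hwf.
  assert (Hi : forall x, D x -> (cls (f x) < n)%nat).
  { intros x Hx. destruct (Hf x (HD x Hx)) as [H1 H2]. apply Hcls; auto.
    eapply Forall_impl; [|exact H2]. intros v (r & -> & _). discriminate. }
  exists ls. split; [auto|]. split.
  - intros x0 H0 B HV HB.
    assert (Hc : forall y, gamma_box E M (eval_sharp E M sigma ls B) y -> cls y = cls (f x0)).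
    { intros y Hy. destruct (Hev (nb E M delta x0) (nb_good E M d delta x0)) as [_ HI].
      specialize (HI B (box_holds E M HE HM HEM d delta Hdelta D HD x0 B H0 HV HB)).
      apply (Forall2_map_l (fun g => decided E M lo hi (g (nb E M delta x0)))) in HI. apply class_decided with n lo hi; auto.
      eapply Forall2_comp; [exact (Hfs x0 H0)| |].
      - eapply Forall2_comp with (S := fun g v => exists r, v = EF r /\
          (fst (g (nb E M delta x0)) -> hi <= r) /\ (snd (g (nb E M delta x0)) -> r <= lo)); [exact HI|exact Hy|].
        intros g I v (a & b & -> & Hab & (_ & A1 & A2) & (_ & B1 & B2)) (_ & L1 & L2).
        (* The endpoints are finite, which excludes infinities and NaN for a value between them. *)
        destruct v as [r| | |]; simpl in L1, L2; try tauto. exists r. split; auto.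
        split; intros T; [specialize (A1 T)|specialize (B2 T)]; lra.
      - intros i g v [G1 G2] (r & -> & R1 & R2). exists r. auto. }
    intros y y' Hy Hy'. now rewrite (Hc y Hy), (Hc y' Hy').
  - intros x Hx. destruct (Hev (nb E M delta x) (nb_good E M d delta x)) as [HC _].
    assert (Hself : Forall2 (holdsC) (map (nb E M delta x) (seq 0 d)) x).
    { apply Forall2_map_l. apply (nb_self E M HE HM HEM d delta Hdelta D HD x Hx). }
    specialize (HC x Hself). apply (Forall2_map_l (fun g => decided E M lo hi (g (nb E M delta x)))) in HC. apply class_decided with n lo hi; auto.
    eapply Forall2_comp; [exact (Hfs x Hx)|exact HC|].
    intros i g v [G1 G2] (r & -> & _ & R1 & R2). exists r. auto.
Qed.
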